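(* If $K$ is a finite field, then every action of the (abstract) group $\mathrm{GL}(\mathrm{M}_{\infty}(K))$ by homeomorphisms on a non-empty metrizable compact space has a (global) fixed point.
   Context: For a unital ring $R$, $\mathrm{GL}(R)$ denotes its group of invertible elements. For a field $K$, the ring $\mathrm{M}_\infty(K)$ is defined as follows. Consider the inductive limit of the matrix rings $\mathrm{M}_{2^0}(K)\hookrightarrow\dots\hookrightarrow\mathrm{M}_{2^n}(K)\hookrightarrow\mathrm{M}_{2^{n+1}}(K)\hookrightarrow\dots$ along the unital embeddings $a\mapsto\begin{pmatrix}a&0\\0&a\end{pmatrix}$. These embeddings are isometric for the normalized rank metrics $(a,b)\mapsto \mathrm{rank}(a-b)/2^n$ on $\mathrm{M}_{2^n}(K)$, which therefore jointly extend to a metric on the inductive limit; $\mathrm{M}_\infty(K)$ is the metric completion, with the ring operations extended by continuity. An action by homeomorphisms is a group action such that each group element acts by a homeomorphism; no continuity in the group variable is assumed. A fixed point is a point fixed by every element of the group. *)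

(* Defs.v *)
From HB Require Import structures.
From mathcomp Require Import all_boot all_order all_algebra.
From mathcomp Require Import all_classical all_reals all_analysis.
From mathcomp Require Import generic_quotient ring_quotient ring.

Set Implicit Arguments.
Unset Strict Implicit.
Unset Printing Implicit Defensive.

Import Order.TTheory GRing.Theory Num.Theory.
Import numFieldNormedType.Exports.

Local Open Scope classical_set_scope.
Local Open Scope ring_scope.
Local Open Scope quotient_scope.

(* 2 ^ n, by a recursion that makes 'M_(pow2 n.+1) convertible to
   'M_(pow2 n + pow2 n), so that block matrices need no cast *)
Fixpoint pow2 (n : nat) : nat := if n is m.+1 then (pow2 m + pow2 m)%N else 1%N.

Lemma pow2E n : pow2 n = (2 ^ n)%N.
Proof. by elim: n => //= n ->; rewrite addnn -mul2n expnS. Qed.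

Section Embeddings.
Variable K : fieldType.

Definition dup m (a : 'M[K]_m) : 'M[K]_(m + m) := block_mx a 0 0 a.

(* For n <= N this is the composite of the maps [dup] from level n up to
   level N (lemmas ext_id and extS); for N < n it is a junk value *)
Fixpoint ext (n N : nat) (a : 'M[K]_(pow2 n)) : 'M[K]_(pow2 N) :=
  match N with
  | N'.+1 => if (n <= N')%N then dup (ext N' a) else conform_mx 0 a
  | 0%N => conform_mx 0 a
  end.

Lemma ext_id n (a : 'M[K]_(pow2 n)) : ext n a = a.
Proof. by case: n a => [|n] a /=; rewrite ?ltnn conform_mx_id. Qed.

Lemma extS n N (a : 'M[K]_(pow2 n)) : (n <= N)%N -> ext N.+1 a = dup (ext N a).
Proof. by move=> /= ->. Qed.

Lemma ext_trans n m N (a : 'M[K]_(pow2 n)) : (n <= m)%N -> (m <= N)%N ->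
  ext N (ext m a) = ext N a.
Proof.
move=> nm; elim: N => [|N IH].
  by rewrite leqn0 => /eqP ?; subst m; rewrite ext_id.
rewrite leq_eqVlt => /orP[/eqP ?|]; first by subst m; rewrite ext_id.
by rewrite ltnS => mN; rewrite !extS ?IH// (leq_trans nm).
Qed.

Lemma dupD m (a b : 'M[K]_m) : dup (a + b) = dup a + dup b.
Proof. by rewrite /dup add_block_mx !addr0. Qed.

Lemma dupN m (a : 'M[K]_m) : dup (- a) = - dup a.
Proof. by rewrite /dup opp_block_mx !oppr0. Qed.

Lemma dupM m (a b : 'M[K]_m) : dup (a *m b) = dup a *m dup b.
Proof. by rewrite /dup mulmx_block !mulmx0 !mul0mx !addr0 add0r. Qed.

Lemma dup0 m : dup (0 : 'M[K]_m) = 0.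
Proof. by rewrite /dup block_mx0. Qed.

Lemma dup1 m : dup (1%:M : 'M[K]_m) = 1%:M.
Proof. by rewrite /dup -scalar_mx_block. Qed.

Lemma rank_dup m (a : 'M[K]_m) : \rank (dup a) = (\rank a + \rank a)%N.
Proof. by rewrite /dup rank_diag_block_mx. Qed.

Lemma level_ind n (P : nat -> Prop) : P n ->
  (forall N, (n <= N)%N -> P N -> P N.+1) -> forall N, (n <= N)%N -> P N.
Proof.
move=> Pn PS; elim=> [|N IH]; first by rewrite leqn0 => /eqP <-.
by rewrite leq_eqVlt => /orP[/eqP <-//|nN]; apply: PS => //; exact: IH.
Qed.

Lemma extD n N (a b : 'M[K]_(pow2 n)) : (n <= N)%N ->
  ext N (a + b) = ext N a + ext N b.
Proof. by move: N; apply: level_ind => [|N nN IH]; rewrite ?ext_id// !extS// IH dupD. Qed.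

Lemma extN n N (a : 'M[K]_(pow2 n)) : (n <= N)%N -> ext N (- a) = - ext N a.
Proof. by move: N; apply: level_ind => [|N nN IH]; rewrite ?ext_id// !extS// IH dupN. Qed.

Lemma extM n N (a b : 'M[K]_(pow2 n)) : (n <= N)%N ->
  ext N (a *m b) = ext N a *m ext N b.
Proof. by move: N; apply: level_ind => [|N nN IH]; rewrite ?ext_id// !extS// IH dupM. Qed.

Lemma ext0 n N : (n <= N)%N -> ext N (0 : 'M[K]_(pow2 n)) = 0.
Proof. by move: N; apply: level_ind => [|N nN IH]; rewrite ?ext_id// !extS// IH dup0. Qed.

Lemma ext1 n N : (n <= N)%N -> ext N (1%:M : 'M[K]_(pow2 n)) = 1%:M.
Proof. by move: N; apply: level_ind => [|N nN IH]; rewrite ?ext_id// !extS// IH dup1. Qed.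

Lemma ext_inj n N : (n <= N)%N -> injective (@ext n N).
Proof.
elim: N => [|N IH].
  by rewrite leqn0 => /eqP ? a b; subst; rewrite !ext_id.
rewrite leq_eqVlt => /orP[/eqP ? a b|]; first by subst; rewrite !ext_id.
rewrite ltnS => nN a b; rewrite !extS// /dup => /eq_block_mx[+ _ _ _].
exact: IH.
Qed.

Lemma rank_ext n N (a : 'M[K]_(pow2 n)) : (n <= N)%N ->
  (\rank (ext N a) * pow2 n = \rank a * pow2 N)%N.
Proof.
by move: N; apply: level_ind => [|N nN IH]; rewrite ?ext_id// extS// rank_dup mulnDl IH//= mulnDr.
Qed.

End Embeddings.

(* The inductive limit. The field R of reals is a parameter of the type because
   the metric below takes its values in it. *)
Section Limit.
Variables (R : realType) (K : fieldType).

Definition stage := {n : nat & 'M[K]_(pow2 n)}.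
Definition at_level N (x : stage) : 'M[K]_(pow2 N) := ext N (tagged x).

Definition stage_eq (x y : stage) : bool :=
  at_level (maxn (tag x) (tag y)) x == at_level (maxn (tag x) (tag y)) y.

Lemma stage_eqP N x y : (tag x <= N)%N -> (tag y <= N)%N ->
  stage_eq x y = (at_level N x == at_level N y).
Proof.
move=> xN yN; have mN : (maxn (tag x) (tag y) <= N)%N by rewrite geq_max xN.
rewrite /stage_eq -(inj_eq (ext_inj (N := N) mN)) /at_level !ext_trans//.
  exact: leq_maxr.
exact: leq_maxl.
Qed.

Lemma stage_eq_equiv : equiv_class_of stage_eq.
Proof.
split=> [x|x y|y x z].
- by rewrite /stage_eq.
- by rewrite /stage_eq maxnC eq_sym.
pose N := maxn (tag x) (maxn (tag y) (tag z)).
have xN : (tag x <= N)%N by rewrite leq_maxl.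
have yN : (tag y <= N)%N by rewrite !leq_max leqnn orbT.
have zN : (tag z <= N)%N by rewrite !leq_max leqnn !orbT.
by rewrite !(@stage_eqP N)// => /eqP-> /eqP->.
Qed.

Canonical stage_eq_rel := EquivRelPack stage_eq_equiv.
Canonical stage_eq_enc := defaultEncModRel stage_eq.

Definition matlim (_ : realType) := {eq_quot stage_eq}.
Local Notation D := (matlim R).
HB.instance Definition _ := EqQuotient.on D.
HB.instance Definition _ := Choice.on D.

(* the canonical map of level n into the limit *)
Definition in_lim n (a : 'M[K]_(pow2 n)) : D := \pi_D (Tagged _ a : stage).

Definition stage_op2 (f : forall n, 'M[K]_(pow2 n) -> 'M[K]_(pow2 n) -> 'M[K]_(pow2 n))
    (x y : stage) : stage :=
  Tagged (fun n => 'M[K]_(pow2 n))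
    (f (maxn (tag x) (tag y)) (at_level _ x) (at_level _ y)).

Definition stage_zero : stage := Tagged (fun n => 'M[K]_(pow2 n)) (0 : 'M[K]_(pow2 0%N)).
Definition stage_one : stage := Tagged (fun n => 'M[K]_(pow2 n)) (1%:M : 'M[K]_(pow2 0%N)).
Definition stage_opp (x : stage) : stage :=
  Tagged (fun n => 'M[K]_(pow2 n)) (- tagged x).
Definition stage_add := stage_op2 (fun n a b => a + b).
Definition stage_mul := stage_op2 (fun n a b => a *m b).

Lemma at_level_opp N x : (tag x <= N)%N -> at_level N (stage_opp x) = - at_level N x.
Proof. exact: extN. Qed.

Lemma at_level_add N x y : (tag x <= N)%N -> (tag y <= N)%N ->
  at_level N (stage_add x y) = at_level N x + at_level N y.
Proof.
move=> xN yN; rewrite {1}/at_level /= extD ?geq_max ?xN//.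
by rewrite /at_level !ext_trans ?geq_max ?xN ?leq_maxl ?leq_maxr.
Qed.

Lemma at_level_mul N x y : (tag x <= N)%N -> (tag y <= N)%N ->
  at_level N (stage_mul x y) = at_level N x *m at_level N y.
Proof.
move=> xN yN; rewrite {1}/at_level /= extM ?geq_max ?xN//.
by rewrite /at_level !ext_trans ?geq_max ?xN ?leq_maxl ?leq_maxr.
Qed.

Lemma at_level0 N : at_level N stage_zero = 0. Proof. exact: ext0. Qed.
Lemma at_level1 N : at_level N stage_one = 1%:M. Proof. exact: ext1. Qed.

(* equality in the limit is equality at all sufficiently high levels *)
Lemma matlim_eqP M x y : (forall N, (M <= N)%N -> (tag x <= N)%N ->
   (tag y <= N)%N -> at_level N x = at_level N y) -> \pi_D x = \pi_D y.
Proof.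
move=> H; apply/eqP; rewrite piE/=.
pose N := maxn M (maxn (tag x) (tag y)).
have MN : (M <= N)%N by rewrite leq_maxl.
have xN : (tag x <= N)%N by rewrite !leq_max leqnn orbT.
have yN : (tag y <= N)%N by rewrite !leq_max leqnn !orbT.
by rewrite (@stage_eqP N)// H.
Qed.

Lemma matlim_eqE N x y : (tag x <= N)%N -> (tag y <= N)%N ->
  \pi_D x = \pi_D y -> at_level N x = at_level N y.
Proof. by move=> xN yN /eqP; rewrite piE/= (stage_eqP xN yN) => /eqP. Qed.

Definition lim_zero : D := lift_cst D stage_zero.
Definition lim_one : D := lift_cst D stage_one.
Definition lim_opp := lift_op1 D stage_opp.
Definition lim_add := lift_op2 D stage_add.
Definition lim_mul := lift_op2 D stage_mul.

Canonical pi_lim_zero := PiConst lim_zero.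
Canonical pi_lim_one := PiConst lim_one.

Lemma pi_opp : {morph \pi_D : x / stage_opp x >-> lim_opp x}.
Proof.
move=> x; unlock lim_opp.
apply: (@matlim_eqP (maxn (tag x) (tag (repr (\pi_D x))))) => N.
rewrite geq_max => /andP[xN rN] _ _; rewrite !at_level_opp//; congr (- _).
by apply: matlim_eqE => //; rewrite reprK.
Qed.
Canonical pi_opp_morph := PiMorph1 pi_opp.

Lemma pi_add : {morph \pi_D : x y / stage_add x y >-> lim_add x y}.
Proof.
move=> x y; unlock lim_add.
apply: (@matlim_eqP (maxn (maxn (tag x) (tag (repr (\pi_D x))))
  (maxn (tag y) (tag (repr (\pi_D y)))))) => N.
rewrite !geq_max => /andP[/andP[xN rN] /andP[yN sN]] _ _.
by rewrite !at_level_add//; congr (_ + _); apply: matlim_eqE => //; rewrite reprK.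
Qed.
Canonical pi_add_morph := PiMorph2 pi_add.

Lemma pi_mul : {morph \pi_D : x y / stage_mul x y >-> lim_mul x y}.
Proof.
move=> x y; unlock lim_mul.
apply: (@matlim_eqP (maxn (maxn (tag x) (tag (repr (\pi_D x))))
  (maxn (tag y) (tag (repr (\pi_D y)))))) => N.
rewrite !geq_max => /andP[/andP[xN rN] /andP[yN sN]] _ _.
by rewrite !at_level_mul//; congr (_ *m _); apply: matlim_eqE => //; rewrite reprK.
Qed.
Canonical pi_mul_morph := PiMorph2 pi_mul.

Ltac lim_tac M := apply: (@matlim_eqP M) => N; rewrite !geq_max;
  let H := fresh in move=> H _ _;
  repeat match goal with H : is_true (_ && _) |- _ => case/andP: H => ? ? end;
  rewrite ?(at_level_add, at_level_mul, at_level_opp, at_level0, at_level1)//=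
    ?geq_max; repeat (apply/andP; split); try assumption.

Lemma lim_addA : associative lim_add.
Proof.
move=> x y z; rewrite -[x]reprK -[y]reprK -[z]reprK !piE.
by lim_tac (maxn (maxn (tag (repr x)) (tag (repr y))) (tag (repr z))); rewrite addrA.
Qed.

Lemma lim_addC : commutative lim_add.
Proof.
move=> x y; rewrite -[x]reprK -[y]reprK !piE.
by lim_tac (maxn (tag (repr x)) (tag (repr y))); rewrite addrC.
Qed.

Lemma lim_add0 : left_id lim_zero lim_add.
Proof.
by move=> x; rewrite -[x]reprK !piE; lim_tac (maxn 0 (tag (repr x))); rewrite add0r.
Qed.

Lemma lim_addN : left_inverse lim_zero lim_opp lim_add.
Proof.
by move=> x; rewrite -[x]reprK !piE; lim_tac (maxn 0 (tag (repr x))); rewrite addNr.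
Qed.

HB.instance Definition _ := GRing.isZmodule.Build D lim_addA lim_addC lim_add0 lim_addN.

Lemma lim_mulA : associative lim_mul.
Proof.
move=> x y z; rewrite -[x]reprK -[y]reprK -[z]reprK !piE.
by lim_tac (maxn (maxn (tag (repr x)) (tag (repr y))) (tag (repr z))); rewrite mulmxA.
Qed.

Lemma lim_mul1l : left_id lim_one lim_mul.
Proof.
by move=> x; rewrite -[x]reprK !piE; lim_tac (maxn 0 (tag (repr x))); rewrite mul1mx.
Qed.

Lemma lim_mul1r : right_id lim_one lim_mul.
Proof.
by move=> x; rewrite -[x]reprK !piE; lim_tac (maxn 0 (tag (repr x))); rewrite mulmx1.
Qed.

Lemma lim_mulDl : left_distributive lim_mul lim_add.
Proof.
move=> x y z; rewrite -[x]reprK -[y]reprK -[z]reprK !piE.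
by lim_tac (maxn (maxn (tag (repr x)) (tag (repr y))) (tag (repr z))); rewrite mulmxDl.
Qed.

Lemma lim_mulDr : right_distributive lim_mul lim_add.
Proof.
move=> x y z; rewrite -[x]reprK -[y]reprK -[z]reprK !piE.
by lim_tac (maxn (maxn (tag (repr x)) (tag (repr y))) (tag (repr z))); rewrite mulmxDr.
Qed.

Lemma lim_1neq0 : lim_one != lim_zero.
Proof.
rewrite !piE/= (@stage_eqP 0)// at_level0 at_level1.
by apply/eqP => /matrixP/(_ ord0 ord0)/eqP; rewrite !mxE/= oner_eq0.
Qed.

HB.instance Definition _ := GRing.Zmodule_isNzRing.Build D
  lim_mulA lim_mul1l lim_mul1r lim_mulDl lim_mulDr lim_1neq0.

Lemma in_limD n (a b : 'M[K]_(pow2 n)) : in_lim (a + b) = in_lim a + in_lim b.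
Proof.
rewrite /in_lim -[RHS]pi_add; apply: (@matlim_eqP n) => N nN _ _.
by rewrite at_level_add// /at_level/= extD.
Qed.

Lemma in_limM n (a b : 'M[K]_(pow2 n)) : in_lim (a *m b) = in_lim a * in_lim b.
Proof.
rewrite /in_lim -[RHS]pi_mul; apply: (@matlim_eqP n) => N nN _ _.
by rewrite at_level_mul// /at_level/= extM.
Qed.

Lemma in_lim1 n : in_lim (1%:M : 'M[K]_(pow2 n)) = 1.
Proof.
have -> : 1 = \pi_D stage_one by rewrite piE.
by apply: (@matlim_eqP n) => N nN _ _; rewrite at_level1 /at_level/= ext1.
Qed.

Lemma in_limN n (a : 'M[K]_(pow2 n)) : in_lim (- a) = - in_lim a.
Proof. by rewrite /in_lim -[RHS]pi_opp. Qed.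

Lemma in_lim_dup n (a : 'M[K]_(pow2 n)) :
  in_lim (dup a : 'M[K]_(pow2 n.+1)) = in_lim a.
Proof.
apply: (@matlim_eqP n.+1) => N nN _ _.
by rewrite /at_level/= -(ext_trans a (leqnSn n) nN) extS// ext_id.
Qed.

Lemma in_lim_surj (x : D) : exists n (a : 'M[K]_(pow2 n)), x = in_lim a.
Proof.
by exists (tag (repr x)), (tagged (repr x)); rewrite -{1}[x]reprK; case: (repr x).
Qed.

(* two elements of the limit have representatives at a common level *)
Lemma in_lim_surj2 (x y : D) :
  exists n (a b : 'M[K]_(pow2 n)), x = in_lim a /\ y = in_lim b.
Proof.
pose N := maxn (tag (repr x)) (tag (repr y)).
have H z : (tag (repr z) <= N)%N -> z = in_lim (at_level N (repr z)).
  move=> zN; rewrite -{1}[z]reprK; apply: (@matlim_eqP N) => M NM _ _.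
  by rewrite {2}/at_level/= /at_level ext_trans.
by exists N, (at_level N (repr x)), (at_level N (repr y)); split;
  apply: H; rewrite leq_max leqnn ?orbT.
Qed.

(* the normalized rank; by nrankE it does not depend on the representative *)
Definition nrank (x : D) : R :=
  (\rank (tagged (repr x)))%:R / (2 ^ tag (repr x))%:R.

Lemma nrankE n (a : 'M[K]_(pow2 n)) :
  nrank (in_lim a) = (\rank a)%:R / (2 ^ n)%:R.
Proof.
have p0 m : (pow2 m)%:R != 0 :> R by rewrite pow2E pnatr_eq0 expn_eq0.
rewrite /nrank -!pow2E; set r := repr _; apply/eqP; rewrite eqr_div//.
pose N := maxn (tag r) n.
have rN : (tag r <= N)%N by rewrite leq_maxl.
have nN : (n <= N)%N by rewrite leq_maxr.
have e : ext N (tagged r) = ext N a.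
  by apply: (@matlim_eqE N r (Tagged _ a)) => //; rewrite reprK.
have := rank_ext (tagged r) rN; rewrite e => e1; have e2 := rank_ext a nN.
rewrite -!natrM; apply/eqP; congr (_%:R); apply/eqP.
have pN : (0 < pow2 N)%N by rewrite pow2E expn_gt0.
by rewrite -(eqn_pmul2r pN) mulnAC -e1 mulnAC e2 -!mulnA (mulnC (pow2 N)).
Qed.

Lemma nrank0 : nrank 0 = 0.
Proof.
have -> : 0 = in_lim (0 : 'M[K]_(pow2 0)) by rewrite /in_lim piE.
by rewrite nrankE mxrank0 mul0r.
Qed.

Lemma nrank1 : nrank 1 = 1.
Proof. by rewrite -(in_lim1 0) nrankE mxrank1 divr1. Qed.

Lemma nrank_eq0 x : nrank x = 0 -> x = 0.
Proof.
have [n [a ->]] := in_lim_surj x; rewrite nrankE => /eqP.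
rewrite mulf_eq0 invr_eq0 !pnatr_eq0 expn_eq0 /= orbF mxrank_eq0 => /eqP->.
by rewrite -[0 in LHS](subrr 0) in_limD in_limN subrr.
Qed.

Lemma nrankN x : nrank (- x) = nrank x.
Proof. by have [n [a ->]] := in_lim_surj x; rewrite -in_limN !nrankE mxrank_opp. Qed.

Lemma nrankD x y : nrank (x + y) <= nrank x + nrank y.
Proof.
have [n [a [b [-> ->]]]] := in_lim_surj2 x y; rewrite -in_limD !nrankE -mulrDl.
by rewrite ler_wpM2r ?invr_ge0// -natrD ler_nat mxrank_add.
Qed.

Lemma nrankMl x y : nrank (x * y) <= nrank x.
Proof.
have [n [a [b [-> ->]]]] := in_lim_surj2 x y; rewrite -in_limM !nrankE.
by rewrite ler_wpM2r ?invr_ge0// ler_nat mxrankM_maxl.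
Qed.

Lemma nrankMr x y : nrank (x * y) <= nrank y.
Proof.
have [n [a [b [-> ->]]]] := in_lim_surj2 x y; rewrite -in_limM !nrankE.
by rewrite ler_wpM2r ?invr_ge0// ler_nat mxrankM_maxr.
Qed.

Definition rank_dist (x y : D) : R := nrank (x - y).

Lemma rank_distxx x : rank_dist x x = 0.
Proof. by rewrite /rank_dist subrr nrank0. Qed.
Lemma rank_dist_eq0 x y : rank_dist x y = 0 -> x = y.
Proof. by move/nrank_eq0/eqP; rewrite subr_eq0 => /eqP. Qed.
Lemma rank_distC x y : rank_dist x y = rank_dist y x.
Proof. by rewrite /rank_dist -nrankN opprB. Qed.
Lemma rank_dist_triangle y x z : rank_dist x z <= rank_dist x y + rank_dist y z.
Proof. by rewrite /rank_dist (le_trans _ (nrankD _ _))// addrA subrK. Qed.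

HB.instance Definition _ := isMetric.Build R D
  rank_distxx rank_dist_eq0 rank_distC rank_dist_triangle.

Lemma mdist_in_lim n (a b : 'M[K]_(pow2 n)) :
  mdist (in_lim a) (in_lim b) = (\rank (a - b))%:R / (2 ^ n)%:R.
Proof. by rewrite -nrankE in_limD in_limN. Qed.

End Limit.

Section MetricSequences.
Variables (R : realType) (T : metricType R).

Lemma cauchy_seqP (u : nat -> T) : cauchy (u @ \oo) <->
  forall e : R, 0 < e ->
    exists N, forall m n, (N <= m)%N -> (N <= n)%N -> mdist (u m) (u n) < e.
Proof.
split=> [/(proj1 (cauchyP _)) H e e0|H].
  have e20 : 0 < e / 2 by rewrite divr_gt0.
  have [x [N _ Nx]] := H _ e20; exists N => m n Nm Nn.
  have := Nx m Nm; have := Nx n Nn; rewrite /= !ballEmdist/= => xn xm.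
  rewrite (le_lt_trans (metric_triangle _ x _))// [ltRHS]splitr ltrD//.
  by rewrite metric_sym.
apply/cauchyP => e e0; have [N HN] := H e e0.
by exists (u N); exists N => // n /= Nn; rewrite ballEmdist /=; apply: HN.
Qed.

Lemma cvg_seqP (u : nat -> T) (l : T) : u @ \oo --> l <->
  forall e : R, 0 < e -> exists N, forall n, (N <= n)%N -> mdist l (u n) < e.
Proof.
split=> [/cvg_ballP H e e0|H].
  have [N _ HN] := H e e0.
  by exists N => n Nn; have := HN n Nn; rewrite /= ballEmdist.
apply/cvg_ballP => e e0; have [N HN] := H e e0.
by exists N => // n /= Nn; rewrite ballEmdist; apply: HN.
Qed.

End MetricSequences.

(* The metric completion as a ring: Cauchy sequences modulo the two-sided
   ideal of sequences converging to 0 *)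
Section CauchySequences.
Variables (R : realType) (K : fieldType).
Local Notation D := (matlim K R).

Lemma mdistE (x y : D) : mdist x y = nrank (x - y). Proof. by []. Qed.

Lemma nrank_ge0 (x : D) : 0 <= nrank x.
Proof. by rewrite divr_ge0. Qed.

Definition is_cauchy : pred (nat -> D) := fun u => `[< cauchy (u @ \oo) >].

Lemma is_cauchy_subring : subring_closed is_cauchy.
Proof.
split=> [|u v /asboolP/cauchy_seqP cu /asboolP/cauchy_seqP cv
        |u v /asboolP/cauchy_seqP cu /asboolP/cauchy_seqP cv];
  apply/asboolP/cauchy_seqP => e e0.
- by exists 0%N => m n _ _; rewrite mdistE subrr nrank0.
- have e20 : 0 < e / 2 by rewrite divr_gt0.
  have [[N HN] [M HM]] := (cu _ e20, cv _ e20).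
  exists (maxn N M) => m n; rewrite !geq_max => /andP[Nm Mm] /andP[Nn Mn].
  have -> : mdist ((u - v) m) ((u - v) n) =
      nrank ((u m - u n) + - (v m - v n)).
    by rewrite mdistE opprD opprK addrACA opprD opprK.
  rewrite (le_lt_trans (nrankD _ _))// nrankN [ltRHS]splitr.
  by rewrite ltrD// -mdistE; [apply: HN|apply: HM].
- have e20 : 0 < e / 2 by rewrite divr_gt0.
  have [[N HN] [M HM]] := (cu _ e20, cv _ e20).
  exists (maxn N M) => m n; rewrite !geq_max => /andP[Nm Mm] /andP[Nn Mn].
  have -> : mdist ((u * v) m) ((u * v) n) =
      nrank ((u m - u n) * v m + u n * (v m - v n)).
    by rewrite mdistE mulrBl mulrBr addrA subrK.
  rewrite (le_lt_trans (nrankD _ _))// [ltRHS]splitr ltrD//.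
    by rewrite (le_lt_trans (nrankMl _ _))// -mdistE HN.
  by rewrite (le_lt_trans (nrankMr _ _))// -mdistE HM.
Qed.

Definition cauchy_sequence := {u : nat -> D | is_cauchy u}.
HB.instance Definition _ := SubChoice.on cauchy_sequence.
HB.instance Definition _ :=
  GRing.SubChoice_isSubNzRing.Build (nat -> D) is_cauchy cauchy_sequence
    is_cauchy_subring.
Local Notation C := cauchy_sequence.

Lemma seq0E n : val (0 : C) n = 0. Proof. by rewrite rmorph0. Qed.
Lemma seq1E n : val (1 : C) n = 1. Proof. by rewrite rmorph1. Qed.
Lemma seqNE (u : C) n : val (- u) n = - val u n.
Proof. by rewrite rmorphN. Qed.
Lemma seqDE (u v : C) n : val (u + v) n = val u n + val v n.
Proof. by rewrite rmorphD. Qed.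
Lemma seqBE (u v : C) n : val (u - v) n = val u n - val v n.
Proof. by rewrite rmorphB. Qed.
Lemma seqME (u v : C) n : val (u * v) n = val u n * val v n.
Proof. by rewrite rmorphM. Qed.

Definition null_sequence : {pred C} :=
  fun u => `[< val u n @[n --> \oo] --> (0 : D) >].

Lemma null_sequenceP (u : C) : reflect (forall e : R, 0 < e ->
    exists N, forall n, (N <= n)%N -> nrank (val u n) < e) (u \in null_sequence).
Proof.
rewrite unfold_in; apply: (iffP (asboolP _)) => [/cvg_seqP H e /H[N HN]|H].
  by exists N => n /HN; rewrite mdistE sub0r nrankN.
apply/cvg_seqP => e /H[N HN]; exists N => n /HN.
by rewrite mdistE sub0r nrankN.
Qed.

Lemma null_sequence_zmod : zmod_closed null_sequence.
Proof.
split=> [|u v /null_sequenceP hu /null_sequenceP hv]; apply/null_sequenceP => e e0.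
  by exists 0%N => n _; rewrite seq0E nrank0.
have e20 : 0 < e / 2 by rewrite divr_gt0.
have [[N HN] [M HM]] := (hu _ e20, hv _ e20).
exists (maxn N M) => n; rewrite !geq_max => /andP[Nn Mn].
rewrite seqBE (le_lt_trans (nrankD _ _))// nrankN [ltRHS]splitr.
by rewrite ltrD//; [apply: HN|apply: HM].
Qed.

HB.instance Definition _ :=
  GRing.isZmodClosed.Build C null_sequence null_sequence_zmod.

Lemma null_sequence_mull (u v : C) : v \in null_sequence -> u * v \in null_sequence.
Proof.
move=> /null_sequenceP hv; apply/null_sequenceP => e /hv[N HN].
by exists N => n Nn; rewrite seqME (le_lt_trans (nrankMr _ _))// HN.
Qed.

Lemma null_sequence_mulr (u v : C) : u \in null_sequence -> u * v \in null_sequence.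
Proof.
move=> /null_sequenceP hv; apply/null_sequenceP => e /hv[N HN].
by exists N => n Nn; rewrite seqME (le_lt_trans (nrankMl _ _))// HN.
Qed.

Lemma null_sequence1 : 1 \notin null_sequence.
Proof.
apply/negP => /null_sequenceP/(_ 1 ltr01)[N /(_ N (leqnn N))].
by rewrite seq1E nrank1 ltxx.
Qed.

End CauchySequences.

Definition Minf (R : realType) (K : fieldType) := Quotient.quot (@null_sequence R K).

Section MinfRing.
Variables (R : realType) (K : fieldType).
Local Notation D := (matlim K R).
Local Notation C := (cauchy_sequence R K).
Local Notation M := (Minf R K).

HB.instance Definition _ := EqQuotient.on M.
HB.instance Definition _ := Choice.on M.
HB.instance Definition _ := GRing.Zmodule.on M.

Lemma Minf_eqP (u v : C) : reflect (\pi_M u = \pi_M v) (u - v \in @null_sequence R K).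
Proof.
by rewrite (Quotient.idealrBE (@null_sequence R K)); exact: eqP.
Qed.

Definition Minf_one : M := \pi_M 1.
Definition Minf_mul := lift_op2 M *%R.

Lemma pi_MinfD (u v : C) : \pi_M u + \pi_M v = \pi_M (u + v).
Proof. by rewrite piE. Qed.

Lemma pi_MinfN (u : C) : - \pi_M u = \pi_M (- u).
Proof. by rewrite piE. Qed.

Lemma pi_Minf_mul (u v : C) : Minf_mul (\pi_M u) (\pi_M v) = \pi_M (u * v).
Proof.
unlock Minf_mul; apply/Minf_eqP.
set u' := repr (\pi_M u); set v' := repr (\pi_M v).
have -> : u' * v' - u * v = (u' - u) * v' + u * (v' - v).
  by rewrite mulrBl mulrBr addrA subrK.
rewrite rpredD//.
  by apply/null_sequence_mulr/Minf_eqP; rewrite reprK.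
by apply/null_sequence_mull/Minf_eqP; rewrite reprK.
Qed.

Lemma Minf_mulA : associative Minf_mul.
Proof.
by move=> x y z; rewrite -[x]reprK -[y]reprK -[z]reprK !pi_Minf_mul mulrA.
Qed.

Lemma Minf_mul1l : left_id Minf_one Minf_mul.
Proof. by move=> x; rewrite -[x]reprK pi_Minf_mul mul1r. Qed.

Lemma Minf_mul1r : right_id Minf_one Minf_mul.
Proof. by move=> x; rewrite -[x]reprK pi_Minf_mul mulr1. Qed.

Lemma Minf_mulDl : left_distributive Minf_mul +%R.
Proof.
move=> x y z; rewrite -[x]reprK -[y]reprK -[z]reprK.
by rewrite !pi_Minf_mul !pi_MinfD pi_Minf_mul mulrDl.
Qed.

Lemma Minf_mulDr : right_distributive Minf_mul +%R.
Proof.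
move=> x y z; rewrite -[x]reprK -[y]reprK -[z]reprK.
by rewrite !pi_Minf_mul !pi_MinfD pi_Minf_mul mulrDr.
Qed.

Lemma Minf_1neq0 : Minf_one != 0.
Proof.
have -> : 0 = \pi_M 0 by rewrite piE.
by apply/eqP => /Minf_eqP; rewrite subr0 (negbTE (null_sequence1 R K)).
Qed.

HB.instance Definition _ := GRing.Zmodule_isNzRing.Build M
  Minf_mulA Minf_mul1l Minf_mul1r Minf_mulDl Minf_mulDr Minf_1neq0.

Lemma pi_MinfM (u v : C) : \pi_M u * \pi_M v = \pi_M (u * v).
Proof. exact: pi_Minf_mul. Qed.

Lemma pi_Minf1 : 1 = \pi_M 1. Proof. by []. Qed.

Definition Minf_unit : pred M := fun x => `[< exists y, y * x = 1 /\ x * y = 1 >].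

Definition Minf_inv (x : M) : M :=
  if pselect (exists y, y * x = 1 /\ x * y = 1) is left e then projT1 (cid e) else x.

Lemma Minf_mulVx : {in Minf_unit, left_inverse 1 Minf_inv *%R}.
Proof.
move=> x /asboolP xu; rewrite /Minf_inv; case: pselect => // e.
by case: (projT2 (cid e)).
Qed.

Lemma Minf_mulxV : {in Minf_unit, right_inverse 1 Minf_inv *%R}.
Proof.
move=> x /asboolP xu; rewrite /Minf_inv; case: pselect => // e.
by case: (projT2 (cid e)).
Qed.

Lemma Minf_unitP (x y : M) : y * x = 1 /\ x * y = 1 -> Minf_unit x.
Proof. by move=> xy; apply/asboolP; exists y. Qed.

Lemma Minf_inv_out : {in [predC Minf_unit], Minf_inv =1 id}.
Proof.
move=> x /negP xu; rewrite /Minf_inv; case: pselect => // e.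
by case: xu; apply/asboolP.
Qed.

HB.instance Definition _ := GRing.NzRing_hasMulInverse.Build M
  Minf_mulVx Minf_mulxV Minf_unitP Minf_inv_out.

(* the metric of the completion *)
Definition Minf_rank (x : M) : R := limn (fun n => nrank (val (repr x) n)).

Lemma dist_nrank (x y : D) : `|nrank x - nrank y| <= nrank (x - y).
Proof.
have h a b : nrank a - nrank b <= nrank (a - b).
  by rewrite lerBlDr; have := nrankD (a - b) b; rewrite subrK.
by rewrite ler_norml h andbT lerNl opprB -[nrank (x - y)]nrankN opprB h.
Qed.

Lemma Minf_rank_cvg (u : C) : nrank (val u n) @[n --> \oo] --> Minf_rank (\pi_M u).
Proof.
have cvgr (v : C) : cvgn (fun n => nrank (val v n)).
  apply/cauchy_cvgP/cauchy_exP => e e0.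
  have /asboolP/cauchy_seqP/(_ _ e0)[N HN] := valP v.
  exists (nrank (val v N)); exists N => // n /= Nn.
  by rewrite /ball/= (le_lt_trans (dist_nrank _ _))// -mdistE HN.
rewrite /Minf_rank; set v := repr _.
have /null_sequenceP uv : v - u \in @null_sequence R K.
  by apply/Minf_eqP; rewrite reprK.
suff : (fun n => nrank (val v n) - nrank (val u n)) @ \oo --> (0 : R).
  move=> h; rewrite -[X in _ --> X]subr0.
  rewrite (_ : (fun n => nrank (val u n)) = (fun n => nrank (val v n) -
    (nrank (val v n) - nrank (val u n)))); first exact: cvgB (cvgr v) h.
  by apply/funext => n; rewrite opprB addrC subrK.
apply/cvgr0Pnorm_lt => e /uv[N HN].
exists N => // n /= /HN; rewrite seqBE; apply: le_lt_trans.
exact: dist_nrank.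
Qed.

Local Arguments Minf_rank_cvg : clear implicits.

Lemma Minf_rankE (u : C) : Minf_rank (\pi_M u) = limn (fun n => nrank (val u n)).
Proof. by apply/esym/cvg_lim => //; exact: Minf_rank_cvg. Qed.

Lemma Minf_rank0 : Minf_rank 0 = 0.
Proof.
have -> : 0 = \pi_M 0 by rewrite piE.
rewrite Minf_rankE; under eq_fun do rewrite seq0E nrank0.
by rewrite lim_cst.
Qed.

Lemma Minf_rank_eq0 x : Minf_rank x = 0 -> x = 0.
Proof.
rewrite -[x]reprK; move: (repr x) => u u0.
have -> : 0 = \pi_M 0 by rewrite piE.
apply/Minf_eqP/null_sequenceP => e e0; rewrite subr0.
have /cvgr0Pnorm_lt/(_ _ e0)[N _ HN] : nrank (val u n) @[n --> \oo] --> (0 : R).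
  by rewrite -u0; exact: Minf_rank_cvg.
by exists N => n /HN /=; apply: le_lt_trans; exact: ler_norm.
Qed.

Lemma Minf_rankN x : Minf_rank (- x) = Minf_rank x.
Proof.
rewrite -[x]reprK; move: (repr x) => u; rewrite pi_MinfN !Minf_rankE.
by under eq_fun do rewrite seqNE nrankN.
Qed.

Lemma Minf_rankD x y : Minf_rank (x + y) <= Minf_rank x + Minf_rank y.
Proof.
rewrite -[x]reprK -[y]reprK; move: (repr x) (repr y) => u v; rewrite pi_MinfD.
apply: (ler_cvg_to (Minf_rank_cvg (u + v))
  (cvgD (Minf_rank_cvg u) (Minf_rank_cvg v))).
by apply: nearW => n; rewrite seqDE; exact: nrankD.
Qed.

Lemma Minf_rankMl x y : Minf_rank (x * y) <= Minf_rank x.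
Proof.
rewrite -[x]reprK -[y]reprK; move: (repr x) (repr y) => u v; rewrite pi_MinfM.
apply: (ler_cvg_to (Minf_rank_cvg (u * v)) (Minf_rank_cvg u)).
by apply: nearW => n; rewrite seqME; exact: nrankMl.
Qed.

Lemma Minf_rankMr x y : Minf_rank (x * y) <= Minf_rank y.
Proof.
rewrite -[x]reprK -[y]reprK; move: (repr x) (repr y) => u v; rewrite pi_MinfM.
apply: (ler_cvg_to (Minf_rank_cvg (u * v)) (Minf_rank_cvg v)).
by apply: nearW => n; rewrite seqME; exact: nrankMr.
Qed.

Definition Minf_dist (x y : M) : R := Minf_rank (x - y).

Lemma Minf_distxx x : Minf_dist x x = 0.
Proof. by rewrite /Minf_dist subrr Minf_rank0. Qed.
Lemma Minf_dist_eq0 x y : Minf_dist x y = 0 -> x = y.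
Proof. by move/Minf_rank_eq0/eqP; rewrite subr_eq0 => /eqP. Qed.
Lemma Minf_distC x y : Minf_dist x y = Minf_dist y x.
Proof. by rewrite /Minf_dist -Minf_rankN opprB. Qed.
Lemma Minf_dist_triangle y x z : Minf_dist x z <= Minf_dist x y + Minf_dist y z.
Proof. by rewrite /Minf_dist (le_trans _ (Minf_rankD _ _))// addrA subrK. Qed.

HB.instance Definition _ := isMetric.Build R M
  Minf_distxx Minf_dist_eq0 Minf_distC Minf_dist_triangle.

Lemma mdist_MinfE (x y : M) : mdist x y = Minf_rank (x - y). Proof. by []. Qed.

Lemma cst_is_cauchy (a : D) : is_cauchy (cst a).
Proof. by apply/asboolP/cauchy_seqP => e e0; exists 0%N => *; rewrite mdistxx. Qed.

Definition cst_seq (a : D) : C := exist _ (cst a) (cst_is_cauchy a).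

Definition in_Minf (a : D) : M := \pi_M (cst_seq a).

(* The lemmas below say that in_Minf is an isometric ring embedding with dense
   image in Minf R K, that Minf R K is complete, and that its operations are
   continuous for the metric *)
Lemma in_MinfB a b : in_Minf (a - b) = in_Minf a - in_Minf b.
Proof.
have e : cst_seq (a - b) = cst_seq a - cst_seq b
  by apply: val_inj; rewrite rmorphB.
by rewrite /in_Minf e -pi_MinfD -pi_MinfN.
Qed.

Lemma in_MinfM a b : in_Minf (a * b) = in_Minf a * in_Minf b.
Proof.
have e : cst_seq (a * b) = cst_seq a * cst_seq b
  by apply: val_inj; rewrite rmorphM.
by rewrite /in_Minf e -pi_MinfM.
Qed.

Lemma in_Minf1 : in_Minf 1 = 1.
Proof.
have e : cst_seq 1 = 1 by apply: val_inj; rewrite rmorph1.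
by rewrite /in_Minf e pi_Minf1.
Qed.

Lemma mdist_in_Minf a b : mdist (in_Minf a) (in_Minf b) = mdist a b.
Proof.
rewrite mdist_MinfE -in_MinfB /in_Minf Minf_rankE.
rewrite (_ : (fun n => _) = (fun=> nrank (a - b)) :> (nat -> R))//.
by rewrite lim_cst.
Qed.

Lemma in_Minf_dense (x : M) (e : R) : 0 < e -> exists a, mdist x (in_Minf a) < e.
Proof.
move=> e0; have e20 : 0 < e / 2 by rewrite divr_gt0.
have /asboolP/cauchy_seqP/(_ _ e20)[N HN] := valP (repr x).
exists (val (repr x) N); rewrite -{1}[x]reprK mdist_MinfE.
rewrite /in_Minf pi_MinfN pi_MinfD (@le_lt_trans _ _ (e / 2))//.
  apply: (ler_cvg_to (Minf_rank_cvg _) (cvg_cst (e / 2))).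
  by exists N => // n Nn; rewrite seqDE seqNE; apply/ltW/HN.
by rewrite ltr_pdivrMr// ltr_pMr// ltr1n.
Qed.

Lemma Minf_complete (x : nat -> M) : cauchy (x @ \oo) -> exists y : M, x @ \oo --> y.
Proof.
move=> /cauchy_seqP cx.
have ha k : exists a, mdist (x k) (in_Minf a) < k.+1%:R^-1.
  by apply: in_Minf_dense; rewrite invr_gt0.
pose a k := projT1 (cid (ha k)).
have xa k : mdist (x k) (in_Minf (a k)) < k.+1%:R^-1 by exact: projT2 (cid (ha k)).
have small (e : R) : 0 < e -> exists N, forall k, (N <= k)%N -> k.+1%:R^-1 < e.
  move=> e0; have [N _ HN] := near_infty_natSinv_lt (PosNum e0).
  by exists N => k /HN.
have ca : is_cauchy a.
  apply/asboolP/cauchy_seqP => e e0; have e30 : 0 < e / 3 by rewrite divr_gt0.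
  have [[N HN] [L HL]] := (small _ e30, cx _ e30).
  exists (maxn N L) => m n; rewrite !geq_max => /andP[Nm Lm] /andP[Nn Ln].
  rewrite -mdist_in_Minf (le_lt_trans (metric_triangle _ (x m) _))//.
  have -> : e = e / 3 + (e / 3 + e / 3) by field.
  rewrite ltrD//; first by rewrite metric_sym (lt_trans (xa m))// HN.
  rewrite (le_lt_trans (metric_triangle _ (x n) _))// ltrD//; first exact: HL.
  by rewrite (lt_trans (xa n))// HN.
pose y : M := \pi_M (exist _ a ca).
exists y; apply/cvg_seqP => e e0.
have e30 : 0 < e / 3 by rewrite divr_gt0.
have /asboolP/cauchy_seqP/(_ _ e30)[L HL] := ca.
have [N HN] := small _ e30.
exists (maxn N L) => k; rewrite geq_max => /andP[Nk Lk].
rewrite (le_lt_trans (metric_triangle _ (in_Minf (a k)) _))//.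
have -> : e = (e / 3 + e / 3) + e / 3 by field.
rewrite ltrD//; last by rewrite metric_sym (lt_trans (xa k))// HN.
rewrite (@le_lt_trans _ _ (e / 3)) ?ltrDl//.
rewrite mdist_MinfE /in_Minf /y pi_MinfN pi_MinfD.
apply: (ler_cvg_to (Minf_rank_cvg _) (cvg_cst (e / 3))).
by exists L => // n Ln; rewrite seqDE seqNE; apply/ltW/HL.
Qed.

Lemma mdist_MinfD (x y x' y' : M) :
  mdist (x + y) (x' + y') <= mdist x x' + mdist y y'.
Proof.
rewrite mdist_MinfE opprD addrACA.
exact: Minf_rankD.
Qed.

Lemma mdist_MinfM (x y x' y' : M) :
  mdist (x * y) (x' * y') <= mdist x x' + mdist y y'.
Proof.
rewrite mdist_MinfE.
have -> : x * y - x' * y' = (x - x') * y + x' * (y - y').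
  by rewrite mulrBl mulrBr addrA subrK.
by rewrite (le_trans (Minf_rankD _ _))// lerD ?Minf_rankMl ?Minf_rankMr.
Qed.

End MinfRing.

Definition GL (A : unitRingType) := {x : A | x \is a GRing.unit}.

Section GLGroup.
Variable A : unitRingType.
HB.instance Definition _ := SubChoice.on (GL A).

Definition GL_one : GL A := exist (fun x => x \is a GRing.unit) 1 (unitr1 A).
Lemma GL_mul_unit (g h : GL A) : val g * val h \is a GRing.unit.
Proof. by rewrite unitrMr (valP g, valP h). Qed.

Lemma GL_inv_unit (g : GL A) : (val g)^-1 \is a GRing.unit.
Proof. by rewrite unitrV (valP g). Qed.

Definition GL_mul (g h : GL A) : GL A := exist (fun x => x \is a GRing.unit) _ (GL_mul_unit g h).
Definition GL_inv (g : GL A) : GL A := exist (fun x => x \is a GRing.unit) _ (GL_inv_unit g).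

Lemma GL_mulA : associative GL_mul.
Proof. by move=> g h k; apply: val_inj; rewrite /= mulrA. Qed.
Lemma GL_mul1g : left_id GL_one GL_mul.
Proof. by move=> g; apply: val_inj; rewrite /= mul1r. Qed.
Lemma GL_mulg1 : right_id GL_one GL_mul.
Proof. by move=> g; apply: val_inj; rewrite /= mulr1. Qed.
Lemma GL_mulVg : left_inverse GL_one GL_inv GL_mul.
Proof. by move=> g; apply: val_inj; rewrite /= mulVr// (valP g). Qed.
Lemma GL_mulgV : right_inverse GL_one GL_inv GL_mul.
Proof. by move=> g; apply: val_inj; rewrite /= divrr// (valP g). Qed.

HB.instance Definition _ := isGroup.Build (GL A)
  GL_mulA GL_mul1g GL_mulg1 GL_mulVg GL_mulgV.

End GLGroup.

Definition is_action (G : groupType) (X : Type) (act : G -> X -> X) : Prop :=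
  (forall x, act 1%g x = x) /\
  (forall g h x, act (g * h)%g x = act g (act h x)).

Definition is_homeomorphism (X Y : topologicalType) (f : X -> Y) : Prop :=
  continuous f /\ exists f' : Y -> X, [/\ cancel f f', cancel f' f & continuous f'].

Definition is_metric (R : realType) (X : Type) (d : X -> X -> R) : Prop :=
  [/\ forall x, d x x = 0,
      forall x y, d x y = 0 -> x = y,
      forall x y, d x y = d y x &
      forall x y z, d x z <= d x y + d y z].

(* some metric induces the topology of X *)
Definition metrizable (R : realType) (X : topologicalType) : Prop :=
  exists d : X -> X -> R, is_metric d /\
    forall (x : X) (A : set X),
      nbhs x A <-> exists2 e : R, 0 < e & [set y | d x y < e] `<=` A.

(* Main.v *)
(* Measure g by its displacement l(g) = sup_y d(g y, y).  The maps of a compact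
   metric space form a separable space, so countably many translates of each set
   {l <= e} cover the group, and this alone makes l continuous at 1 for the rank
   metric: a diagonal argument over a sequence of orthogonal idempotents gives an
   idempotent e such that conjugation by GL(eAe) changes l by a bounded amount; a
   collision among uncountably many elements 1 + a with a^2 = 0, followed by a
   commutator, makes l small on all elementary matrices between small orthogonal
   idempotents under e; a swindle makes it small on GL(pAp) for some idempotent
   p <> 0; and a second diagonal argument conjugates any sequence of
   counterexamples to continuity into pAp.

   On GL_n(K), for K finite, functions that are 1-Lipschitz for the rank have
   variance at most 17 n.  With n = 2^N large, one piece of a finite cover of X by
   small sets is therefore close to h x and to a h x for all a in GL_(2^m)(K) and
   some h in GL_(2^N)(K), so that h x is almost fixed by GL_(2^m)(K).  A cluster
   point of such points is fixed by the dense subgroup of all GL_(2^m)(K), hence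
   by the whole group. *)
Require Import Defs.
From mathcomp Require Import all_boot all_order all_algebra.
From mathcomp Require Import all_classical all_reals all_analysis.
From mathcomp Require Import zify lra ring.
From Stdlib Require Ncring Ncring_tac.

Set Implicit Arguments.
Unset Strict Implicit.
Unset Printing Implicit Defensive.

Import Order.TTheory GRing.Theory Num.Theory.
Import numFieldNormedType.Exports.
Local Open Scope ring_scope.

(** * Computing in noncommutative rings *)

(** The group acts as an abstract group, so estimates in the rank metric say nothing about the
    action until displacement is tied to rank; this is why automatic continuity has to precede
    concentration. Completeness of the rank metric does the work of a Baire category argument: an
    element prescribed block by block along orthogonal idempotents of ranks 2^-n exists as a
    convergent sum, so its n-th block can be chosen against the n-th translate. This half uses only
    the axioms [rank_ring] and [length_function]. Regularity and primeness make idempotents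
    comparable by rank, so that small corners can be conjugated into one another. Since the cover
    exists for every e > 0, bounds by a fixed multiple of c are enough, and the constants 8, 12, 14
    * 12 = 168 and 170 merely count factors.

    Finiteness of K enters by counting: the variance refers to the uniform probability on the finite
    group GL_n(K). A normalized rank 2^-j is a rank n 2^-j for n = 2^N, and its square outgrows a
    variance linear in n. The exceptional set then becomes smaller than any fixed fraction of
    GL_n(K), in particular than one over the order of GL_(2^m)(K). *)

Section NoncommutativeRing.
Variable A : pzRingType.

(** Orthogonality of Peirce components; the tactic [peirce] searches the context for such factors
    [f] and [g]. *)
Lemma mulr_kill (x y f g : A) : x * f = x -> f * g = 0 -> g * y = y -> x * y = 0.
Proof. by move=> <- fg <-; rewrite mulrA -(mulrA x) fg mulr0 mul0r. Qed.

Lemma mulr_step (x y c z : A) : x * y = c -> x * (y * z) = c * z.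
Proof. by move=> <-; rewrite mulrA. Qed.

#[export] Instance ncring_ops :
  @Ncring.Ring_ops A 0 1 +%R *%R (fun x y => x - y) -%R (@eq A) := {}.
#[export] Instance ncring :
  @Ncring.Ring A 0 1 +%R *%R (fun x y => x - y) -%R (@eq A) ncring_ops.
Proof.
constructor; try (intros; hnf; solve [assumption | congruence]).
- exact: RelationClasses.eq_equivalence.
- exact: add0r.
- exact: addrC.
- exact: addrA.
- exact: mul1r.
- exact: mulr1.
- exact: mulrA.
- by move=> x y z; exact: mulrDl.
- by move=> x y z; exact: mulrDr.
- by [].
- exact: subrr.
Qed.

End NoncommutativeRing.

(* Expands both sides, simplifies every product of two neighbours that a
   hypothesis [x * y = c] evaluates or that vanishes because [x = x * f],
   [f * g = 0] and [y = g * y], and compares the results. *)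
Ltac peirce_fact x y k :=
  match goal with
  | H : x * y = ?c |- _ => k H
  | H : x * ?f = x |- _ =>
    match goal with
    | Hy : ?g * y = y |- _ =>
      match goal with Hfg : f * g = 0 |- _ => k (mulr_kill H Hfg Hy) end
    end
  end.

Ltac peirce_step :=
  match goal with
  | |- context [?x * (?y * ?z)] =>
    peirce_fact x y ltac:(fun H => rewrite !(mulr_step _ H))
  | |- context [?x * ?y] => peirce_fact x y ltac:(fun H => rewrite !H)
  end.

Ltac peirce_expand := rewrite ?(mulrDl, mulrDr, mulNr, mulrN, mul1r, mulr1,
  mul0r, mulr0, opprK, oppr0, addr0, add0r) -?mulrA.

Ltac peirce := peirce_expand;
  repeat (peirce_step; peirce_expand);
  first [done | Ncring_tac.non_commutative_ring].


(** * Complete rings with a rank function *)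

Section RankRing.
Variables (R : realType) (A : unitRingType) (rk : A -> R).

(** Frobenius' inequality is what makes the rank additive on orthogonal idempotents. Completeness is
    asked only for geometrically controlled steps, which suffices for the infinite sums formed here.
    Primeness holds up to [e] because in the completion it is inherited from matrices by
    approximation. *)
Record rank_ring : Prop := RankRing {
  rk_eq0 : forall x, rk x = 0 -> x = 0;
  rk0 : rk 0 = 0;
  rk1 : rk 1 = 1;
  rkN : forall x, rk (- x) = rk x;
  rkD : forall x y, rk (x + y) <= rk x + rk y;
  rkMl : forall x y, rk (x * y) <= rk x;
  rkMr : forall x y, rk (x * y) <= rk y;
  rk_Frobenius : forall x y z, rk (x * y) + rk (y * z) <= rk y + rk (x * y * z);
  rk_complete : forall (u : nat -> A) (c : R),
    (forall n, rk (u n.+1 - u n) <= c * 2^-1 ^+ n) ->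
    exists l, forall e : R, 0 < e ->
      exists N, forall n, (N <= n)%N -> rk (u n - l) < e;
  rk_regular : forall a : A, exists b, a * b * a = a;
  rk_prime : forall a b (e : R), 0 < e ->
    exists x, Num.min (rk a) (rk b) - e <= rk (a * x * b);
  rk_dyadic : forall n, exists2 e : A, e * e = e & rk e = 2^-1 ^+ n
}.

Hypothesis rkP : rank_ring.

Lemma rk_ge0 x : 0 <= rk x.
Proof.
by have := rkD rkP x (- x); rewrite subrr (rk0 rkP) (rkN rkP); lra.
Qed.

Lemma rkB x y : rk (x - y) <= rk x + rk y.
Proof. by rewrite -(rkN rkP y); exact: rkD. Qed.

Lemma rkC x y : rk (x - y) = rk (y - x).
Proof. by rewrite -(rkN rkP) opprB. Qed.

Lemma rk_lip x y : rk x <= rk y + rk (x - y).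
Proof. by rewrite addrC -{1}(subrK y x); exact: rkD. Qed.

Lemma rk_le0 x : rk x <= 0 -> x = 0.
Proof. by move=> x0; apply: (rk_eq0 rkP); have := rk_ge0 x; lra. Qed.

Lemma rk_small x : (forall e : R, 0 < e -> rk x <= e) -> x = 0.
Proof.
move=> h; apply: rk_le0; rewrite leNgt; apply/negP => x0.
by have := h (rk x / 2); lra.
Qed.

Definition conv (u : nat -> A) (l : A) := forall e : R, 0 < e ->
  exists N, forall n, (N <= n)%N -> rk (u n - l) < e.

Lemma conv_uniq u l l' : conv u l -> conv u l' -> l = l'.
Proof.
move=> ul ul'; apply/eqP; rewrite -subr_eq0; apply/eqP/rk_small => e e0.
have [|N HN] := ul (e / 2); first by lra.
have [|N' HN'] := ul' (e / 2); first by lra.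
have := HN (maxn N N') (leq_maxl _ _); have := HN' (maxn N N') (leq_maxr _ _).
set v := u _ => h h'.
have := rkB (v - l') (v - l); have -> : v - l' - (v - l) = l - l' by peirce.
by lra.
Qed.

Lemma conv_eventually u v l N :
  (forall n, (N <= n)%N -> u n = v n) -> conv u l -> conv v l.
Proof.
move=> uv ul e /ul[M HM]; exists (maxn N M) => n; rewrite geq_max => /andP[Nn Mn].
by rewrite -uv// HM.
Qed.

Lemma conv_ext u v l : u =1 v -> conv u l -> conv v l.
Proof. by move=> uv; apply: (@conv_eventually _ _ _ 0) => n _. Qed.

Lemma conv_cst l : conv (fun=> l) l.
Proof. by move=> e e0; exists 0%N => n _; rewrite subrr (rk0 rkP). Qed.

Lemma conv_const u l c : (forall n, u n = c) -> conv u l -> l = c.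
Proof. by move=> uc ul; apply: conv_uniq ul _; apply: conv_ext (conv_cst c). Qed.

Lemma convD u v l m : conv u l -> conv v m -> conv (fun n => u n + v n) (l + m).
Proof.
move=> ul vm e e0.
have [|N HN] := ul (e / 2); first by lra.
have [|N' HN'] := vm (e / 2); first by lra.
exists (maxn N N') => n; rewrite geq_max => /andP[/HN h /HN' h'].
by rewrite opprD addrACA (le_lt_trans (rkD rkP _ _))//; lra.
Qed.

Lemma convN u l : conv u l -> conv (fun n => - u n) (- l).
Proof.
by move=> ul e /ul[N HN]; exists N => n /HN; rewrite -opprD (rkN rkP).
Qed.

Lemma convB u v l m : conv u l -> conv v m -> conv (fun n => u n - v n) (l - m).
Proof. by move=> ul vm; apply: convD => //; exact: convN. Qed.

Lemma convM u v l m : conv u l -> conv v m -> conv (fun n => u n * v n) (l * m).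
Proof.
move=> ul vm e e0.
have [|N HN] := ul (e / 2); first by lra.
have [|N' HN'] := vm (e / 2); first by lra.
exists (maxn N N') => n; rewrite geq_max => /andP[/HN h /HN' h'].
have -> : u n * v n - l * m = (u n - l) * v n + l * (v n - m) by peirce.
have := rkD rkP ((u n - l) * v n) (l * (v n - m)).
by have := rkMl rkP (u n - l) (v n); have := rkMr rkP l (v n - m); lra.
Qed.

Lemma convMl a u l : conv u l -> conv (fun n => a * u n) (a * l).
Proof. by move=> ul; apply: convM => //; exact: conv_cst. Qed.

Lemma convMr a u l : conv u l -> conv (fun n => u n * a) (l * a).
Proof. by move=> ul; apply: convM => //; exact: conv_cst. Qed.

Lemma convS u l : conv u l -> conv (fun n => u n.+1) l.
Proof. by move=> ul e /ul[N HN]; exists N => n Nn; apply/HN/leqW. Qed.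

Lemma rk_conv_le u l (c : R) : conv u l ->
  (exists N, forall n, (N <= n)%N -> rk (u n) <= c) -> rk l <= c.
Proof.
move=> ul [N HN]; rewrite leNgt; apply/negP => cl.
have [|N' HN'] := ul (rk l - c); first by lra.
have := HN (maxn N N') (leq_maxl _ _); have := HN' (maxn N N') (leq_maxr _ _).
by rewrite rkC; set v := u _; have := rk_lip l v; lra.
Qed.


Lemma sum_bound (x : nat -> A) (c : R) : (forall n, rk (x n) <= c * 2^-1 ^+ n) ->
  forall n, rk (\sum_(i < n) x i) <= 2 * c.
Proof.
(* The subtracted tail of the geometric series makes the induction close. *)
move=> xc n; suff : rk (\sum_(i < n) x i) <= 2 * c - 2 * (c * 2^-1 ^+ n).
  have := xc n; have := rk_ge0 (x n); lra.
elim: n => [|n IH]; first by rewrite big_ord0 (rk0 rkP) expr0; lra.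
rewrite big_ord_recr /= exprS; set q := c * _ in IH *.
have := xc n; rewrite -/q => xn; rewrite (le_trans (rkD rkP _ _))//.
have -> : c * (2^-1 * 2^-1 ^+ n) = 2^-1 * q by rewrite /q mulrCA.
by lra.
Qed.

Lemma sum_conv (x : nat -> A) (c : R) : (forall n, rk (x n) <= c * 2^-1 ^+ n) ->
  exists2 s, conv (fun n => \sum_(i < n) x i) s & rk s <= 2 * c.
Proof.
move=> xc; have [|s sP] := @rk_complete rkP (fun n => \sum_(i < n) x i) c.
  by move=> n; rewrite big_ord_recr /= [X in X - _]addrC addrK.
exists s => //; apply: rk_conv_le sP _.
by exists 0%N => n _; exact: sum_bound.
Qed.

End RankRing.

(** * Equivalence and comparability of idempotents *)

Section Idempotents.
Variables (A : unitRingType).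
Implicit Types e f p q v w x : A.

Definition corner e f x := e * x = x /\ x * f = x.
Definition subidem e f := e * f = e /\ f * e = e.
(** Murray-von Neumann equivalence of idempotents, with its witnesses. In particular
    [equivalent e e u u'] says that [u] is a unit of the ring eAe with inverse [u'], and it is used
    in this sense throughout. *)
Definition equivalent p q v w :=
  [/\ corner q p v, corner p q w, w * v = p & v * w = q].

Lemma cornerD e f x y : corner e f x -> corner e f y -> corner e f (x + y).
Proof. by move=> [e1 e2] [e3 e4]; split; peirce. Qed.

Lemma cornerN e f x : corner e f x -> corner e f (- x).
Proof. by move=> [e1 e2]; split; peirce. Qed.

Lemma cornerB e f x y : corner e f x -> corner e f y -> corner e f (x - y).
Proof. by move=> [e1 e2] [e3 e4]; split; peirce. Qed.

Lemma cornerM e f g x y : corner e f x -> corner f g y -> corner e g (x * y).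
Proof. by move=> [e1 e2] [e3 e4]; split; peirce. Qed.

Lemma corner_sub e f e' f' x : subidem e e' -> subidem f f' ->
  corner e f x -> corner e' f' x.
Proof.
move=> [e1 e2] [f1 f2] [x1 x2]; split.
  by rewrite -x1 mulrA e2.
by rewrite -x2 -mulrA f1.
Qed.

Lemma subidem_trans e f g : subidem e f -> subidem f g -> subidem e g.
Proof.
move=> [e1 e2] [f1 f2]; split; first by rewrite -e1 -mulrA f1.
by rewrite -e2 mulrA f2.
Qed.

Lemma subidem_orth e f g : subidem e f -> f * g = 0 -> g * f = 0 ->
  e * g = 0 /\ g * e = 0.
Proof.
by move=> [ef fe] fg gf; split; [rewrite -ef -mulrA fg mulr0|rewrite -fe mulrA gf mul0r].
Qed.

Lemma idemB e f : e * e = e -> f * f = f -> subidem e f ->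
  [/\ (f - e) * (f - e) = f - e, subidem (f - e) f, e * (f - e) = 0 &
      (f - e) * e = 0].
Proof. by move=> ee ff [ef fe]; split; [|split| |]; peirce. Qed.

Lemma idemD e f : e * e = e -> f * f = f -> e * f = 0 -> f * e = 0 ->
  [/\ (e + f) * (e + f) = e + f, subidem e (e + f) & subidem f (e + f)].
Proof. by move=> ee ff ef fe; split; [|split|split]; peirce. Qed.

Lemma subidemD e f g : subidem e g -> subidem f g -> subidem (e + f) g.
Proof. by move=> [e1 e2] [f1 f2]; split; peirce. Qed.

Lemma equivalent_idem p q v w : equivalent p q v w -> p * p = p /\ q * q = q.
Proof.
by move=> [[qv vp] [pw wq] wv vw]; split; rewrite -?wv -?vw; peirce.
Qed.

Lemma equivalent_refl p : p * p = p -> equivalent p p p p.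
Proof. by []. Qed.

Lemma equivalent_sym p q v w : equivalent p q v w -> equivalent q p w v.
Proof. by move=> []; split. Qed.

Lemma equivalent_trans p q r v w v' w' :
  equivalent p q v w -> equivalent q r v' w' -> equivalent p r (v' * v) (w * w').
Proof.
move=> [[qv vp] [pw wq] wv vw] [[rv' v'q] [qw' w'r] w'v' v'w'].
by split; [split|split| |]; peirce.
Qed.

Lemma equivalentD p q v w p' q' v' w' :
  equivalent p q v w -> equivalent p' q' v' w' ->
  p * p' = 0 -> p' * p = 0 -> q * q' = 0 -> q' * q = 0 ->
  equivalent (p + p') (q + q') (v + v') (w + w').
Proof.
move=> E E'; have [pp qq] := equivalent_idem E.
have [pp1 qq1] := equivalent_idem E'; move: E E'.
move=> [[qv vp] [pw wq] wv vw] [[qv' vp'] [pw' wq'] wv' vw'] pp' p'p qq' q'q.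
by split; [split|split| |]; peirce.
Qed.

End Idempotents.

Section Comparability.
Variables (R : realType) (A : unitRingType) (rk : A -> R).
Hypothesis rkP : rank_ring rk.
Implicit Types e f p q v w x : A.

(** Frobenius' inequality for [p], [p + q], [q], whose triple product is [p * q] = 0. *)
Lemma rk_orthD p q : p * p = p -> q * q = q -> p * q = 0 -> q * p = 0 ->
  rk (p + q) = rk p + rk q.
Proof.
move=> pp qq pq qp; have := rk_Frobenius rkP p (p + q) q.
have -> : p * (p + q) = p by peirce.
rewrite pq (rk0 rkP); have -> : (p + q) * q = q by peirce.
by have := rkD rkP p q; lra.
Qed.

Lemma rk_subB p q : p * p = p -> q * q = q -> subidem p q ->
  rk (q - p) = rk q - rk p.
Proof.
move=> pp qq pq; have [qpi _ e1 e2] := idemB pp qq pq.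
have := rk_orthD pp qpi e1 e2.
by rewrite addrC subrK; lra.
Qed.

Lemma rk_subidem p q : subidem p q -> rk p <= rk q.
Proof. by move=> [<- _]; exact: (rkMr rkP). Qed.

Lemma subidem_eq p q : p * p = p -> q * q = q -> subidem p q -> rk q <= rk p ->
  p = q.
Proof.
move=> pp qq pq qlep; apply/esym/eqP; rewrite -subr_eq0; apply/eqP/(rk_le0 rkP).
by rewrite rk_subB//; lra.
Qed.

Lemma rk_corner p q x : corner p q x -> rk x <= rk p /\ rk x <= rk q.
Proof.
by move=> [px xq]; split; [rewrite -px; exact: rkMl|rewrite -xq; exact: rkMr].
Qed.

Lemma equivalent_rk p q v w : equivalent p q v w -> rk v = rk p /\ rk q = rk p.
Proof.
move=> [cv cw wv vw]; have [] := rk_corner cv; have [] := rk_corner cw.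
have := rkMl rkP v w; have := rkMr rkP v w; have := rkMl rkP w v.
by have := rkMr rkP w v; rewrite wv vw; split; lra.
Qed.

(** An inner inverse y stays one after compression to y' = pyq, because a = qap; then y'ay' is in
    addition reflexive. *)
Lemma regular_corner p q a : p * p = p -> q * q = q -> corner q p a ->
  exists w, [/\ corner p q w, a * w * a = a & w * a * w = w].
Proof.
move=> pp qq [qa ap]; have [y aya] := rk_regular rkP a.
have aya' : a * (y * a) = a by rewrite mulrA.
pose y' := p * y * q.
have y'C : corner p q y' by split; rewrite /y'; peirce.
have [g ay'] : exists g, a * y' = g by exists (a * y').
have ga : g * a = a by rewrite -ay' /y' !mulrA ap -mulrA qa.
have gg : g * g = g by rewrite -{2}ay' mulrA ga.
case: y'C; clearbody y' => py' y'q.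
have qg : q * g = g by rewrite -ay' mulrA qa.
have gq : g * q = g by rewrite -ay' -mulrA y'q.
exists (y' * g); split; [split| |]; by peirce.
Qed.

Lemma half_expn_small (e : R) : 0 < e -> exists N, 2^-1 ^+ N < e.
Proof.
move=> e0; exists (Num.bound e^-1).
have := archi_boundP (_ : 0 <= e^-1); rewrite invr_ge0 => /(_ (ltW e0)).
set N := Num.bound _ => eN; rewrite exprVn invf_plt ?posrE ?exprn_gt0//.
by rewrite (lt_trans eN)// -natrX ltr_nat ltn_expl.
Qed.

Lemma half_expn_le n m : (n <= m)%N -> 2^-1 ^+ m <= 2^-1 ^+ n :> R.
Proof.
by move=> nm; apply: ler_wiXn2l => //; lra.
Qed.

(** Primeness yields a in qAp of rank at least half of the smaller rank. With a reflexive inverse w,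
    the idempotents wa and aw are equivalent and have the rank of a. *)
Lemma compare_step p q : p * p = p -> q * q = q -> exists p1 q1 v w,
  [/\ equivalent p1 q1 v w, subidem p1 p, subidem q1 q &
      Num.min (rk (p - p1)) (rk (q - q1)) <= 2^-1 * Num.min (rk p) (rk q)].
Proof.
move=> pp qq; set m := Num.min (rk p) (rk q).
have m0 : 0 <= m by rewrite le_min !(rk_ge0 rkP).
have [m0'|mp] := leP m 0.
  exists 0, 0, 0, 0; split; try by do ?split; rewrite ?(mul0r, mulr0).
  by rewrite !subr0 -/m; lra.
have m2 : 0 < m / 2 by lra.
have [x hx] := rk_prime rkP q p m2.
set a := q * x * p in hx.
have aC : corner q p a by split; rewrite /a; peirce.
have [w [wC awa waw]] := regular_corner pp qq aC.
case: aC => qa ap; case: wC => pw wq; clearbody a.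
have wa : equivalent (w * a) (a * w) a w.
  by split; [split|split| |]; rewrite ?mulrA// -?mulrA ?(mulrA w)// mulrA.
have [_ ra] := equivalent_rk wa.
have sp : subidem (w * a) p by split; peirce.
have sq : subidem (a * w) q by split; peirce.
have [i1 i2] := equivalent_idem wa.
exists (w * a), (a * w), a, w; split => //.
rewrite !rk_subB// ra; have [ra' _] := equivalent_rk wa.
rewrite -ra' -addr_minl -/m; move: hx; rewrite minC -/m; lra.
Qed.

(** Exhaustion by [compare_step]: the smaller remainder is halved each time, so the pieces of the
    equivalence have geometrically decreasing rank and can be summed. The identities pass to the
    limit, where one of the two remainders must have rank 0. *)
Lemma compare p q : p * p = p -> q * q = q -> exists p' q' v w,
  [/\ equivalent p' q' v w, subidem p' p, subidem q' q & p' = p \/ q' = q].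
Proof.
move=> pp qq.
have stepP (s : A * A) : exists r : (A * A) * (A * A),
    s.1 * s.1 = s.1 -> s.2 * s.2 = s.2 ->
    [/\ equivalent r.1.1 r.1.2 r.2.1 r.2.2, subidem r.1.1 s.1,
      subidem r.1.2 s.2 & Num.min (rk (s.1 - r.1.1)) (rk (s.2 - r.1.2)) <=
        2^-1 * Num.min (rk s.1) (rk s.2)].
  have [[s1 s2]|ns] := pselect (s.1 * s.1 = s.1 /\ s.2 * s.2 = s.2).
    by have [p1 [q1 [v [w H]]]] := compare_step s1 s2; exists ((p1, q1), (v, w)).
  by exists ((0, 0), (0, 0)) => s1 s2; case: ns.
have [F FP] := choice stepP.
pose st := fix st n := if n is n'.+1 then
  ((st n').1 - (F (st n')).1.1, (st n').2 - (F (st n')).1.2) else (p, q).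
pose V n := \sum_(i < n) (F (st i)).2.1.
pose W n := \sum_(i < n) (F (st i)).2.2.
have inv n : [/\ (st n).1 * (st n).1 = (st n).1, (st n).2 * (st n).2 = (st n).2,
    equivalent (p - (st n).1) (q - (st n).2) (V n) (W n) &
    [/\ subidem (st n).1 p, subidem (st n).2 q &
    Num.min (rk (st n).1) (rk (st n).2) <= 2^-1 ^+ n]].
  elim: n => [|n [pn qn eqn [sp sq mn]]].
    split => //=; first by rewrite /V /W !big_ord0 !subrr; do ?split; rewrite ?mulr0.
    split => //; rewrite expr0 ge_min; apply/orP; left.
    by rewrite -(mulr1 p) (le_trans (rkMr rkP _ _))// (rk1 rkP).
  have [e1 s1 s2 m1] := FP _ pn qn.
  have [i1 i2] := equivalent_idem e1.
  have [j1 j2 j3 j4] := idemB i1 pn s1; have [k1 k2 k3 k4] := idemB i2 qn s2.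
  split => //=; last first.
    split; [exact: subidem_trans sp|exact: subidem_trans sq|].
    by rewrite exprS (le_trans m1)// ler_wpM2l//; lra.
  rewrite /V /W !big_ord_recr /= -/(V n) -/(W n).
  have [h1 _ h3 h4] := idemB pn pp sp; have [l1 _ l3 l4] := idemB qn qq sq.
  have E (a b c : A) : a - (b - c) = (a - b) + c by peirce.
  rewrite !E.
  have [] := subidem_orth s1 h3 h4; have [] := subidem_orth s2 l3 l4 => ? ? ? ?.
  exact: equivalentD.
have small n : rk (F (st n)).2.1 <= 1 * 2^-1 ^+ n /\
    rk (F (st n)).2.2 <= 1 * 2^-1 ^+ n.
  have [pn qn _ [_ _ mn]] := inv n; have [e1 s1 s2 _] := FP _ pn qn.
  have [v1 q1] := equivalent_rk e1; have [w1 _] := equivalent_rk (equivalent_sym e1).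
  have := rk_subidem s1; have := rk_subidem s2; move: mn.
  by rewrite mul1r ge_min => /orP[]; lra.
have [v Vv _] := sum_conv rkP (fun n => (small n).1).
have [w Ww _] := sum_conv rkP (fun n => (small n).2).
rewrite -/V -/W in Vv Ww.
have lim (f g : nat -> A) a b : (forall n, f n = g n) -> conv rk f a -> conv rk g b ->
    a = b.
  by move=> fg fa gb; apply: conv_uniq fa _ => //; apply: conv_ext gb => n.
have WV := convM rkP Ww Vv; have VW := convM rkP Vv Ww.
have cp := convB rkP (conv_cst rkP p) WV; have cq := convB rkP (conv_cst rkP q) VW.
have e n : equivalent (p - (st n).1) (q - (st n).2) (V n) (W n).
  by have [] := inv n.
have stE n : (st n).1 = p - W n * V n /\ (st n).2 = q - V n * W n.
  by have [_ _ -> ->] := e n; rewrite !subKr.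
have Vp n : V n * p = V n.
  have [_ _ [[_ h] _ _ _] [[h1 h2] _ _]] := inv n; rewrite -h; peirce.
have pW n : p * W n = W n.
  have [_ _ [_ [h _] _ _] [[h1 h2] _ _]] := inv n; rewrite -h; peirce.
have Wq n : W n * q = W n.
  have [_ _ [_ [_ h] _ _] [_ [h1 h2] _]] := inv n; rewrite -h; peirce.
have qV n : q * V n = V n.
  have [_ _ [[h _] _ _ _] [_ [h1 h2] _]] := inv n; rewrite -h; peirce.
have VWV n : V n * (W n * V n) = V n.
  by have [[_ h] _ -> _] := e n.
have WVW n : W n * (V n * W n) = W n.
  by have [_ [_ h] _ ->] := e n.
have {}Vp : v * p = v by apply: lim Vp (convMr _ _ Vv) Vv.
have {}pW : p * w = w by apply: lim pW (convMl _ _ Ww) Ww.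
have {}Wq : w * q = w by apply: lim Wq (convMr _ _ Ww) Ww.
have {}qV : q * v = v by apply: lim qV (convMl _ _ Vv) Vv.
have {}VWV : v * (w * v) = v by apply: lim VWV (convM _ Vv WV) Vv.
have {}WVW : w * (v * w) = w by apply: lim WVW (convM _ Ww VW) Ww.
exists (w * v), (v * w), v, w.
have wvi : w * v * (w * v) = w * v by rewrite -mulrA VWV.
have vwi : v * w * (v * w) = v * w by rewrite -mulrA WVW.
have sp : subidem (w * v) p by split; peirce.
have sq : subidem (v * w) q by split; peirce.
split => //.
  by split; [split|split| |]; rewrite // -mulrA.
have [x0|x0] := eqVneq (rk (p - w * v)) 0.
  by left; apply/esym/eqP; rewrite -subr_eq0; apply/eqP/(rk_eq0 rkP).
right; apply/esym/eqP; rewrite -subr_eq0; apply/eqP/(rk_small rkP) => eps eps0.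
rewrite leNgt; apply/negP => epsq.
have rp : 0 < rk (p - w * v) by rewrite lt_def x0 (rk_ge0 rkP).
(* If both limit remainders had rank at least 2d, their approximations within d would both have rank
   above d, against the bound 2^-N < d on the smaller one. *)
pose d := Num.min (rk (p - w * v)) eps / 2.
have d0 : 0 < d by rewrite divr_gt0// lt_min rp.
have [N1 HN1] := cp _ d0; have [N2 HN2] := cq _ d0; have [N3 HN3] := half_expn_small d0.
pose N := maxn N1 (maxn N2 N3).
have h1 := HN1 N (leq_maxl _ _).
have h2 : rk (q - V N * W N - (q - v * w)) < d.
  by apply: HN2; rewrite !leq_max leqnn orbT.
have h3 : 2^-1 ^+ N <= 2^-1 ^+ N3 :> R.
  by apply: half_expn_le; rewrite !leq_max leqnn !orbT.
have [_ _ _ [_ _]] := inv N; have [-> ->] := stE N => h4.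
rewrite (rkC rkP) in h1; rewrite (rkC rkP) in h2.
have := rk_lip rkP (p - w * v) (p - W N * V N).
have := rk_lip rkP (q - v * w) (q - V N * W N).
have : d * 2 <= rk (p - w * v) by rewrite /d divfK ?pnatr_eq0// ge_min lexx.
have : d * 2 <= eps by rewrite /d divfK ?pnatr_eq0// ge_min lexx orbT.
by move: h4; rewrite ge_min => /orP[]; lra.
Qed.

Lemma compare_le p q : p * p = p -> q * q = q -> rk p <= rk q ->
  exists q' v w, equivalent p q' v w /\ subidem q' q.
Proof.
move=> pp qq pq; have [p' [q' [v [w [e sp sq H]]]]] := compare pp qq.
have [p'p q'q] := equivalent_idem e; have [_ r] := equivalent_rk e.
have p'E : p' = p.
  case: H => // q'E; apply: subidem_eq => //; rewrite -r q'E //.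
by exists q', v, w; rewrite -p'E.
Qed.

Lemma compare_eq p q : p * p = p -> q * q = q -> rk p = rk q ->
  exists v w, equivalent p q v w.
Proof.
move=> pp qq pq; have [|q' [v [w [e s]]]] := compare_le pp qq; first by rewrite pq.
exists v, w; have [_ q'q] := equivalent_idem e; have [_ r] := equivalent_rk e.
by rewrite -(subidem_eq q'q qq s)// r pq.
Qed.

End Comparability.

(** * Conjugating corners, and Gaussian elimination with idempotent blocks *)

Section Reduction.
Variables (R : realType) (A : unitRingType) (rk : A -> R).
Hypothesis rkP : rank_ring rk.
Implicit Types e f p q v w x : A.

(** The complements [E - p] and [E - q] have equal rank, hence are equivalent; adding the two
    equivalences turns the given one into conjugation by a unit of EAE. *)
Lemma equivalent_extend E p q v w : E * E = E -> subidem p E -> subidem q E ->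
  equivalent p q v w ->
  exists h h', [/\ equivalent E E h h', h * p = v & p * h' = w].
Proof.
move=> EE pE qE e; have [pp qq] := equivalent_idem e.
have [_ r] := equivalent_rk rkP e.
have [p1 p2 p3 p4] := idemB pp EE pE; have [q1 q2 q3 q4] := idemB qq EE qE.
have [|v' [w' e']] := compare_eq rkP p1 q1; first by rewrite !(rk_subB rkP)// r.
exists (v + v'), (w + w'); split.
- have := equivalentD e e' p3 p4 q3 q4.
  have E2 x : x + (E - x) = E by peirce.
  by rewrite !E2.
- case: e e' => [[_ h] _ _ _] [[_ h'] _ _ _].
  have z : v' * p = 0 by apply: mulr_kill h' p4 pp.
  by rewrite mulrDl h z addr0.
- case: e e' => [_ [h _] _ _] [_ [h' _] _ _].
  have z : p * w' = 0 by apply: mulr_kill pp p3 h'.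
  by rewrite mulrDr h z addr0.
Qed.

(** Move [p] under [p0] and [q] under [q0] separately. Orthogonality on both sides allows the two
    equivalences to be added and then extended to a unit of EAE. *)
Lemma conj_corner E p q p0 q0 : E * E = E -> p * p = p -> q * q = q ->
  p0 * p0 = p0 -> q0 * q0 = q0 -> subidem p E -> subidem q E ->
  subidem p0 E -> subidem q0 E -> p * q = 0 -> q * p = 0 ->
  p0 * q0 = 0 -> q0 * p0 = 0 -> rk p <= rk p0 -> rk q <= rk q0 ->
  exists h h', equivalent E E h h' /\
    forall y, corner p q y -> corner p0 q0 (h * y * h').
Proof.
move=> EE pp qq pp0 qq0 pE qE pE0 qE0 pq qp pq0 qp0 rp rq.
have [p1 [v [w [e s]]]] := compare_le rkP pp pp0 rp.
have [q1 [v' [w' [e' s']]]] := compare_le rkP qq qq0 rq.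
have [_ pp1] := equivalent_idem e; have [_ qq1] := equivalent_idem e'.
have [s1 s2] := subidem_orth s pq0 qp0.
have [s3 s4] := subidem_orth s' s2 s1.
have eD := equivalentD e e' pq qp s4 s3.
have [||h [h' [eh hv hw]]] := equivalent_extend EE _ _ eD.
- by apply: subidemD.
- by apply: subidemD; [exact: subidem_trans s _|exact: subidem_trans s' _].
exists h, h'; split=> // y [py yq].
have hp : h * p = v.
  have := congr1 (fun z => z * p) hv; case: e e' => [[_ vp] _ _ _] [[_ vq] _ _ _].
  have v'p : v' * p = 0 by apply: mulr_kill vq qp pp.
  by peirce_expand; rewrite pp qp vp v'p mulr0 !addr0.
have qh : q * h' = w'.
  have := congr1 (fun z => q * z) hw; case: e e' => [_ [pw _] _ _] [_ [qw _] _ _].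
  have v'p : q * w = 0 by apply: mulr_kill qq qp pw.
  by rewrite mulrA !mulrDr qp qq v'p qw !add0r.
have -> : h * y * h' = v * y * w' by rewrite -py -yq -hp -qh; peirce.
apply: (corner_sub s s'); case: e e' => [[? ?] _ _ _] [_ [? ?] _ _].
by split; peirce.
Qed.

Lemma unipotentK x z : x * x = 0 -> (1 - x) * ((1 + x) * z) = z.
Proof. by move=> xx; peirce. Qed.

Lemma unipotentVK x z : x * x = 0 -> (1 + x) * ((1 - x) * z) = z.
Proof. by move=> xx; peirce. Qed.

(* Gaussian elimination in two blocks.  The first row operation makes the
   (g, f) entry left invertible, so that the (f, f) entry can become f. *)
Lemma block_elimination f g u u' : f * f = f -> g * g = g -> f * g = 0 ->
  g * f = 0 -> rk f <= rk g -> equivalent (f + g) (f + g) u u' ->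
  exists l1 r1 l2 r2 d d',
    [/\ corner g f l1, corner f g r1, corner g f l2, corner f g r2 &
      equivalent g g d d' /\ 1 - (f + g) + u =
        (1 + l1) * ((1 + r1) * ((1 + l2) * ((1 + r2) * (1 - g + d))))].
Proof.
move=> ff gg fg gf fleg [[cu uc] [cu' u'c] u'u uu'].
pose a := f * u * f; pose c := g * u * f; pose x := f * u' * f; pose y := f * u' * g.
have xayc : x * a + y * c = f.
  have : f * (u' * (f + g) * u) * f = f by rewrite u'c u'u; peirce.
  by move=> E; rewrite -[RHS]E /x /a /y /c; peirce.
have aC : corner f f a by split; rewrite /a; peirce.
have [w [[fw wf] awa _]] := regular_corner rkP ff ff aC.
case: aC => fa af.
have gc : g * c = c by rewrite /c; peirce.
have cf : c * f = c by rewrite /c; peirce.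
have fx : f * x = x by rewrite /x; peirce.
have xf : x * f = x by rewrite /x; peirce.
have fy : f * y = y by rewrite /y; peirce.
have yg : y * g = y by rewrite /y; peirce.
have ea : a = f * u * f by []; have ec : c = g * u * f by [].
clearbody a c x y.
have {}awa : a * (w * a) = a by rewrite mulrA.
(* [k] projects onto the kernel of the (f, f) entry [a]. Since [u] is invertible, the (g, f) entry
   [c] is injective there, with left inverse [y]; the idempotent [e0] is the image of [k] under
   [c]. *)
pose k := f - w * a.
have fk : f * k = k by rewrite /k; peirce.
have kf : k * f = k by rewrite /k; peirce.
have ak : a * k = 0 by rewrite /k; peirce.
have kk : k * k = k by rewrite {1}/k mulrBl fk -mulrA ak; peirce.
have wak : w * a = f - k by rewrite /k; peirce.
clearbody k.
have yck : y * (c * k) = k.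
  have := congr1 (fun z => z * k) xayc; rewrite mulrDl -mulrA ak mulr0 add0r fk.
  by rewrite mulrA.
have [z ez] : exists z, z = c * k by exists (c * k).
have [e0 ee0] : exists e0, e0 = z * (k * y) by exists (z * (k * y)).
have ek0 : equivalent k e0 z (k * y).
  have zk : z * k = z by rewrite ez -mulrA kk.
  have kyz : y * z = k by rewrite ez yck.
  have gz : g * z = z by rewrite ez; peirce.
  by split=> //; [split|split|]; rewrite ?ee0; peirce.
have [_ e00] := equivalent_idem ek0.
have e0g : subidem e0 g.
  have zg : g * z = z by rewrite ez; peirce.
  by split; rewrite ee0; peirce.
have sk : subidem k f by [].
have [_ rke] := equivalent_rk rkP ek0.
have [i1 i2 i3 i4] := idemB kk ff sk; have [j1 j2 j3 j4] := idemB e00 gg e0g.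
(* Because rk f <= rk g, there is room in [g] beside [e0] for a copy [e1] of [f - k]. *)
have [|e1 [v [v' [ev sv]]]] := compare_le rkP i1 j1.
  by rewrite !(rk_subB rkP)// rke; lra.
have zg : g * z = z by rewrite ez; peirce.
have e0z : e0 * z = z by case: ek0 => [[]].
have zk : z * k = z by case: ek0 => [[]].
have kyE : k * y * e0 = k * y by case: ek0 => _ [_ ->].
have kyz : k * y * z = k by case: ek0 => _ _ ->.
have [[ev1 vf] [fv' ve1] v'v _] := ev.
have e10 : e1 * e0 = 0 /\ e0 * e1 = 0 by apply: subidem_orth sv j4 j3.
have e1g : subidem e1 g by apply: subidem_trans sv j2.
have gv : g * v = v by rewrite -ev1 mulrA e1g.2.
have v'g : v' * g = v' by rewrite -ve1 -mulrA e1g.1.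
have {}fv' : f * v' = v' by rewrite -fv' mulrA i2.2.
have {}vf : v * f = v by rewrite -vf -mulrA i2.1.
have vk : v * k = 0 by case: ev => [[_ <-] _ _ _]; rewrite -mulrA i4 mulr0.
have kyv : k * y * v = 0.
  by rewrite -kyE -ev1 -mulrA (mulrA e0) e10.2 mul0r mulr0.
have v'z : v' * z = 0 by rewrite -ve1 -e0z -mulrA (mulrA e1) e10.1 mul0r mulr0.
(* As [w * a] is [f - k], adding [t] times the f-row to the g-row changes [c] only off the kernel of
   [a]. The new entry [c'] agrees with [c] on [k] and with [v] on [f - k], and has left inverse
   [y']. *)
have [t et] : exists t, t = (v - c) * w by exists ((v - c) * w).
have [c' ec'] : exists c', c' = z + v by exists (z + v).
have [y' ey'] : exists y', y' = k * y + v' by exists (k * y + v').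
have y'c' : y' * c' = f.
  rewrite ey' ec' mulrDl !mulrDr kyz kyv v'z v'v; peirce.
have ta : t * a = c' - c.
  by rewrite et -mulrA wak ec' ez; peirce.
have gt : g * t = t by rewrite et; peirce.
have tf : t * f = t by rewrite et; peirce.
have gc' : g * c' = c' by rewrite ec'; peirce.
have zf : z * f = z by rewrite ez; peirce.
have c'f : c' * f = c' by rewrite ec'; peirce.
have fy' : f * y' = y' by rewrite ey'; peirce.
have y'g : y' * g = y' by rewrite ey'; peirce.
(* Adding [s] times the g-row turns the (f, f) entry [a] into [f]. *)
pose s := (f - a) * y'.
have sc' : s * c' = f - a by rewrite /s; peirce.
have fs : f * s = s by rewrite /s; peirce.
have sg : s * g = s by rewrite /s; peirce.
clearbody s.
have [ o eo] : exists o, o = 1 - (f + g) by exists (1 - (f + g)).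
have [oo [of_ fo] [og go]] : [/\ o * o = o, o * f = 0 /\ f * o = 0 &
    o * g = 0 /\ g * o = 0].
  by rewrite eo; do ?split; peirce.
have [b eb] : exists b, b = f * u * g by exists (f * u * g).
have [d0 ed0] : exists d0, d0 = g * u * g by exists (g * u * g).
have fb : f * b = b by rewrite eb; peirce.
have bg : b * g = b by rewrite eb; peirce.
have gd0 : g * d0 = d0 by rewrite ed0; peirce.
have d0g : d0 * g = d0 by rewrite ed0; peirce.
have uE : u = a + b + c + d0.
  by rewrite ea eb ec ed0 -{1}cu -[X in _ * X]uc; peirce.
have [b1 eb1] : exists b1, b1 = b + s * d0 + s * t * b.
  by exists (b + s * d0 + s * t * b).
have [d ed] : exists d, d = d0 + t * b - c' * b1 by exists (d0 + t * b - c' * b1).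
have fb1 : f * b1 = b1 by rewrite eb1; peirce.
have b1g : b1 * g = b1 by rewrite eb1; peirce.
have gd : g * d = d by rewrite ed; peirce.
have dg : d * g = d by rewrite ed; peirce.
(* After three row operations the matrix is block triangular with diagonal [f], [d]. Its inverse
   provides the inverse of [d] in gAg, and the entry [b1] splits off as the fourth factor. *)
pose u2 := (1 - c') * ((1 + s) * ((1 + t) * (o + u))).
have u2E : u2 = o + f + b1 + d.
  by rewrite /u2 ed eb1 uE; peirce.
have ss : s * s = 0 by apply: mulr_kill sg gf fs.
have tt : t * t = 0 by apply: mulr_kill tf fg gt.
have cc' : c' * c' = 0 by apply: mulr_kill c'f fg gc'.
have uu2 : (1 - t) * ((1 - s) * ((1 + c') * u2)) = o + u.
  by rewrite /u2 unipotentVK// !unipotentK.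
have ou : o * u = 0 by rewrite -cu mulrA mulrDr of_ og addr0 mul0r.
have uo : u * o = 0 by rewrite -uc -mulrA mulrDl fo go addr0 mulr0.
have ou' : o * u' = 0 by rewrite -cu' mulrA mulrDr of_ og addr0 mul0r.
have u'o : u' * o = 0 by rewrite -u'c -mulrA mulrDl fo go addr0 mulr0.
have o1 : o + (f + g) = 1 by rewrite eo; peirce.
have inv1 : (o + u') * (o + u) = 1 by rewrite -[RHS]o1 -u'u; peirce.
have inv2 z1 : (o + u) * ((o + u') * z1) = z1.
  by rewrite mulrA -[RHS]mul1r -[X in _ = X * _]o1 -uu'; congr (_ * _); peirce.
have [u2' eu2'] : exists x, x = (o + u') * ((1 - t) * ((1 - s) * (1 + c'))).
  by eexists.
have inv3 : u2' * u2 = 1 by rewrite eu2' -!mulrA uu2.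
have inv4 : u2 * u2' = 1.
  rewrite eu2' /u2 -!mulrA inv2 unipotentVK// unipotentVK//.
  by rewrite -[X in _ * X]mulr1 unipotentK.
clearbody u2; have gu2 : g * u2 = d by rewrite u2E; peirce.
have u2'f : u2' * f = f.
  have u2f : u2 * f = f by rewrite u2E; peirce.
  by rewrite -{1}u2f mulrA inv3 mul1r.
have u2b1 : u2' * b1 = b1 by rewrite -fb1 mulrA u2'f.
have u2d : u2' * d = g - b1.
  have -> : d = u2 * g - b1 by rewrite u2E; peirce.
  by rewrite mulrBr mulrA inv3 mul1r u2b1.
have dd' : d * (g * u2' * g) = g by rewrite !mulrA dg -gu2 -(mulrA g) inv4; peirce.
have d'd : g * u2' * g * d = g by rewrite -mulrA gd -mulrA u2d; peirce.
exists (- t), (- s), c', (b1 * (g * u2' * g)), d, (g * u2' * g).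
split.
- by apply: cornerN.
- by apply: cornerN.
- by [].
- by split; peirce.
split; first by split; [|split; peirce| |].
rewrite -eo -uu2; congr (_ * (_ * (_ * _))); rewrite u2E.
have -> : 1 - g = o + f by rewrite eo; peirce.
have : g * u2' * g * g = g * u2' * g by rewrite -mulrA gg.
by move: d'd; move: (g * u2' * g) => d' d'd d'g; peirce.
Qed.

End Reduction.

(** * Infinite sums and supports *)

Section Sums.
Variables (R : realType) (A : unitRingType) (rk : A -> R).
Hypothesis rkP : rank_ring rk.
Implicit Types (e f p q v w a : A) (x y z : nat -> A).

Definition sums x s := conv rk (fun n => \sum_(i < n) x i) s.

Lemma sums_exist x (c : R) : (forall n, rk (x n) <= c * 2^-1 ^+ n) ->
  exists s, sums x s.
Proof. by move=> /(sum_conv rkP)[s]; exists s. Qed.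

Lemma sums_uniq x s t : sums x s -> sums x t -> s = t.
Proof. exact: conv_uniq. Qed.

Lemma sums_ext x y s : x =1 y -> sums x s -> sums y s.
Proof. by move=> xy; apply: conv_ext => n; apply: eq_bigr => i _; exact: xy. Qed.

Lemma sumsD x y s t : sums x s -> sums y t -> sums (fun n => x n + y n) (s + t).
Proof.
move=> xs yt; apply: conv_ext (convD rkP xs yt) => n.
by rewrite big_split.
Qed.

Lemma sumsMl a x s : sums x s -> sums (fun n => a * x n) (a * s).
Proof.
by move=> xs; apply: conv_ext (convMl rkP a xs) => n; rewrite -big_distrr.
Qed.

Lemma sumsMr a x s : sums x s -> sums (fun n => x n * a) (s * a).
Proof.
by move=> xs; apply: conv_ext (convMr rkP a xs) => n; rewrite -big_distrl.
Qed.

Lemma sumsM x y s t : (forall i j, i <> j -> x i * y j = 0) ->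
  sums x s -> sums y t -> sums (fun n => x n * y n) (s * t).
Proof.
move=> xy xs yt; apply: conv_ext (convM rkP xs yt) => n.
rewrite big_distrl /=; apply: eq_bigr => i _.
rewrite big_distrr /= (bigD1 i)//= big1 ?addr0// => j /negP ji.
by apply: xy => /ord_inj ij; apply: ji; rewrite ij.
Qed.

Lemma sums_fixl a x s : (forall n, a * x n = x n) -> sums x s -> a * s = s.
Proof.
by move=> ax xs; apply: (sums_uniq _ (xs)); apply: sums_ext (sumsMl a xs).
Qed.

Lemma sums_fixr a x s : (forall n, x n * a = x n) -> sums x s -> s * a = s.
Proof.
by move=> ax xs; apply: (sums_uniq _ (xs)); apply: sums_ext (sumsMr a xs).
Qed.

Lemma sums_single x s n : (forall i, i <> n -> x i = 0) -> sums x s -> s = x n.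
Proof.
move=> x0 xs; apply: (conv_uniq rkP xs).
apply: (conv_eventually (N := n.+1) _ (conv_cst rkP (x n))) => m nm.
rewrite (bigD1 (Ordinal nm))//= big1 ?addr0// => j /negP jn.
by apply: x0 => jn'; apply: jn; apply/eqP/val_inj.
Qed.

Lemma sums_pickl a x s n : (forall i, i <> n -> a * x i = 0) -> sums x s ->
  a * s = a * x n.
Proof. by move=> ax xs; apply: (sums_single ax); exact: sumsMl. Qed.

Lemma sums_pickr a x s n : (forall i, i <> n -> x i * a = 0) -> sums x s ->
  s * a = x n * a.
Proof.
by move=> ax xs; apply: (sums_single (x := fun n => x n * a)) => //; exact: sumsMr.
Qed.

Lemma sums_S x s : sums x s -> sums (fun n => x n.+1) (s - x 0%N).
Proof.
move=> xs; have := convB rkP (convS xs) (conv_cst rkP (x 0%N)).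
by apply: conv_ext => n; rewrite big_ord_recl addrC addKr.
Qed.

End Sums.

(** * Small idempotents supporting given elements *)

Section Supports.
Variables (R : realType) (A : unitRingType) (rk : A -> R).
Hypothesis rkP : rank_ring rk.
Implicit Types (e f p q v w : A).

(** [e] supports [c] on the left and [f] supports [d] on the right. What [f] misses after [e] is b =
    f(1 - e); its right support [x], placed under 1 - e, completes [e] to a common support. Both are
    compressed by 1 - p to stay orthogonal to [p]. *)
Lemma support p c d : p * p = p -> p * c = 0 -> d * p = 0 ->
  exists q, [/\ q * q = q, p * q = 0, q * p = 0, q * c = c & d * q = d] /\
    rk q <= rk c + rk d.
Proof.
move=> pp pc dp; have [u cuc] := rk_regular rkP c; have [u' dud] := rk_regular rkP d.
have [e eE] : exists e, e = c * u * (1 - p) by eexists.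
have [f fE] : exists f, f = (1 - p) * u' * d by eexists.
have pe : p * e = 0 by rewrite eE; peirce.
have ep : e * p = 0 by rewrite eE; peirce.
have fp : f * p = 0 by rewrite fE; peirce.
have pf : p * f = 0 by rewrite fE; peirce.
have ec : e * c = c by rewrite eE -mulrA mulrBl pc subr0 mul1r cuc.
have df : d * f = d by rewrite fE !mulrA mulrBr dp subr0 mulr1 dud.
have ee : e * e = e by rewrite {2}eE !mulrA ec -eE.
have ff : f * f = f by rewrite {1}fE -!mulrA df mulrA -fE.
have [b bE] : exists b, b = f * (1 - e) by eexists.
have be : b * e = 0 by rewrite bE; peirce.
have bp : b * p = 0 by rewrite bE; peirce.
have bc : b * c = 0 by rewrite bE; peirce.
have [w bwb] := rk_regular rkP b.
have {}bwb : b * (w * b) = b by rewrite mulrA.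
have [x xE] : exists x, x = (1 - e) * (1 - p) * w * b by eexists.
have bx : b * x = b by rewrite xE; peirce.
have ex : e * x = 0 by rewrite xE; peirce.
have px : p * x = 0 by rewrite xE; peirce.
have xe : x * e = 0 by rewrite xE; peirce.
have xp : x * p = 0 by rewrite xE; peirce.
have xc : x * c = 0 by rewrite xE; peirce.
have xx : x * x = x by rewrite {1}xE -!mulrA bx xE; peirce.
have fx : f * x = b.
  have : f * ((1 - e) * x) = b by rewrite mulrA -bE.
  by rewrite mulrBl ex subr0 mul1r.
have dx : d * x = d - d * e by rewrite -df -!mulrA fx bE; peirce.
exists (e + x); split; first by split; peirce.
have := rkD rkP e x; have := rkMl rkP c (u * (1 - p)); rewrite mulrA -eE.
have := rkMr rkP ((1 - e) * (1 - p) * w) b; rewrite -xE.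
have := rkMl rkP f (1 - e); rewrite -bE; have := rkMr rkP ((1 - p) * u') d.
by rewrite -fE; lra.
Qed.

(** Enlarge [P n] by an orthogonal idempotent supporting what it misses of [a n] on either side.
    This costs at most twice the rank of [a n], and summing the geometric series doubles the
    constant again. *)
Lemma common_support (a : nat -> A) (c : R) : (forall n, rk (a n) <= c * 2^-1 ^+ n) ->
  exists p, [/\ p * p = p, forall n, p * a n = a n /\ a n * p = a n & rk p <= 4 * c].
Proof.
move=> ac.
have stepP (s : A * A) : exists q, s.1 * s.1 = s.1 ->
    [/\ q * q = q, s.1 * q = 0, q * s.1 = 0,
      q * ((1 - s.1) * s.2) = (1 - s.1) * s.2 &
      s.2 * (1 - s.1) * q = s.2 * (1 - s.1)] /\ rk q <= 2 * rk s.2.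
  have [pp|np] := pselect (s.1 * s.1 = s.1); last by exists 0.
  have [||q [H rq]] := @support s.1 ((1 - s.1) * s.2) (s.2 * (1 - s.1)) pp.
  - by peirce.
  - by peirce.
  exists q => _; split=> //; have := rkMl rkP s.2 (1 - s.1).
  by have := rkMr rkP (1 - s.1) s.2; lra.
have [F FP] := choice stepP.
pose P := fix P n := if n is n'.+1 then P n' + F (P n', a n') else 0.
have P0 : P 0%N = 0 by [].
have PS n : P n.+1 = P n + F (P n, a n) by [].
clearbody P.
have PP n : P n * P n = P n.
  elim: n => [|n IH]; first by rewrite P0 mul0r.
  rewrite PS; by have /= [[h1 h2 h3 _ _] _] := FP (P n, a n) IH; have [] := idemD IH h1 h2 h3.
have Pn n : [/\ P n * P n.+1 = P n, P n.+1 * P n = P n, P n.+1 * a n = a n &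
    a n * P n.+1 = a n].
  have /= [[h1 h2 h3 h4 h5] _] := FP (P n, a n) (PP n); have h := PP n.
  rewrite PS; move: h h1 h2 h3 h4 h5; move: (P n) (a n) (F _) => p y q h h1 h2 h3 h4 h5.
  have h6 : q * y = (1 - p) * y by rewrite -h4; peirce.
  have h7 : y * q = y * (1 - p) by rewrite -h5; peirce.
  by split; peirce.
have Pk n k : [/\ P (n + k)%N * P n = P n & P n * P (n + k)%N = P n].
  elim: k => [|k [IH1 IH2]]; first by rewrite addn0 PP.
  rewrite addnS; have [h1 h2 _ _] := Pn (n + k)%N.
  by split; [rewrite -IH1 mulrA h2|rewrite -IH2 -mulrA h1].
have Fc n : rk (F (P n, a n)) <= 2 * c * 2^-1 ^+ n.
  by have [_ /=] := FP (P n, a n) (PP n); have := ac n; lra.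
have [p Sp rp] := sum_conv rkP Fc.
have {}Sp : conv rk P p.
  apply: conv_ext Sp => n; elim: n => [|n IH]; first by rewrite big_ord0 P0.
  by rewrite big_ord_recr /= IH PS.
exists p; split; last by lra.
  by apply: (conv_uniq rkP (convM rkP Sp Sp)); apply: conv_ext Sp.
move=> n; have [_ _ h3 h4] := Pn n.
have hk k : (n.+1 <= k)%N -> P k * a n = a n /\ a n * P k = a n.
  move=> /subnKC <-; have [e1 e2] := Pk n.+1 (k - n.+1)%N.
  by split; [rewrite -h3 mulrA e1|rewrite -h4 -mulrA e2].
split; apply: (conv_uniq rkP _ (conv_cst rkP (a n))).
  apply: conv_eventually (convMr rkP (a n) Sp) => k /hk[]; exact.
apply: conv_eventually (convMl rkP (a n) Sp) => k /hk[]; exact.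
Qed.

End Supports.

(** * Splitting idempotents into orthogonal pieces of dyadic rank *)

Section Dyadic.
Variables (R : realType) (A : unitRingType) (rk : A -> R).
Hypothesis rkP : rank_ring rk.
Implicit Types (e f p q v w : A).

(** An idempotent of the required rank exists somewhere by [rk_dyadic]; comparability moves it under
    [p]. *)
Lemma half_idem p n : p * p = p -> rk p = 2^-1 ^+ n -> exists q,
  [/\ q * q = q, subidem q p, rk q = 2^-1 ^+ n.+1 & rk (p - q) = 2^-1 ^+ n.+1].
Proof.
move=> pp rp; have [e ee re] := rk_dyadic rkP n.+1.
have h : 2^-1 ^+ n = 2 * 2^-1 ^+ n.+1 :> R by rewrite exprS; lra.
have h0 : 0 <= 2^-1 ^+ n.+1 :> R by apply: exprn_ge0; lra.
have [|q [v [w [eq sq]]]] := compare_le rkP ee pp; first by rewrite re rp h; lra.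
have [_ qq] := equivalent_idem eq; have [_ rq] := equivalent_rk rkP eq.
by exists q; split; rewrite ?(rk_subB rkP)// rq re// rp h; lra.
Qed.

Lemma dyadic_partition p n : p * p = p -> rk p = 2^-1 ^+ n ->
  exists e : nat -> A, [/\ forall i, e i * e i = e i, forall i, subidem (e i) p,
    forall i, rk (e i) = 2^-1 ^+ (n + i).+1 &
    forall i j, i <> j -> e i * e j = 0].
Proof.
move=> pp rp.
have stepP (s : A * nat) : exists q, s.1 * s.1 = s.1 -> rk s.1 = 2^-1 ^+ s.2 ->
    [/\ q * q = q, subidem q s.1, rk q = 2^-1 ^+ s.2.+1 &
      rk (s.1 - q) = 2^-1 ^+ s.2.+1].
  have [[h1 h2]|h] := pselect (s.1 * s.1 = s.1 /\ rk s.1 = 2^-1 ^+ s.2).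
    by have [q] := half_idem h1 h2; exists q.
  by exists 0 => h1 h2; case: h.
have [F FP] := choice stepP.
pose r := fix r i := if i is i'.+1 then r i' - F (r i', (n + i')%N) else p.
have r0 : r 0%N = p by [].
have rS i : r i.+1 = r i - F (r i, (n + i)%N) by [].
clearbody r; pose e i := F (r i, (n + i)%N).
have inv i : r i * r i = r i /\ rk (r i) = 2^-1 ^+ (n + i)%N.
  elim: i => [|i [IH1 IH2]]; first by rewrite r0 addn0.
  have /= [h1 h2 h3 h4] := FP (r i, (n + i)%N) IH1 IH2.
  by rewrite rS addnS; have [] := idemB h1 IH1 h2.
have eP i : [/\ e i * e i = e i, subidem (e i) (r i), rk (e i) = 2^-1 ^+ (n + i).+1
    & e i * r i.+1 = 0 /\ r i.+1 * e i = 0].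
  have [h1 h2] := inv i; have /= [h3 h4 h5 h6] := FP (r i, (n + i)%N) h1 h2.
  by split=> //; rewrite rS; have [] := idemB h3 h1 h4.
have rk_ i k : subidem (r (i + k)%N) (r i).
  elim: k => [|k IH]; first by rewrite addn0; have [] := inv i.
  apply: subidem_trans IH; rewrite addnS rS.
  have [h1 _] := inv (i + k)%N; have [h3 h4 _ _] := eP (i + k)%N.
  by have [] := idemB h3 h1 h4.
have lt i j : (i < j)%N -> e i * e j = 0 /\ e j * e i = 0.
  move=> ij; have [_ h _ _] := eP j; have [_ _ _ [h1 h2]] := eP i.
  have {}h : subidem (e j) (r i.+1).
    by apply: subidem_trans h _; rewrite -(subnKC ij).
  by have [] := subidem_orth h h2 h1.
exists e; split=> [i|i|i|i j ij]; try by have [] := eP i.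
  have [_ h _ _] := eP i; apply: subidem_trans h _.
  by rewrite -r0 -{1}(add0n i).
by have [/lt[]|/lt[]|] := ltngtP i j.
Qed.

Lemma three_pieces p n : p * p = p -> rk p = 2^-1 ^+ n -> exists a b c,
  [/\ [/\ a * a = a, b * b = b & c * c = c],
      [/\ subidem a p, subidem b p & subidem c p],
      [/\ rk a = 2^-1 ^+ n.+2, rk b = 2^-1 ^+ n.+2 & rk c = 2^-1 ^+ n.+2],
      [/\ a * b = 0, b * a = 0 & b * c = 0] &
      [/\ c * b = 0, a * c = 0 & c * a = 0]].
Proof.
move=> pp rp; have [d [dd sd rd rd']] := half_idem pp rp.
have [d1 d2 d3 d4] := idemB dd pp sd.
have [a [aa sa ra ra']] := half_idem dd rd.
have [a1 a2 a3 a4] := idemB aa dd sa.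
have [c [cc sc rc _]] := half_idem d1 rd'.
have [c1 c2] := subidem_orth sc d4 d3.
have [a5 a6] := subidem_orth sa c2 c1.
have [b5 b6] := subidem_orth a2 c2 c1.
exists a, (d - a), c; split; split => //.
- exact: subidem_trans sd.
- exact: subidem_trans sd.
- exact: subidem_trans d2.
Qed.

End Dyadic.

(** * Automatic continuity of length functions *)

Section Units.
Variable A : unitRingType.
Implicit Types (x y z : A).

Lemma unit_mul x y : x \is a GRing.unit -> y \is a GRing.unit ->
  x * y \is a GRing.unit.
Proof. by move=> xu yu; rewrite unitrMl. Qed.

Lemma unit_intro x y : x * y = 1 -> y * x = 1 -> x \is a GRing.unit /\ x^-1 = y.
Proof.
move=> xy yx; have xu : x \is a GRing.unit by apply/unitrP; exists y.
by split=> //; rewrite -[RHS]mul1r -(mulVr xu) -mulrA xy mulr1.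
Qed.

Lemma unipotent_unit x : x * x = 0 -> 1 + x \is a GRing.unit /\ (1 + x)^-1 = 1 - x.
Proof. by move=> xx; apply: unit_intro; peirce. Qed.

End Units.

Section LengthFunctions.
Variables (R : realType) (A : unitRingType) (rk : A -> R).
Hypothesis rkP : rank_ring rk.
Variable l : A -> R.
Implicit Types (e f p q v w x y : A).

(** [len_cover] is the only trace of the compact space in the continuity argument. *)
Record length_function : Prop := LengthFunction {
  lenM : forall x y, x \is a GRing.unit -> y \is a GRing.unit ->
    l (x * y) <= l x + l y;
  lenV : forall x, x \is a GRing.unit -> l x^-1 = l x;
  len_cover : forall e : R, 0 < e -> exists g : nat -> A,
    (forall n, g n \is a GRing.unit) /\
    forall x, x \is a GRing.unit -> exists n, l (x * (g n)^-1) <= e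
}.

Hypothesis lP : length_function.

(** Every unit of eAe occurs as the e-block of a block diagonal unit of A of length at most [c]; the
    block on 1 - e is not controlled. *)
Definition full (e : A) (c : R) := forall u u', equivalent e e u u' ->
  exists w, [/\ w \is a GRing.unit, l w <= c, w * e = u & e * w = u].

(* If no e_n were full, a diagonal element chosen to avoid the n-th translate
   in its e_n block would lie in none of them. *)
Lemma exists_full (c : R) (e : nat -> A) : 0 < c -> (forall n, e n * e n = e n) ->
  (forall n, rk (e n) <= 2^-1 ^+ n) -> (forall i j, i <> j -> e i * e j = 0) ->
  exists n, full (e n) (2 * c).
Proof.
move=> c0 ee re eo; have [g [gu gc]] := len_cover lP c0.
have [n Hn] : exists n, forall u u', equivalent (e n) (e n) u u' ->
    exists y, [/\ y \is a GRing.unit, y * e n = u, e n * y = u & l (y * (g n)^-1) <= c].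
  apply: contrapT => /forallNP H.
  have H' n : exists uu : A * A, equivalent (e n) (e n) uu.1 uu.2 /\ forall y,
      y \is a GRing.unit -> y * e n = uu.1 -> e n * y = uu.1 ->
      l (y * (g n)^-1) <= c -> False.
    apply: contrapT => /forallNP H'; apply: (H n) => u u' uu'.
    apply: contrapT => /forallNP H2; apply: (H' (u, u')); split=> //= y y1 y2 y3 y4.
    by apply: (H2 y).
  have [U UP] := choice H'.
  pose x n := (U n).1 - e n; pose x' n := (U n).2 - e n.
  have xC n : corner (e n) (e n) (x n).
    by apply: cornerB; [case: (UP n) => [[]]|split; rewrite ee].
  have x'C n : corner (e n) (e n) (x' n).
    by apply: cornerB; [case: (UP n) => [[]]|split; rewrite ee].
  have xs n : rk (x n) <= 1 * 2^-1 ^+ n.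
    by have [h _] := rk_corner rkP (xC n); rewrite mul1r (le_trans h).
  have x's n : rk (x' n) <= 1 * 2^-1 ^+ n.
    by have [h _] := rk_corner rkP (x'C n); rewrite mul1r (le_trans h).
  have [X XP] := sums_exist rkP xs; have [X' XP'] := sums_exist rkP x's.
  have ort (y z : nat -> A) : (forall n, corner (e n) (e n) (y n)) ->
      (forall n, corner (e n) (e n) (z n)) -> forall i j, i <> j -> y i * z j = 0.
    move=> hy hz i j /eo ij; have [_ h1] := hy i; have [h2 _] := hz j.
    exact: mulr_kill h1 ij h2.
  (* In each block the product relation says y + y' + yy' = 0. This additive form survives summation
     because mixed products vanish. *)
  have circ0 (y y' : nat -> A) Y Y' : (forall n, corner (e n) (e n) (y n)) ->
      (forall n, corner (e n) (e n) (y' n)) ->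
      (forall n, (e n + y n) * (e n + y' n) = e n) ->
      sums rk y Y -> sums rk y' Y' -> (1 + Y) * (1 + Y') = 1.
    move=> hy hy' yy' YP YP'.
    have := sumsD rkP (sumsD rkP YP YP') (sumsM rkP (ort _ _ hy hy') YP YP').
    set S := _ + _ => SP; suff : S = 0 by rewrite /S => h; rewrite -[RHS]addr0 -h; peirce.
    apply: (conv_const rkP _ SP) => n; apply: big1 => i _.
    have := yy' i; have [h1 h2] := hy i; have [h3 h4] := hy' i; have h5 := ee i.
    have -> : (e i + y i) * (e i + y' i) = e i + (y i + y' i + y i * y' i) by peirce.
    by move=> h; apply: (addrI (e i)); rewrite addr0.
  have exE n : e n + x n = (U n).1 by rewrite /x addrC subrK.
  have exE' n : e n + x' n = (U n).2 by rewrite /x' addrC subrK.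
  have XX' : (1 + X) * (1 + X') = 1.
    by apply: circ0 XP XP' => // n; rewrite exE exE'; case: (UP n) => [[]].
  have X'X : (1 + X') * (1 + X) = 1.
    by apply: circ0 XP' XP => // n; rewrite exE exE'; case: (UP n) => [[]].
  have [Xu _] := unit_intro XX' X'X.
  have [n ln] := gc _ Xu.
  case: (UP n) => [_ /(_ (1 + X) Xu)]; apply=> //.
    rewrite mulrDl mul1r (sums_pickr rkP _ XP (n := n)); last first.
      by move=> i /eo h; have [_ h1] := xC i; rewrite -h1 -mulrA h mulr0.
    by have [_ ->] := xC n.
  rewrite mulrDr mulr1 (sums_pickl rkP _ XP (n := n)); last first.
    by move=> i /nesym /eo h; have [h1 _] := xC i; rewrite -h1 mulrA h mul0r.
  by have [-> _] := xC n.
(* [y1] realizes the identity block near the same translate [g n]; dividing by it removes [g n],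
   which explains the bound 2c. *)
have [|y1 [y1u y1e ey1 y1l]] := Hn (e n) (e n); first exact: equivalent_refl.
exists n => u u' uu'; have [y [yu ye ey yl]] := Hn u u' uu'.
have y1V : y1^-1 * e n = e n by rewrite -{1}y1e mulKr.
have Vy1 : e n * y1^-1 = e n by rewrite -{1}ey1 mulrK.
exists (y * y1^-1); split.
- by apply: unit_mul; rewrite ?unitrV.
- have -> : y * y1^-1 = (y * (g n)^-1) * (y1 * (g n)^-1)^-1.
    by rewrite invrM ?unitrV// invrK mulrA mulrVK.
  have h z : z \is a GRing.unit -> z * (g n)^-1 \is a GRing.unit.
    by move=> zu; apply: unit_mul; rewrite ?unitrV.
  rewrite (le_trans (lenM lP (h _ yu) _)) ?unitrV ?h// (lenV lP) ?h//; lra.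
- by rewrite -mulrA y1V.
- by rewrite mulrA ey; case: uu' => [[_ ue] _ _ _]; rewrite -ue -mulrA Vy1.
Qed.

(** Fullness replaces [h] by a unit w of A with the same e-block. Conjugation by w acts on eAe as
    conjugation by [h], and w and its inverse cost [c] each. *)
Lemma full_conj e c h h' x : full e c -> equivalent e e h h' -> corner e e x ->
  1 + x \is a GRing.unit ->
  1 + h * x * h' \is a GRing.unit /\ l (1 + h * x * h') <= l (1 + x) + 2 * c.
Proof.
move=> fe hh' [ex xe] xu; have [w [wu lw we ew]] := fe _ _ hh'.
case: hh' => [[eh he] [eh' h'e] h'h hh'].
have wV : e * w^-1 = h'.
  by rewrite -h'h -ew mulrA h'e mulrK.
have -> : 1 + h * x * h' = w * (1 + x) * w^-1.
  rewrite mulrDr mulrDl mulr1 mulrV//; congr (_ + _).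
  by rewrite -we -wV -ex -xe; peirce.
have wxu := unit_mul wu xu; have wVu : w^-1 \is a GRing.unit by rewrite unitrV.
split; first exact: unit_mul.
by have := lenM lP wu xu; have := lenM lP wxu wVu; rewrite (lenV lP)//; lra.
Qed.

(** Cantor's diagonal sequence [d], evaluated at its own index [phi d]: the value true is
    contradictory, and the value false produces the partner [s] of [d]. *)
Lemma cantor_collision (phi : (nat -> bool) -> nat) :
  exists s t i, [/\ phi s = phi t, s i = true & t i = false].
Proof.
apply: contrapT => H.
pose d i := ~~ `[< exists s, phi s = i /\ s i = true >].
case: (boolP (d (phi d))) => hd.
  have := hd; rewrite {1}/d => /asboolPn; apply; by exists d.
have := hd; rewrite {1}/d negbK => /asboolP[s [sd st]].
by apply: H; exists s, d, (phi d); split=> //; exact: negbTE.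
Qed.

(* Two of the uncountably many elements 1 + \sum_i t_i v_i, for t in 2^N, lie in
   the same translate. *)
Lemma full_square_zero e c n : 0 < c -> e * e = e -> rk e = 2^-1 ^+ n ->
  exists a p q o v w m, [/\
    [/\ corner e e a, a * a = 0 & l (1 + a) <= 2 * c],
    [/\ p * p = p, o * o = o, p * o = 0 & o * p = 0],
    [/\ subidem p e, subidem o e & subidem q e],
    [/\ rk p = 2^-1 ^+ m & rk o = 2^-1 ^+ m] &
    [/\ equivalent q p v w, a * q = v, o * a = 0 & q * o = 0 /\ o * q = 0]].
Proof.
move=> c0 ee re; have [g [gu gc]] := len_cover lP c0.
have [f [ff fe fr fo]] := dyadic_partition rkP ee re.
have H i : exists r : (A * A * A) * (A * A),
    [/\ [/\ r.1.1.1 * r.1.1.1 = r.1.1.1, r.1.1.2 * r.1.1.2 = r.1.1.2 &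
            r.1.2 * r.1.2 = r.1.2],
        [/\ subidem r.1.1.1 (f i), subidem r.1.1.2 (f i) & subidem r.1.2 (f i)],
        [/\ rk r.1.1.1 = 2^-1 ^+ (n + i).+3 & rk r.1.2 = 2^-1 ^+ (n + i).+3],
        [/\ r.1.1.1 * r.1.1.2 = 0, r.1.1.2 * r.1.1.1 = 0 & r.1.1.2 * r.1.2 = 0] &
        [/\ r.1.2 * r.1.1.2 = 0, r.1.1.1 * r.1.2 = 0, r.1.2 * r.1.1.1 = 0 &
            equivalent r.1.1.2 r.1.1.1 r.2.1 r.2.2]].
  have [p [q [ o [[pp qq oo] [sp sq so] [rp rq ro] [pq qp qo] [oq po op]]]]] :=
    three_pieces rkP (ff i) (fr i).
  have [|v [w vw]] := compare_eq rkP qq pp; first by rewrite rp rq.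
  by exists ((p, q, o), (v, w)).
have [r rP] := choice H.
pose v i := (r i).2.1.
have vC i : corner (r i).1.1.1 (r i).1.1.2 (v i).
  by case: (rP i) => [_ _ _ _ [_ _ _ []]].
have vf i : corner (f i) (f i) (v i).
  by case: (rP i) => [_ [s1 s2 _] _ _ _]; exact: corner_sub s1 s2 (vC i).
have ve i : corner e e (v i) by apply: corner_sub (fe i) (fe i) (vf i).
have vv i j : v i * v j = 0.
  have [<-|/eqP/fo ij] := eqVneq i j.
    have [h1 h2] := vC i; case: (rP i) => [_ _ _ [_ h _] _].
    exact: mulr_kill h2 h h1.
  by have [_ h1] := vf i; have [h2 _] := vf j; exact: mulr_kill h1 ij h2.
have ov i j : (r i).1.2 * v j = 0.
  have [[_ _ oo] [_ _ [of_ fo']] _ _ [_ _ op _]] := rP i.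
  have [<-|/eqP/fo ij] := eqVneq i j.
    by have [h1 h2] := vC i; exact: mulr_kill oo op h1.
  by have [h2 _] := vf j; exact: mulr_kill of_ ij h2.
have vq i j : j <> i -> v j * (r i).1.1.2 = 0.
  move=> /fo ij; have [_ [_ [_ fq] _] _ _ _] := rP i.
  by rewrite -fq mulrA; have [_ h] := vf j; rewrite -h -(mulrA _ (f j)) ij mulr0 mul0r.
have rv i : rk (v i) <= 1 * 2^-1 ^+ i.
  have [h _] := rk_corner rkP (vf i); rewrite mul1r (le_trans h)// fr.
  by apply: half_expn_le; rewrite -addnS addnC; apply: leq_trans (leq_addr _ _); exact: leqnSn.
have tP (t : nat -> bool) : exists a, sums rk (fun i => if t i then v i else 0) a.
  apply: (sums_exist rkP (c := 1)) => i; case: (t i); first exact: rv.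
  by rewrite (rk0 rkP) mul1r; apply: exprn_ge0; lra.
have [a aP] := choice tP.
have aC t : corner e e (a t).
  split; [apply: sums_fixl (aP t)|apply: sums_fixr (aP t)] => // i;
  by case: (t i); rewrite ?mulr0 ?mul0r//; case: (ve i).
have ya y t : (forall i, y * v i = 0) -> y * a t = 0.
  move=> yv; apply: (conv_const rkP _ (sumsMl rkP y (aP t))) => k.
  by apply: big1 => i _; case: (t i); rewrite ?mulr0.
have ay y t : (forall i, v i * y = 0) -> a t * y = 0.
  move=> yv; apply: (conv_const rkP _ (sumsMr rkP y (aP t))) => k.
  by apply: big1 => i _; case: (t i); rewrite ?mul0r.
have aa s t : a s * a t = 0 by apply: ya => i; exact: ay.
have xu t : 1 + a t \is a GRing.unit /\ (1 + a t)^-1 = 1 - a t.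
  exact: unipotent_unit.
have phiP t : exists k, l ((1 + a t) * (g k)^-1) <= c by apply: gc; case: (xu t).
have [phi phiE] := choice phiP.
have [s [t [i [st si ti]]]] := cantor_collision phi.
have [[pp qq oo] [sp sq so] [rp ro] [pq qp qo] [oq po op vw]] := rP i.
(* All products of the [a t] vanish, so (1 + a_s)(1 + a_t)^-1 = 1 + (a_s - a_t), and right
   multiplication by the i-th middle piece isolates [v i]. Each [f i] was cut into three quarters,
   whence the exponent. *)
exists (a s - a t), (r i).1.1.1, (r i).1.1.2, (r i).1.2, (v i), (r i).2.2, (n + i).+3.
split=> //.
- split; [exact: cornerB| by rewrite mulrBl !mulrBr !aa !subrr|].
  have [su _] := xu s; have [tu tV] := xu t.
  have -> : 1 + (a s - a t) = ((1 + a s) * (g (phi s))^-1) *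
      ((1 + a t) * (g (phi t))^-1)^-1.
    rewrite invrM ?unitrV// invrK st !mulrA mulrVK// tV.
    by have ast := aa s t; peirce.
  have h y : y \is a GRing.unit -> y * (g (phi t))^-1 \is a GRing.unit.
    by move=> yu; apply: unit_mul; rewrite ?unitrV.
  have := phiE s; have := phiE t; rewrite st => l1 l2.
  rewrite (le_trans (lenM lP (h _ su) _)) ?unitrV ?h// (lenV lP) ?h//; lra.
- by split; exact: subidem_trans (fe i).
split=> //; last by rewrite mulrBr !ya ?subrr.
rewrite mulrBl (sums_pickr rkP _ (aP s) (n := i)); last first.
  by move=> j ji; case: (s j); rewrite ?mul0r ?vq.
rewrite (sums_pickr rkP _ (aP t) (n := i)); last first.
  by move=> j ji; case: (t j); rewrite ?mul0r ?vq.
by rewrite si ti mul0r subr0; case: (vC i).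
Qed.

(** With s = wy, so that as = y and sa = 0, the element 1 + y is the product of 1 + a and the
    conjugate of 1 - a by the unit e + s of eAe. The costs are 2c for the first factor and 2c + 2 *
    2c for the second. *)
Lemma full_elementary e c n : 0 < c -> e * e = e -> rk e = 2^-1 ^+ n ->
  full e (2 * c) -> exists p o m,
  [/\ [/\ p * p = p, o * o = o, p * o = 0 & o * p = 0],
    subidem p e, subidem o e, rk p = 2^-1 ^+ m /\ rk o = 2^-1 ^+ m &
    forall y, corner p o y -> l (1 + y) <= 8 * c].
Proof.
move=> c0 ee re fe.
have [a [p [q [ o [v [w [m [[aC aa la] [pp oo po op] [sp so sq] [rp ro]]]]]]]]] :=
  full_square_zero c0 ee re.
move=> [[[pv vq] [qw wp] wv vw] aq oa [qo oq]].
exists p, o, m; split=> // y [py yo].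
have [s sE] : exists s, s = w * y by eexists.
have as_ : a * s = y.
  by rewrite sE -qw -mulrA mulrA aq mulrA vw.
have sa : s * a = 0 by rewrite sE -yo -!mulrA oa !mulr0.
have ss : s * s = 0 by rewrite sE -yo -!mulrA (mulrA o) -qw (mulrA o q) oq !mul0r !mulr0.
have sC : corner e e s.
  rewrite sE; apply: (corner_sub sq so); split; first by rewrite mulrA qw.
  by rewrite -mulrA yo.
have [es se] := sC; have [ea ae] := aC.
have [au aV] := unipotent_unit aa.
have hC : equivalent e e (e + s) (e - s).
  by split; [split|split| |]; peirce.
have [|] := full_conj fe hC (cornerN aC); first by rewrite -aV unitrV.
have -> : 1 + y = (1 + a) * (1 + (e + s) * - a * (e - s)) by rewrite -as_; peirce.
move=> hu hl; rewrite (le_trans (lenM lP au hu))//.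
by move: hl; rewrite -aV (lenV lP)//; lra.
Qed.

End LengthFunctions.

(** * From elementary matrices to a whole corner, and continuity at 1 *)

Section Swindle.
Variables (R : realType) (A : unitRingType) (rk : A -> R).
Hypothesis rkP : rank_ring rk.
Variable l : A -> R.
Hypothesis lP : length_function l.
Implicit Types (e f p q v w x y : A).

Definition small (c : R) p q := forall y, corner p q y -> l (1 + y) <= c.

(** A unit of eAe conjugates the corner between [f] and [g] into the one between [p] and [o];
    conjugating back costs 2c' by fullness. *)
Lemma elementary_small e p o m (c c' : R) : e * e = e -> full l e c' ->
  p * p = p -> o * o = o -> p * o = 0 -> o * p = 0 ->
  subidem p e -> subidem o e -> rk p = 2^-1 ^+ m -> rk o = 2^-1 ^+ m ->
  small c p o ->
  forall f g, f * f = f -> g * g = g -> f * g = 0 -> g * f = 0 ->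
    subidem f e -> subidem g e -> rk f <= 2^-1 ^+ m -> rk g <= 2^-1 ^+ m ->
    small (c + 2 * c') f g.
Proof.
move=> ee fe pp oo po op pe oe rp ro sm f g ff gg fg gf fse gse rf rg y yC.
rewrite -{}rp in rf; rewrite -{}ro in rg.
have [h [h' [hh' hy]]] :=
  conj_corner rkP ee ff gg pp oo fse gse pe oe fg gf po op rf rg.
have := sm _ (hy y yC); have y0C := corner_sub pe oe (hy y yC).
have [he [h1 h2]] : corner e e y /\ corner p o (h * y * h').
  by split; [apply: corner_sub fse gse yC|exact: hy].
have yy : (h * y * h') * (h * y * h') = 0 by apply: mulr_kill h2 op h1.
have [yu _] := unipotent_unit yy.
have {}yC : h' * (h * y * h') * h = y.
  case: hh' he => [[? ?] [? ?] h'h hh'] [? ?].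
  by rewrite !mulrA h'h -!mulrA h'h; peirce.
have [_] := full_conj lP fe (equivalent_sym hh') y0C yu.
by rewrite yC; lra.
Qed.

(** The circle composition: units are handled as 1 + x through [x], which, unlike 1 + x, can be
    summed over infinitely many blocks. *)
Definition circ x y := x + y + x * y.

Lemma circE x y : (1 + x) * (1 + y) = 1 + circ x y.
Proof. by rewrite /circ; peirce. Qed.

Lemma small_unit p q x : q * p = 0 -> corner p q x -> 1 + x \is a GRing.unit.
Proof.
move=> qp [px xq]; have xx : x * x = 0 by apply: mulr_kill xq qp px.
by case: (unipotent_unit xx).
Qed.

(** diag(d, d^-1) = E12(d) E21(-d^-1) E12(d) E12(-1) E21(1) E12(-1); the two adjacent factors E12
    merge into E12(d - 1), which leaves five. *)
Lemma whitehead (c : R) p q v w d d' : p * q = 0 -> q * p = 0 ->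
  equivalent p q v w -> equivalent p p d d' -> small c p q -> small c q p ->
  let z := 1 + (d - p) + (v * d' * w - q) in
  z \is a GRing.unit /\ l z <= 5 * c.
Proof.
move=> pq qp vw dd spq sqp z.
have [pp qq] := equivalent_idem vw.
case: vw dd => [[qv vp] [pw wq] wv vw] [[pd dp] [pd' d'p] d'd dd'].
have x1 : corner p q (d * w) by split; peirce.
have x2 : corner q p (- (v * d')) by split; peirce.
have x3 : corner p q ((d - p) * w) by split; peirce.
have x4 : corner q p v by split; peirce.
have x5 : corner p q (- w) by split; peirce.
have zE : z = (1 + d * w) * ((1 - v * d') * ((1 + (d - p) * w) *
    ((1 + v) * (1 - w)))).
  by rewrite /z; peirce.
have u1 := small_unit qp x1; have u2 := small_unit pq x2.
have u3 := small_unit qp x3; have u4 := small_unit pq x4.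
have u5 := small_unit qp x5.
have u45 := unit_mul u4 u5; have u35 := unit_mul u3 u45.
have u25 := unit_mul u2 u35; have u15 := unit_mul u1 u25.
rewrite zE; split=> //.
have := lenM lP u1 u25; have := lenM lP u2 u35; have := lenM lP u3 u45.
have := lenM lP u4 u5; have := spq _ x1; have := sqp _ x2; have := spq _ x3.
by have := sqp _ x4; have := spq _ x5; lra.
Qed.

(* The swindle: if u_0 = X_0 u_1, u_1 = X_1 u_2, etc. with each u_(i+1) living in
   a corner half the size of that of u_i and each X_i a product of four
   elementary matrices, then diag(u_0, u_1, ...) is diag(X_0, X_1, ...) times a
   conjugate of diag(1, u_1, u_2, ...), and Whitehead's lemma applies to both. *)
Lemma corner_small (c : R) e t o m : e * e = e -> t * t = t -> o * o = o ->
  t * o = 0 -> o * t = 0 -> subidem t e -> subidem o e ->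
  rk t = 2^-1 ^+ m -> rk o = 2^-1 ^+ m ->
  (forall f g, f * f = f -> g * g = g -> f * g = 0 -> g * f = 0 ->
    subidem f e -> subidem g e -> rk f <= 2^-1 ^+ m -> rk g <= 2^-1 ^+ m ->
    small c f g) ->
  exists p, [/\ p * p = p, rk p = 2^-1 ^+ m.+1 &
    forall u u', equivalent p p u u' -> l (1 - p + u) <= 14 * c].
Proof.
move=> ee tt oo to ot te oe rt ro sm.
have [C [CC Ct rC Co]] := dyadic_partition rkP tt rt.
have CS i : rk (C i.+1) = 2^-1 * rk (C i) by rewrite !rC addnS exprS.
(* [G i] is a copy of the next corner [C i.+1] inside [C i]; it has half the rank, so block
   elimination applies to [C i] = [F i] + [G i]. *)
have H i : exists r : A * (A * A),
    equivalent (C i.+1) r.1 r.2.1 r.2.2 /\ subidem r.1 (C i).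
  have [|g [v [w [h1 h2]]]] := compare_le rkP (CC i.+1) (CC i).
    by rewrite CS; have := rk_ge0 rkP (C i); lra.
  by exists (g, (v, w)).
have [r rP] := choice H.
pose G i := (r i).1; pose V i := (r i).2.1; pose W i := (r i).2.2.
have VW i : equivalent (C i.+1) (G i) (V i) (W i) by case: (rP i).
have GsC i : subidem (G i) (C i) by case: (rP i).
clearbody G V W; clear r rP H.
have [F FE] : exists F, forall i, F i = C i - G i by exists (fun i => C i - G i).
have GG i : G i * G i = G i by have [] := equivalent_idem (VW i).
have FP i : [/\ F i * F i = F i, subidem (F i) (C i), G i * F i = 0 & F i * G i = 0].
  by rewrite FE; exact: idemB (GG i) (CC i) (GsC i).
have rFG i : rk (F i) <= rk (G i).
  have [_ h] := equivalent_rk rkP (VW i).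
  by rewrite FE (rk_subB rkP)// h CS; have := rk_ge0 rkP (C i); lra.
have FG i : F i + G i = C i by rewrite FE; peirce.
have stepP (s : nat * (A * A)) : exists r : (A * A) * (A * A) * (A * A),
    equivalent (C s.1) (C s.1) s.2.1 s.2.2 ->
    [/\ corner (G s.1) (F s.1) r.1.1.1, corner (F s.1) (G s.1) r.1.1.2,
      corner (G s.1) (F s.1) r.1.2.1, corner (F s.1) (G s.1) r.1.2.2 &
      equivalent (G s.1) (G s.1) r.2.1 r.2.2 /\ 1 - C s.1 + s.2.1 =
        (1 + r.1.1.1) * ((1 + r.1.1.2) * ((1 + r.1.2.1) * ((1 + r.1.2.2) *
          (1 - G s.1 + r.2.1))))].
  have [h|h] := pselect (equivalent (C s.1) (C s.1) s.2.1 s.2.2); last first.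
    by exists ((0, 0), (0, 0), (0, 0)).
  have [FF _ gf fg] := FP s.1; move: h; rewrite -FG => h.
  have [l1 [r1 [l2 [r2 [d [d' H]]]]]] :=
    block_elimination rkP FF (GG _) fg gf (rFG _) h.
  by exists ((l1, r1), (l2, r2), (d, d')).
have [S SP] := choice stepP.
exists (C 0%N); split=> //; first by rewrite rC addn0.
move=> u0 u0' uP.
(* The recursion carries each unit together with its inverse. The block left on [G i] by the
   elimination is transported to [C i.+1]. *)
pose U := fix U i := if i is j.+1 then
  let d := (S (j, U j)).2 in (W j * d.1 * V j, W j * d.2 * V j) else (u0, u0').
have US i : U i.+1 = (W i * (S (i, U i)).2.1 * V i, W i * (S (i, U i)).2.2 * V i) by [].
have U0 : U 0%N = (u0, u0') by [].
clearbody U.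
have UP i : equivalent (C i) (C i) (U i).1 (U i).2.
  elim: i => [|i IH]; first by rewrite U0.
  have /= [_ _ _ _ [h _]] := SP (i, U i) IH; rewrite US /=.
  move: h (VW i); move: (S _).2.1 (S _).2.2 (V i) (W i) => d d' v w.
  move=> [[gd dg] [gd' d'g] dd' d'd] [[gv vc] [cw wg] wv vw].
  by split; [split|split| |]; peirce.
pose D i := (U i).1 - C i; pose D' i := (U i).2 - C i.
pose L1 i := (S (i, U i)).1.1.1; pose R1 i := (S (i, U i)).1.1.2.
pose L2 i := (S (i, U i)).1.2.1; pose R2 i := (S (i, U i)).1.2.2.
pose Z i := (S (i, U i)).2.1 - G i.
have SE i : [/\ corner (G i) (F i) (L1 i), corner (F i) (G i) (R1 i),
    corner (G i) (F i) (L2 i), corner (F i) (G i) (R2 i) &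
    [/\ corner (G i) (G i) (Z i), Z i = V i * D i.+1 * W i &
      D i = circ (L1 i) (circ (R1 i) (circ (L2 i) (circ (R2 i) (Z i))))]].
  have /= [h1 h2 h3 h4 [h5 h6]] := SP (i, U i) (UP i).
  have h7 : corner (G i) (G i) (Z i).
    by case: h5 => [h5 _ _ _]; apply: cornerB => //; split; exact: GG.
  split=> //; split=> //.
    rewrite /D US /= -/(Z i) /Z; have [[gv vc] [cw wg] wv vw] := VW i.
    case: h5 => [[gd dg] _ _ _]; move: (S _).2.1 gd dg => d gd dg.
    by peirce.
  apply: (addrI 1); rewrite -!circE /D.
  have -> : 1 + ((U i).1 - C i) = 1 - C i + (U i).1 by rewrite addrA addrAC.
  have -> : 1 + Z i = 1 - G i + (S (i, U i)).2.1 by rewrite /Z addrA addrAC.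
  exact: h6.
have DC i : corner (C i) (C i) (D i).
  by case: (UP i) => [h _ _ _]; apply: cornerB => //; split; exact: CC.
have DC' i : corner (C i) (C i) (D' i).
  by case: (UP i) => [_ h _ _]; apply: cornerB => //; split; exact: CC.
have DD' i : circ (D i) (D' i) = 0 /\ circ (D' i) (D i) = 0.
  have [[h1 h2] [h3 h4] h5 h6] := UP i; have h7 := CC i.
  by rewrite /circ /D /D'; split; peirce.
have D0 : 1 - C 0%N + u0 = 1 + D 0%N by rewrite /D U0 /= addrA addrAC.
clearbody D D' L1 R1 L2 R2 Z; clear S SP stepP US U0 U UP.
have GF i : subidem (G i) (C i) /\ subidem (F i) (C i) by split=> //; case: (FP i).
have L1C i : corner (C i) (C i) (L1 i).
  by have [g1 f1] := GF i; have [h _ _ _ _] := SE i; exact: corner_sub g1 f1 h.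
have R1C i : corner (C i) (C i) (R1 i).
  by have [g1 f1] := GF i; have [_ h _ _ _] := SE i; exact: corner_sub f1 g1 h.
have L2C i : corner (C i) (C i) (L2 i).
  by have [g1 f1] := GF i; have [_ _ h _ _] := SE i; exact: corner_sub g1 f1 h.
have R2C i : corner (C i) (C i) (R2 i).
  by have [g1 f1] := GF i; have [_ _ _ h _] := SE i; exact: corner_sub f1 g1 h.
have ZC i : corner (C i) (C i) (Z i).
  by have [g1 f1] := GF i; have [_ _ _ _ [h _ _]] := SE i; exact: (corner_sub g1 g1 h).
have GC i : corner (C i) (C i) (G i) by have [[]] := GF i.
have FC i : corner (C i) (C i) (F i) by have [_ []] := GF i.
have CC' i : corner (C i) (C i) (C i) by split; exact: CC.
have VC i : corner (C i) (C i.+1) (V i).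
  have [[h1 h2] _ _ _] := VW i; have [[h3 h4] _] := GF i.
  by split=> //; rewrite -h1 mulrA h4.
have WC i : corner (C i.+1) (C i) (W i).
  have [_ [h1 h2] _ _] := VW i; have [[h3 h4] _] := GF i.
  by split=> //; rewrite -h2 -mulrA h3.
have rCn i : rk (C i) <= 1 * 2^-1 ^+ i.
  rewrite rC mul1r; apply: half_expn_le; rewrite -addnS addnC.
  by apply: leq_trans (leq_addr _ _); exact: leqnSn.
have ex (x q : nat -> A) : (forall i, corner (C i) (q i) (x i)) -> exists X, sums rk x X.
  move=> xC; apply: (sums_exist rkP (c := 1)) => i.
  by have [h _] := rk_corner rkP (xC i); exact: le_trans h (rCn i).
have ex1 (x : nat -> A) : (forall i, corner (C i.+1) (C i.+1) (x i)) ->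
    exists X, sums rk x X.
  move=> xC; apply: (sums_exist rkP (c := 1)) => i.
  have [h _] := rk_corner rkP (xC i); rewrite (le_trans h)// CS.
  by have := rCn i; have := rk_ge0 rkP (C i); lra.
have C1o i j : i <> j -> C i.+1 * C j.+1 = 0 by move=> ij; apply: Co => -[].
have prod (E x y z : nat -> A) X Y T : (forall i j, i <> j -> E i * E j = 0) ->
    (forall i, x i * E i = x i) -> (forall i, E i * y i = y i) ->
    (forall i, x i * y i = z i) -> sums rk x X -> sums rk y Y -> sums rk z T ->
    X * Y = T.
  move=> Eo xE yE xy xX yY zT.
  have h : forall i j, i <> j -> x i * y j = 0.
    by move=> i j ij; apply: mulr_kill (xE i) (Eo _ _ ij) (yE j).
  by apply: (sums_uniq rkP _ zT); apply: sums_ext (sumsM rkP h xX yY).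
have prodC (x y z : nat -> A) X Y T : (forall i, corner (C i) (C i) (x i)) ->
    (forall i, corner (C i) (C i) (y i)) -> (forall i, x i * y i = z i) ->
    sums rk x X -> sums rk y Y -> sums rk z T -> X * Y = T.
  move=> xC yC; apply: (prod C) => // i; first by case: (xC i).
  by case: (yC i).
have prodC1 (x y z : nat -> A) X Y T : (forall i, corner (C i.+1) (C i.+1) (x i)) ->
    (forall i, corner (C i.+1) (C i.+1) (y i)) -> (forall i, x i * y i = z i) ->
    sums rk x X -> sums rk y Y -> sums rk z T -> X * Y = T.
  move=> xC yC; apply: (prod (fun i => C i.+1)) => // i; first by case: (xC i).
  by case: (yC i).
have circS (x y : nat -> A) X Y : (forall i, corner (C i) (C i) (x i)) ->
    (forall i, corner (C i) (C i) (y i)) -> sums rk x X -> sums rk y Y ->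
    (forall i, corner (C i) (C i) (circ (x i) (y i))) /\
    sums rk (fun i => circ (x i) (y i)) (circ X Y).
  move=> xC yC xX yY.
  split=> [i|]; first by apply: cornerD; [exact: cornerD|exact: cornerM (yC i)].
  apply: (sumsD rkP (sumsD rkP xX yY)); apply: (sumsM rkP) => // i j ij.
  by have [_ h1] := xC i; have [h2 _] := yC j; exact: mulr_kill h1 (Co _ _ ij) h2.
have [L1s L1P] := ex _ _ L1C; have [R1s R1P] := ex _ _ R1C.
have [L2s L2P] := ex _ _ L2C; have [R2s R2P] := ex _ _ R2C.
have [Zs ZP] := ex _ _ ZC; have [Ds DP] := ex _ _ DC.
have [Gs GP] := ex _ _ GC; have [Fs FsP] := ex _ _ FC.
have [Vs VP] := ex _ _ VC.
have [Ws WP] : exists X, sums rk W X.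
  apply: (sums_exist rkP (c := 1)) => i.
  by have [_ h] := rk_corner rkP (WC i); exact: le_trans h (rCn i).
have [C1s C1P] := ex1 _ (fun i => CC' i.+1).
have [Y YP] := ex1 _ (fun i => DC i.+1); have [Y' YP'] := ex1 _ (fun i => DC' i.+1).
have DsE : Ds = circ L1s (circ R1s (circ L2s (circ R2s Zs))).
  have [h1 h1'] := circS _ _ _ _ R2C ZC R2P ZP.
  have [h2 h2'] := circS _ _ _ _ L2C h1 L2P h1'.
  have [h3 h3'] := circS _ _ _ _ R1C h2 R1P h2'.
  have [h4 h4'] := circS _ _ _ _ L1C h3 L1P h3'.
  apply: (sums_uniq rkP DP); apply: sums_ext h4' => i.
  by have [_ _ _ _ [_ _ ->]] := SE i.
have YE : Ds = D 0%N + Y.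
  have := sums_uniq rkP YP (sums_S rkP DP) => ->; peirce.
have DY : D 0%N * Y = 0.
  apply: (conv_const rkP _ (sumsMl rkP (D 0%N) YP)) => n; apply: big1 => i _.
  have [_ h1] := DC 0%N; have [h2 _] := DC i.+1.
  by apply: mulr_kill h1 _ h2; exact: Co.
have E1 : 1 + Ds = (1 + D 0%N) * (1 + Y) by rewrite YE; peirce.
have CCs : C1s * C1s = C1s by apply: (prodC1 _ _ _ _ _ _ _ _ _ C1P C1P C1P) => // i; exact: CC.
have GGs : Gs * Gs = Gs by apply: (prodC _ _ _ _ _ _ _ _ _ GP GP GP).
have FFs : Fs * Fs = Fs by apply: (prodC _ _ _ _ _ _ _ _ _ FsP FsP FsP) => // i; case: (FP i).
have s0 : sums rk (fun=> 0) 0.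
  by apply: conv_ext (conv_cst rkP 0) => n; rewrite big1.
have GFs : Gs * Fs = 0 by apply: (prodC _ _ _ _ _ _ _ _ _ GP FsP s0) => // i; case: (FP i).
have FGs : Fs * Gs = 0 by apply: (prodC _ _ _ _ _ _ _ _ _ FsP GP s0) => // i; case: (FP i).
have Yc : corner C1s C1s Y.
  split; first by apply: (prodC1 _ _ _ _ _ _ _ _ _ C1P YP YP) => // i; case: (DC i.+1).
  by apply: (prodC1 _ _ _ _ _ _ _ _ _ YP C1P YP) => // i; case: (DC i.+1).
have Yc' : corner C1s C1s Y'.
  split; first by apply: (prodC1 _ _ _ _ _ _ _ _ _ C1P YP' YP') => // i; case: (DC' i.+1).
  by apply: (prodC1 _ _ _ _ _ _ _ _ _ YP' C1P YP') => // i; case: (DC' i.+1).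
have YY : circ Y Y' = 0 /\ circ Y' Y = 0.
  have h (x y : nat -> A) X1 Y1 : (forall i, corner (C i.+1) (C i.+1) (x i)) ->
      (forall i, corner (C i.+1) (C i.+1) (y i)) -> (forall i, circ (x i) (y i) = 0) ->
      sums rk x X1 -> sums rk y Y1 -> circ X1 Y1 = 0.
    move=> xC yC xy xX yY.
    have o1 i j : i <> j -> x i * y j = 0.
      move=> ij; have [_ h1] := xC i; have [h2 _] := yC j.
      exact: mulr_kill h1 (C1o _ _ ij) h2.
    have := sumsD rkP (sumsD rkP xX yY) (sumsM rkP o1 xX yY).
    by apply: (conv_const rkP) => n; apply: big1 => i _; exact: xy.
  split; [apply: h YP YP' => // i|apply: h YP' YP => // i];
  by case: (DD' i.+1).
have dC : equivalent C1s C1s (C1s + Y) (C1s + Y').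
  case: Yc Yc' YY => [h1 h2] [h3 h4] [h5 h6].
  have h7 : (C1s + Y') * (C1s + Y) = C1s + circ Y' Y by rewrite /circ; peirce.
  have h8 : (C1s + Y) * (C1s + Y') = C1s + circ Y Y' by rewrite /circ; peirce.
  by split; [split|split|rewrite h7 h6 addr0|rewrite h8 h5 addr0]; peirce.
have VWs : equivalent C1s Gs Vs Ws.
  have C1C i : C i.+1 * C i.+1 = C i.+1 by exact: CC.
  have v1 i : C i * V i = V i by case: (VC i).
  have v2 i : V i * C i.+1 = V i by case: (VC i).
  have w1 i : C i.+1 * W i = W i by case: (WC i).
  have w2 i : W i * C i = W i by case: (WC i).
  have g1 i : G i * C i = G i by case: (GC i).
  have g2 i : C i * G i = G i by case: (GC i).
  split; [split|split| |].
  - by apply: (prod C _ _ _ _ _ _ _ _ _ _ GP VP VP) => // i; case: (VW i) => [[]].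
  - by apply: (prod (fun i => C i.+1) _ _ _ _ _ _ _ _ _ _ VP C1P VP).
  - by apply: (prod (fun i => C i.+1) _ _ _ _ _ _ _ _ _ _ C1P WP WP).
  - by apply: (prod C _ _ _ _ _ _ _ _ _ _ WP GP WP) => // i; case: (VW i) => [_ []].
  - by apply: (prod C _ _ _ _ _ _ _ _ _ _ WP VP C1P) => // i; case: (VW i).
  - by apply: (prod (fun i => C i.+1) _ _ _ _ _ _ _ _ _ _ VP WP GP) => // i; case: (VW i).
have ZE : Zs = Vs * Y * Ws.
  have C1C i : C i.+1 * C i.+1 = C i.+1 by exact: CC.
  have o1 i j : i <> j -> V i * D j.+1 = 0.
    by move=> ij; have [_ h1] := VC i; have [h2 _] := DC j.+1;
      exact: mulr_kill h1 (C1o _ _ ij) h2.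
  have o2 i j : i <> j -> V i * D i.+1 * W j = 0.
    move=> ij; have [_ h1] := DC i.+1; have [h2 _] := WC j.
    by rewrite -mulrA (mulr_kill h1 (C1o _ _ ij) h2) mulr0.
  apply: (sums_uniq rkP ZP); apply: sums_ext (sumsM rkP o2 (sumsM rkP o1 VP YP) WP).
  by move=> i; have [_ _ _ _ [_ -> _]] := SE i.
have sub (x : nat -> A) X : (forall i, corner t t (x i)) -> sums rk x X -> subidem X t.
  move=> xt xX; split; first by apply: sums_fixr xX => // i; case: (xt i).
  by apply: sums_fixl xX => // i; case: (xt i).
have Ct' i : corner t t (C i) by case: (Ct i).
have Gt : subidem Gs t.
  by apply: sub GP => i; case: (GF i) => h _; have [] := subidem_trans h (Ct i).
have Ft : subidem Fs t.
  by apply: sub FsP => i; case: (GF i) => _ h; have [] := subidem_trans h (Ct i).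
have C1t : subidem C1s t by apply: sub C1P => i.
have rt_ x : subidem x t -> rk x <= 2^-1 ^+ m by rewrite -rt; exact: rk_subidem.
have rcr : rk C1s <= rk o by rewrite ro; exact: rt_.
(* Neither 1 + Y nor 1 + Zs is bounded by itself. The spare idempotent [o] has room for the inverse
   of the tail, which turns each of them into a Whitehead matrix. *)
have [Os [th [th' [eO Oo]]]] := compare_le rkP CCs oo rcr.
have [_ OO] := equivalent_idem eO.
have rO : rk Os <= 2^-1 ^+ m by rewrite -ro; exact: rk_subidem.
have te_ x : subidem x t -> subidem x e by move=> h; exact: subidem_trans h te.
have Oe : subidem Os e by exact: subidem_trans Oo oe.
have [Ot tO] := subidem_orth Oo ot to.
have [CO OC] := subidem_orth C1t tO Ot.
have [GO OG] := subidem_orth Gt tO Ot.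
have sGF : small c Gs Fs by apply: sm => //; auto.
have sFG : small c Fs Gs by apply: sm => //; auto.
have sCO : small c C1s Os by apply: sm => //; auto.
have sOC : small c Os C1s by apply: sm => //; auto.
have sGO : small c Gs Os by apply: sm => //; auto.
have sOG : small c Os Gs by apply: sm => //; auto.
have [z1u z1l] := whitehead CO OC eO dC sCO sOC.
(* Passing through [C1s] makes the inverse blocks of the two Whitehead matrices the same element
   [Q], which therefore cancels in [E3]. *)
have eGO : equivalent Gs Os (th * Ws) (Vs * th').
  exact: equivalent_trans (equivalent_sym VWs) eO.
have [[GV VC1] [C1W WG] WV VW'] := VWs; have [CY YC] := Yc; have [CY' Y'C] := Yc'.
have dG : equivalent Gs Gs (Gs + Vs * Y * Ws) (Gs + Vs * Y' * Ws).
  have [YY1 YY2] := YY.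
  have h7 : (Gs + Vs * Y' * Ws) * (Gs + Vs * Y * Ws) = Gs + Vs * circ Y' Y * Ws.
    by rewrite /circ; peirce.
  have h8 : (Gs + Vs * Y * Ws) * (Gs + Vs * Y' * Ws) = Gs + Vs * circ Y Y' * Ws.
    by rewrite /circ; peirce.
  split; [split|split|rewrite h7 YY2|rewrite h8 YY1]; by peirce.
have [z2u z2l] := whitehead GO OG eGO dG sGO sOG.
move: z1u z1l z2u z2l.
have -> : th * Ws * (Gs + Vs * Y' * Ws) * (Vs * th') = th * (C1s + Y') * th'.
  by have [[? ?] [? ?] ? ?] := eO; peirce.
have [Q QE] : exists Q, Q = th * (C1s + Y') * th' - Os by eexists.
have [OQ QO] : Os * Q = Q /\ Q * Os = Q.
  by rewrite QE; have [[? ?] [? ?] ? ?] := eO; split; peirce.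
rewrite -QE; have -> : 1 + (C1s + Y - C1s) + Q = (1 + Y) * (1 + Q) by peirce.
have -> : 1 + (Gs + Vs * Y * Ws - Gs) + Q = (1 + Vs * Y * Ws) * (1 + Q) by peirce.
rewrite -ZE => z1u z1l z2u z2l.
have E2 : 1 + Ds = (1 + L1s) * ((1 + R1s) * ((1 + L2s) * ((1 + R2s) * (1 + Zs)))).
  by rewrite !circE DsE.
have L1c : corner Gs Fs L1s.
  split; first by apply: (prodC _ _ _ _ _ _ _ _ _ GP L1P L1P) => // i; case: (SE i) => [[]].
  by apply: (prodC _ _ _ _ _ _ _ _ _ L1P FsP L1P) => // i; case: (SE i) => [[]].
have R1c : corner Fs Gs R1s.
  split; first by apply: (prodC _ _ _ _ _ _ _ _ _ FsP R1P R1P) => // i; case: (SE i) => [_ []].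
  by apply: (prodC _ _ _ _ _ _ _ _ _ R1P GP R1P) => // i; case: (SE i) => [_ []].
have L2c : corner Gs Fs L2s.
  split; first by apply: (prodC _ _ _ _ _ _ _ _ _ GP L2P L2P) => // i; case: (SE i) => [_ _ []].
  by apply: (prodC _ _ _ _ _ _ _ _ _ L2P FsP L2P) => // i; case: (SE i) => [_ _ []].
have R2c : corner Fs Gs R2s.
  split; first by apply: (prodC _ _ _ _ _ _ _ _ _ FsP R2P R2P) => // i; case: (SE i) => [_ _ _ []].
  by apply: (prodC _ _ _ _ _ _ _ _ _ R2P GP R2P) => // i; case: (SE i) => [_ _ _ []].
have u1 := small_unit FGs L1c; have u2 := small_unit GFs R1c.
have u3 := small_unit FGs L2c; have u4 := small_unit GFs R2c.
have u5 := unit_mul u4 z2u; have u6 := unit_mul u3 u5.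
have u7 := unit_mul u2 u6; have u8 := unit_mul u1 u7.
(* Four elementary matrices of length at most c and two Whitehead matrices of length at most 5c give
   14c. *)
have E3 : 1 + D 0%N = (1 + L1s) * ((1 + R1s) * ((1 + L2s) * ((1 + R2s) *
    ((1 + Zs) * (1 + Q))))) * ((1 + Y) * (1 + Q))^-1.
  apply: (mulIr z1u); rewrite mulrVK// mulrA -E1 E2 -!mulrA //.
have z1v : ((1 + Y) * (1 + Q))^-1 \is a GRing.unit by rewrite unitrV.
rewrite D0 E3; have := lenM lP u8 z1v; rewrite (lenV lP)//.
have := lenM lP u1 u7; have := lenM lP u2 u6; have := lenM lP u3 u5.
have := lenM lP u4 z2u; have := sGF _ L1c; have := sFG _ R1c; have := sGF _ L2c.
have := sFG _ R2c; lra.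
Qed.

(** Fullness with 2c, elementary matrices with 8c, their transport to other corners with 8c + 2 * 2c
    = 12c, and the swindle with 14 * 12c = 168c. *)
Lemma corner_len : forall c : R, 0 < c -> exists p n,
  [/\ p * p = p, rk p = 2^-1 ^+ n &
    forall u u', equivalent p p u u' -> l (1 - p + u) <= 168 * c].
Proof.
move=> c c0.
have one : (1 : A) * 1 = 1 by rewrite mulr1.
have rone : rk 1 = 2^-1 ^+ 0 by rewrite expr0 (rk1 rkP).
have [e [ee _ er eo]] := dyadic_partition rkP one rone.
have [|n en] := exists_full rkP lP c0 ee _ eo.
  by move=> n; rewrite er; apply: half_expn_le.
have [p [ o [m [[pp oo po op] pe oe [rp ro] sm]]]] :=
  full_elementary rkP lP c0 (ee n) (er n) en.
have sm' := elementary_small (ee n) en pp oo po op pe oe rp ro sm.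
have [q [qq rq H]] := corner_small (ee n) pp oo po op pe oe rp ro sm'.
exists q, m.+1; split=> // u u' /H; lra.
Qed.

(* A sequence of counterexamples converging to 1 could be conjugated, up to the
   n-th translate for its n-th member, into a single small corner. *)
Theorem length_continuous (c : R) : 0 < c -> exists2 d : R, 0 < d &
  forall g, g \is a GRing.unit -> rk (g - 1) < d -> l g <= c.
Proof.
(* 168 parts for the element of the small corner and one for each of the two conjugating factors. *)
move=> c0; have c1 : 0 < c / 170 by rewrite divr_gt0.
have [q [k [qq rq lq]]] := corner_len c1.
have [g [gu gc]] := len_cover lP c1.
apply: contrapT => H.
(* The factor 1/4 offsets the 4 in [common_support], so that the support [p] fits under [q]. *)
have pos n : 0 < 2^-1 ^+ k / 4 * 2^-1 ^+ n :> R.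
  have h i : 0 < 2^-1 ^+ i :> R by apply: exprn_gt0; lra.
  by rewrite mulr_gt0// divr_gt0.
have badP n : exists x, [/\ x \is a GRing.unit,
    rk (x - 1) < 2^-1 ^+ k / 4 * 2^-1 ^+ n & c < l x].
  apply: contrapT => /forallNP nx; apply: H.
  exists (2^-1 ^+ k / 4 * 2^-1 ^+ n) => // x xu xr.
  by rewrite leNgt; apply/negP => xl; apply: (nx x).
have [x xP] := choice badP.
pose a n := (g n)^-1 * x n * g n - 1; pose a' n := (g n)^-1 * (x n)^-1 * g n - 1.
have ra n : rk (a n) <= 2^-1 ^+ k / 4 * 2^-1 ^+ n.
  have -> : a n = (g n)^-1 * (x n - 1) * g n.
    by rewrite /a mulrBr mulrBl mulr1 mulVr.
  have [_ h _] := xP n; have := rkMl rkP ((g n)^-1 * (x n - 1)) (g n).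
  by have := rkMr rkP (g n)^-1 (x n - 1); lra.
have [p [pp pa rp]] := common_support rkP ra.
have [|p' [v [w [e sp]]]] := compare_le rkP pp qq; first by rewrite rq; lra.
have one (y : A) : subidem y 1 by split; rewrite ?mulr1 ?mul1r.
have [h [h' [[_ _ h'h hh'] hp ph]]] := equivalent_extend rkP (mulr1 1) (one p) (one p') e.
have [hu hV] := unit_intro hh' h'h.
(* The index is chosen after [h]: the n-th member was conjugated in advance by [g n], so [h] can be
   replaced by the short element h g_n^-1. *)
have [n ln] := gc _ hu; have [xu _ lx] := xP n.
have [pan anp] := pa n.
have E1 : (1 + a n) * (1 + a' n) = 1.
  by rewrite /a /a' !(addrC 1) !subrK !mulrA mulrK// mulrK// mulVr.
have E2 : (1 + a' n) * (1 + a n) = 1.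
  by rewrite /a /a' !(addrC 1) !subrK !mulrA mulrK// mulrVK// mulVr.
have E0 : 1 + a n = (g n)^-1 * x n * g n by rewrite /a addrC subrK.
clearbody a a'.
(* The inverse 1 + a' has the same support: these two formulas exhibit [a'] as a left and as a right
   multiple built from [a]. *)
have a'E : a' n = - a n - a n * a' n.
  have : a' n = (1 + a n) * (1 + a' n) - 1 - a n - a n * a' n by peirce.
  by rewrite E1 => {1}->; peirce.
have a'E2 : a' n = - a n - a' n * a n.
  have : a' n = (1 + a' n) * (1 + a n) - 1 - a n - a' n * a n by peirce.
  by rewrite E2 => {1}->; peirce.
have [pa' a'p] : p * a' n = a' n /\ a' n * p = a' n.
  by split; [rewrite {1}a'E [RHS]a'E|rewrite {1}a'E2 [RHS]a'E2]; peirce.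
have qC y : p * y = y -> y * p = y -> corner q q (h * y * h').
  move=> py yp; apply: (corner_sub sp sp).
  have -> : h * y * h' = v * y * w by rewrite -hp -ph -{1}py -{1}yp !mulrA.
  by case: e => [[? ?] [? ?] ? ?]; split; peirce.
have [b bE] : exists b, b = h * a n * h' by eexists.
have [b' b'E] : exists b', b' = h * a' n * h' by eexists.
have bC : corner q q b by rewrite bE; exact: qC.
have bC' : corner q q b' by rewrite b'E; exact: qC.
have bb1 : b + b' + b * b' = 0.
  have -> : b + b' + b * b' = h * ((1 + a n) * (1 + a' n) - 1) * h'.
    by rewrite bE b'E; peirce.
  by rewrite E1 subrr mulr0 mul0r.
have bb2 : b' + b + b' * b = 0.
  have -> : b' + b + b' * b = h * ((1 + a' n) * (1 + a n) - 1) * h'.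
    by rewrite bE b'E; peirce.
  by rewrite E2 subrr mulr0 mul0r.
have qb : equivalent q q (q + b) (q + b').
  case: bC bC' => [h1 h2] [h3 h4].
  have h5 : (q + b') * (q + b) = q + (b' + b + b' * b) by peirce.
  have h6 : (q + b) * (q + b') = q + (b + b' + b * b') by peirce.
  by split; [split|split|rewrite h5 bb2 addr0|rewrite h6 bb1 addr0]; peirce.
have := lq _ _ qb; have -> : 1 - q + (q + b) = 1 + b by peirce.
have gnu := gu n.
have gV : (g n)^-1 \is a GRing.unit by rewrite unitrV.
have bu : 1 + b = (h * (g n)^-1) * x n * (h * (g n)^-1)^-1.
  rewrite invrM// invrK hV.
  have -> : h * (g n)^-1 * x n * (g n * h') = h * (1 + a n) * h' by rewrite E0 !mulrA.
  by rewrite bE; peirce.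
have wu := unit_mul hu gV.
have wV : (h * (g n)^-1)^-1 \is a GRing.unit by rewrite unitrV.
have wxu := unit_mul wu xu; have bu' := unit_mul wxu wV; rewrite -bu in bu'.
have xE : x n = (h * (g n)^-1)^-1 * (1 + b) * (h * (g n)^-1).
  rewrite bu; move: wu; move: (h * (g n)^-1) (x n) => y z yu.
  by rewrite -mulrA mulrVK// mulKr.
have := lenM lP (unit_mul wV bu') wu; have := lenM lP wV bu'.
by rewrite -xE (lenV lP)//; lra.
Qed.

End Swindle.

(** * Concentration of measure in general linear groups *)

Section Variance.
Variable R : realFieldType.

(* The variance of f for the uniform probability on S is at most v, cleared of
   denominators. *)
Definition variance_le (T : finType) (S : {set T}) (f : T -> R) (v : R) :=
  #|S|%:R * (\sum_(x in S) f x ^+ 2) - (\sum_(x in S) f x) ^+ 2 <= v * #|S|%:R ^+ 2.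

Lemma sum_sqr_diff (T : finType) (S : {set T}) (f : T -> R) (c : R) :
  \sum_(x in S) (f x - c) ^+ 2 =
  \sum_(x in S) f x ^+ 2 - 2 * c * (\sum_(x in S) f x) + #|S|%:R * c ^+ 2.
Proof.
rewrite (eq_bigr (fun x => f x ^+ 2 + (- (2 * c) * f x + c ^+ 2))); last first.
  by move=> x _; ring.
by rewrite !big_split /= -big_distrr /= sumr_const -mulr_natl; ring.
Qed.

(** Summing (f x - f y)^2 over all pairs gives twice the left-hand side of [variance_le]. *)
Lemma oscillation_variance (T : finType) (S : {set T}) (f : T -> R) (d : R) :
  (forall x y, x \in S -> y \in S -> `|f x - f y| <= d) -> variance_le S f (d ^+ 2).
Proof.
move=> fd; rewrite /variance_le.
have d2 x y : x \in S -> y \in S -> (f x - f y) ^+ 2 <= d ^+ 2.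
  by move=> xS yS; rewrite -real_normK ?num_real// lerXn2r ?nnegrE// ?fd//
    (le_trans _ (fd _ _ xS yS)).
have : \sum_(y in S) \sum_(x in S) (f x - f y) ^+ 2 <=
    \sum_(y in S) \sum_(x in S) d ^+ 2.
  by apply: ler_sum => y yS; apply: ler_sum => x xS; exact: d2.
rewrite [leRHS](_ : _ = d ^+ 2 * #|S|%:R ^+ 2); last first.
  by rewrite !sumr_const -mulrnA -[LHS]mulr_natr natrM expr2.
set Q := \sum_(x in S) f x ^+ 2; set F := \sum_(x in S) f x.
rewrite (eq_bigr (fun y => Q + (- (2 * F) * f y + #|S|%:R * f y ^+ 2))); last first.
  by move=> y _; rewrite sum_sqr_diff -/Q -/F; ring.
rewrite !big_split /= -!big_distrr /= -/F -/Q sumr_const -[Q *+ _]mulr_natl.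
have : 0 <= d ^+ 2 * #|S|%:R ^+ 2 :> R by rewrite mulr_ge0// sqr_ge0.
by move: (#|S|%:R) => s; nra.
Qed.

(** Law of total variance: the conditional variances contribute [v], and the conditional mean
    oscillates by at most [d] in the first variable. *)
Lemma variance_prod (I J : finType) (S : {set I}) (T : {set J}) (f : I -> J -> R)
    (v d : R) :
  (forall i, i \in S -> variance_le T (f i) v) ->
  (forall i i' j, i \in S -> i' \in S -> j \in T -> `|f i j - f i' j| <= d) ->
  variance_le (finset.setX S T) (fun x => f x.1 x.2) (v + d ^+ 2).
Proof.
move=> fv fd; rewrite /variance_le cardsX natrM.
have sumX (g : I -> J -> R) : \sum_(x in finset.setX S T) g x.1 x.2 =
    \sum_(i in S) \sum_(j in T) g i j.
  by rewrite pair_big_dep /=; apply: eq_bigl => -[i j]; rewrite finset.in_setX.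
rewrite (sumX (fun i j => f i j ^+ 2)) (sumX f).
pose F i := \sum_(j in T) f i j.
have FF : variance_le S F ((d * #|T|%:R) ^+ 2).
  apply: oscillation_variance => x y xS yS; rewrite /F -sumrB.
  rewrite (le_trans (ler_norm_sum _ _ _))//.
  rewrite (le_trans (ler_sum _ (fun j jT => fd x y j xS yS jT)))//.
  by rewrite sumr_const mulr_natr.
have : #|T|%:R * (\sum_(i in S) \sum_(j in T) f i j ^+ 2) <=
    \sum_(i in S) F i ^+ 2 + #|S|%:R * (v * #|T|%:R ^+ 2).
  have -> : #|S|%:R * (v * #|T|%:R ^+ 2) = \sum_(i in S) v * #|T|%:R ^+ 2.
    by rewrite sumr_const mulr_natl.
  rewrite big_distrr /= -big_split /=.
  by apply: ler_sum => i /fv; rewrite /variance_le -/(F i); lra.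
move: FF; rewrite /variance_le -/(F _).
rewrite -(eq_bigr F (fun i _ => erefl)).
move: (\sum_(i in S) \sum_(j in T) _) (\sum_(i in S) F i ^+ 2) (\sum_(i in S) F i).
have : 0 <= #|S|%:R :> R by [].
move: (#|S|%:R) (#|T|%:R) => s t s0 a b c h1 h2.
have : s * (t * a) <= s * (b + s * (v * t ^+ 2)) by rewrite ler_wpM2l.
by nra.
Qed.

Lemma variance_imset (I J : finType) (S : {set I}) (h : I -> J) (f : J -> R) (v : R) :
  {in S &, injective h} -> variance_le S (f \o h) v -> variance_le (h @: S) f v.
Proof.
by move=> hI; rewrite /variance_le !big_imset//= card_in_imset.
Qed.

End Variance.

(** * Variance and concentration for the rank metric on GL_n(K) *)

Section GeneralLinearGroup.
Variables (R : realFieldType) (K : finFieldType).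

Definition units n : {set 'M[K]_n} := [set g | g \in unitmx].

Lemma rank_col1 m n (a : 'cV[K]_n) : (\rank (block_mx 0 0 a 0 : 'M[K]_(m + n, 1 + n)) <= 1)%N.
Proof.
by rewrite block_mxEv row_mx0 rank_col_0mx rank_row_mx0 rank_leq_col.
Qed.

Lemma rank_row1 n (a : 'M[K]_1) (b : 'rV[K]_n) :
  (\rank (block_mx a b 0 0 : 'M[K]_(1 + n)) <= 1)%N.
Proof.
by rewrite block_mxEv row_mx0 rank_col_mx0 rank_leq_row.
Qed.

(** A section of the first-row map that stays within rank 2 of the identity. If the first entry of
    [v] is 0, a lower triangular factor with b y = 1 is needed to cancel the corner entry of the
    upper one. *)
Lemma first_row n (v : 'rV[K]_(1 + n)) : exists t : 'M[K]_(1 + n),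
  [/\ t \in unitmx, v != 0 -> usubmx t = v & (\rank (t - 1%:M)%R <= 2)%N].
Proof.
have [->|v0] := eqVneq v 0.
  by exists 1%:M; rewrite unitmx1 subrr mxrank0; split.
rewrite -[v]hsubmxK in v0 *; move: (lsubmx v) (rsubmx v) v0 => a b v0.
have one : 1%:M = block_mx 1%:M 0 0 1%:M :> 'M[K]_(1 + n) by rewrite -scalar_mx_block.
have unitb (x : 'M[K]_1) y : x \in unitmx -> (block_mx x y 0 1%:M : 'M[K]_(1 + n)) \in unitmx.
  by rewrite !unitmxE det_ublock det1 mulr1.
have [a0|a0] := eqVneq a 0; last first.
  exists (block_mx a b 0 1%:M); split.
  - apply: unitb; rewrite [a]mx11_scalar unitmxE det_scalar expr1 unitfE.
    by apply: contra a0 => /eqP h; rewrite [a]mx11_scalar h raddf0.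
  - by rewrite block_mxEv col_mxKu.
  - rewrite one opp_block_mx add_block_mx !subrr subr0.
    by rewrite (leq_trans (rank_row1 _ _)).
rewrite a0 in v0 *.
have [j bj] : exists j, b 0 j != 0.
  apply/existsP; apply: contraR v0 => /existsPn b0; rewrite -row_mx0; apply/eqP.
  congr row_mx; apply/rowP => j; rewrite mxE; have := b0 j.
  by rewrite negbK => /eqP.
pose y : 'cV[K]_n := \col_i ((i == j)%:R / b 0 j).
have by1 : b *m y = 1%:M.
  apply/matrixP => i k; rewrite !ord1 !mxE (bigD1 j)//= big1 ?addr0.
    by rewrite mxE eqxx mul1r mulfV.
  by move=> l /negbTE lj; rewrite mxE lj mul0r mulr0.
pose B : 'M[K]_(1 + n) := block_mx 1%:M 0 (- y) 1%:M.
exists (block_mx 1%:M b 0 1%:M *m B); split.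
- rewrite unitmx_mul unitb ?unitmx1//.
  by rewrite unitmxE det_lblock !det1 mulr1 unitr1.
- move=> _; rewrite -mul_usub_mx block_mxEv col_mxKu mul_row_block !mul1mx.
  by rewrite mulmxN by1 addrN mulmx1 add0r.
have -> : block_mx 1%:M b 0 1%:M *m B - 1%:M =
    (block_mx 1%:M b 0 1%:M - 1%:M) *m B + (B - 1%:M).
  by rewrite mulmxBl mul1mx addrA subrK.
rewrite (leq_trans (mxrank_add _ _))// -[2%N]/(1 + 1)%N leq_add//.
  rewrite (leq_trans (mxrankM_maxl _ _))// one opp_block_mx add_block_mx !subrr subr0.
  exact: rank_row1.
by rewrite /B one opp_block_mx add_block_mx !subrr subr0; exact: rank_col1.
Qed.

Definition lipschitz n (f : 'M[K]_n -> R) := forall g h,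
  g \in units n -> h \in units n -> `|f g - f h| <= (\rank (g - h)%R)%:R.

(** An invertible matrix of size n + 1 is uniquely B(c, h) t(v), with [v] its first row. Changing h
    costs the rank of the change and is left to the induction; changing c costs rank 1, and changing
    v at most 2 + 2. Hence 17 = 1^2 + 4^2 per dimension. *)
Lemma variance_units n (f : 'M[K]_n -> R) : lipschitz f ->
  variance_le (units n) f (17 * n%:R).
Proof.
elim: n f => [|n IH] f fL.
  rewrite mulr0 -[X in variance_le _ _ X](expr0n R 2).
  by apply: oscillation_variance => x y _ _; rewrite [x]flatmx0 [y]flatmx0 subrr normr0.
have [t tP] := fin_all_exists (@first_row n).
pose B c (h : 'M[K]_n) : 'M[K]_(1 + n) := block_mx 1%:M 0 c h.
pose Phi (x : 'rV[K]_(1 + n) * ('cV[K]_n * 'M[K]_n)) := B x.2.1 x.2.2 *m t x.1.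
pose D := finset.setX [set v : 'rV[K]_(1 + n) | v != 0] (finset.setX [set: 'cV[K]_n] (units n)).
have DP x : x \in D = (x.1 != 0) && (x.2.2 \in unitmx).
  by case: x => v [c h]; rewrite !finset.in_setX !inE.
have uB c h : (B c h \in unitmx) = (h \in unitmx).
  by rewrite !unitmxE det_lblock det1 mul1r.
have BB c h c' h' : B c h - B c' h' = block_mx 0 0 (c - c') (h - h').
  by rewrite /B opp_block_mx add_block_mx !subrr.
have PhiB v x y : (\rank (Phi (v, x) - Phi (v, y))%R <= \rank (B x.1 x.2 - B y.1 y.2)%R)%N.
  by rewrite /Phi /= -mulmxBl mxrankM_maxl.
have Phi_row x : x.1 != 0 -> usubmx (Phi x) = x.1.
  move=> x0; have [_ /(_ x0) tx _] := tP x.1.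
  rewrite /Phi /B -mul_usub_mx block_mxEv col_mxKu.
  rewrite -{1}[t _]vsubmxK mul_row_col mul1mx mul0mx addr0 //.
have Phi_inj : {in D &, injective Phi}.
  move=> x y; rewrite !DP => /andP[x0 _] /andP[y0 _] e.
  have e1 : x.1 = y.1 by rewrite -Phi_row// e Phi_row.
  have [tu _ _] := tP y.1.
  move: e; rewrite /Phi e1 => /(congr1 (mulmx^~ (invmx (t y.1)))).
  rewrite !mulmxK// => /eq_block_mx[_ _ e2 e3].
  by case: x y e1 e2 e3 {x0 y0 tu} => [v [c h]] [v' [c' h']] /= -> -> ->.
have PhiD : Phi @: D = units n.+1.
  apply/finset.setP => g; rewrite inE; apply/imsetP/idP => [[x]|gu].
    rewrite DP => /andP[_ xu] ->; have [tu _ _] := tP x.1.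
    by rewrite unitmx_mul uB xu.
  pose v := usubmx (g : 'M[K]_(1 + n)).
  have v0 : v != 0.
    apply/eqP => v0; have : v *m invmx g = row_mx 1%:M 0.
      by rewrite mul_usub_mx mulmxV// -[1%:M]/(1%:M : 'M[K]_(1 + n)) scalar_mx_block
        block_mxEv col_mxKu.
    rewrite v0 mul0mx -(@row_mx0 _ 1 1 n) => /eq_row_mx[/matrixP/(_ 0 0)/eqP].
    by rewrite !mxE eqxx eq_sym oner_eq0.
  have [tu /(_ v0) tv _] := tP v.
  pose q := (g : 'M[K]_(1 + n)) *m invmx (t v).
  have uq : usubmx q = row_mx 1%:M 0.
    rewrite /q -mul_usub_mx -/v -{1}tv mul_usub_mx mulmxV// scalar_mx_block.
    by rewrite block_mxEv col_mxKu.
  have qE : q = B (dlsubmx q) (drsubmx q).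
    by rewrite -{1}[q]vsubmxK uq -[dsubmx q]hsubmxK /B block_mxEv.
  exists (v, (dlsubmx q, drsubmx q)); last by rewrite /Phi /= -qE /q mulmxKV.
  by rewrite DP /= v0 -(uB (dlsubmx q)) -qE unitmx_mul unitmx_inv tu gu.
rewrite -PhiD; apply: variance_imset => //.
have -> : 17 * n.+1%:R = (17 * n%:R + 1 ^+ 2) + 4 ^+ 2 :> R by rewrite -natr1; ring.
have PhiU x : x.1 != 0 -> x.2.2 \in unitmx -> Phi x \in units n.+1.
  by move=> x0 xu; rewrite -PhiD; apply: imset_f; rewrite DP x0.
apply: (variance_prod (f := fun v x => f (Phi (v, x)))) => [v|v v' [c h]].
  rewrite inE => v0; have [tu _ _] := tP v.
  apply: (variance_prod (f := fun c h => f (Phi (v, (c, h))))) => [c _|c c' h].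
    apply: IH => h h' hu hu'; rewrite !inE in hu hu'.
    rewrite (le_trans (fL _ _ (PhiU _ _ _) (PhiU _ _ _)))// ler_nat.
    by rewrite (leq_trans (PhiB _ _ _))// BB subrr block_mxEv row_mx0 rank_col_0mx rank_row_0mx.
  rewrite !inE => _ _ hu.
  rewrite (le_trans (fL _ _ (PhiU _ _ _) (PhiU _ _ _)))// -[leRHS]/(1%:R) ler_nat.
  by rewrite (leq_trans (PhiB _ _ _))// BB subrr; exact: rank_col1.
rewrite !inE => v0 v0' /= hu.
rewrite (le_trans (fL _ _ (PhiU _ _ _) (PhiU _ _ _)))// ler_nat /Phi /=.
rewrite -mulmxBr (leq_trans (mxrankM_maxr _ _))//.
have -> : t v - t v' = (t v - 1%:M) - (t v' - 1%:M) by rewrite opprB addrA subrK.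
have [_ _ r1] := tP v; have [_ _ r2] := tP v'.
by rewrite (leq_trans (mxrank_add _ _))// mxrank_opp (leq_add r1 r2).
Qed.

End GeneralLinearGroup.

(** Chebyshev's inequality for the rank distance to [A], a 1-Lipschitz function. Its mean is
    controlled because it vanishes on a set of proportion at least 1/k, so its second moment is at
    most k + 1 times the variance bound. *)
Lemma units_concentration (K : finFieldType) n (A : {set 'M[K]_n}) (k r : nat) :
  A \subset units K n -> (#|units K n| <= k * #|A|)%N ->
  (#|[set h in units K n | [forall a in A, (r <= \rank (h - a)%R)%N]]| * r ^ 2 <=
    17 * n * k.+1 * #|units K n|)%N.
Proof.
move=> AU kA; set B := [set h in _ | _].
have U0 : (0 < #|units K n|)%N by apply/card_gt0P; exists 1%:M; rewrite inE unitmx1.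
have [a0 a0A] : exists a0, a0 \in A.
  by apply/set0Pn; apply: contraTneq kA => ->; rewrite cards0 muln0 -ltnNge.
pose m h := [arg min_(a < a0 in A) \rank (h - a)%R].
have mA h : m h \in A by rewrite /m; case: arg_minnP.
have mP h a : a \in A -> (\rank (h - m h)%R <= \rank (h - a)%R)%N.
  by rewrite /m; case: arg_minnP => // i _ H /H.
pose f h : rat := (\rank (h - m h)%R)%:R.
have fL : lipschitz f.
  have one g h : f g <= f h + (\rank (g - h)%R)%:R.
    rewrite /f -natrD ler_nat addnC (leq_trans (mP _ _ (mA h)))//.
    by rewrite -(subrK h g) -addrA addrK mxrank_add.
  move=> g h _ _; rewrite ler_norml; have := one g h; have := one h g.
  rewrite -(opprB g h) mxrank_opp.
  by move: (f g) (f h) => x y h1 h2; apply/andP; split; lra.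
have fA a : a \in A -> f a = 0.
  by move=> /(mP a); rewrite subrr mxrank0 leqn0 /f => /eqP ->.
have := variance_units fL; rewrite /variance_le.
set Q := \sum_(x in _) f x ^+ 2; set F := \sum_(x in _) f x; set u := #|_|%:R.
move=> V; set v := 17 * n%:R in V.
have v0 : 0 <= v by rewrite mulr_ge0.
have u0 : 0 < u by rewrite ltr0n.
(* Every point of [A] deviates from the mean by the whole mean. *)
have FA : #|A|%:R * F ^+ 2 <= u * (u * Q - F ^+ 2).
  have : \sum_(x in A) (f x - F / u) ^+ 2 <= \sum_(x in units K n) (f x - F / u) ^+ 2.
    rewrite [leRHS](big_setID A) /= (finset.setIidPr AU) lerDl.
    by apply: sumr_ge0 => x _; exact: sqr_ge0.
  rewrite (eq_bigr (fun=> (F / u) ^+ 2)); last by move=> x /fA ->; rewrite sub0r sqrrN.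
  rewrite sumr_const -[X in X <= _ -> _]mulr_natl sum_sqr_diff -/Q -/F -/u => h.
  have : u ^+ 2 * (#|A|%:R * (F / u) ^+ 2) <= u ^+ 2 *
    (Q - 2 * (F / u) * F + u * (F / u) ^+ 2) by apply: ler_wpM2l h; exact: sqr_ge0.
  have -> : u ^+ 2 * (#|A|%:R * (F / u) ^+ 2) = #|A|%:R * F ^+ 2.
    by field; rewrite gt_eqF.
  have -> // : u ^+ 2 * (Q - 2 * (F / u) * F + u * (F / u) ^+ 2) = u * (u * Q - F ^+ 2).
    by field; rewrite gt_eqF.
have uA : u <= k%:R * #|A|%:R by rewrite -natrM ler_nat.
have F2 : F ^+ 2 <= k%:R * v * u ^+ 2.
  rewrite -(ler_pM2l u0).
  have : u * F ^+ 2 <= k%:R * #|A|%:R * F ^+ 2 by rewrite ler_wpM2r// sqr_ge0.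
  have : k%:R * (#|A|%:R * F ^+ 2) <= k%:R * (u * (u * Q - F ^+ 2)) by rewrite ler_wpM2l.
  have : k%:R * (u * (u * Q - F ^+ 2)) <= k%:R * (u * (v * u ^+ 2)).
    by rewrite ler_wpM2l// ler_wpM2l// ltW.
  by lra.
have Qb : Q <= k.+1%:R * v * u.
  by rewrite -(ler_pM2l u0) -natr1; move: V F2; rewrite expr2; lra.
have BQ : #|B|%:R * r%:R ^+ 2 <= Q.
  rewrite /Q (big_setID B) /= (finset.setIidPr _); last first.
    by apply/fintype.subsetP => x; rewrite inE => /andP[].
  rewrite -[leLHS]addr0 lerD//; last by apply: sumr_ge0 => x _; exact: sqr_ge0.
  rewrite mulr_natl -sumr_const; apply: ler_sum => x; rewrite inE => /andP[_ /forall_inP h].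
  by rewrite lerXn2r ?nnegrE// ler_nat h.
have := le_trans BQ Qb; rewrite -natrX /v -!natrM ler_nat.
by rewrite (mulnC _.+1).
Qed.

(** * The completion as a rank ring *)

Local Open Scope classical_set_scope.
Local Open Scope ring_scope.

Section MinfRank.
Variables (R : realType) (K : fieldType).
Local Notation M := (Minf R K).
Local Notation rk := (@Minf_rank R K).

Definition in_Minf_mx n (a : 'M[K]_(pow2 n)) : M := in_Minf (in_lim R a).

Lemma rank_in_Minf (a : matlim K R) : rk (in_Minf a) = nrank a.
Proof.
rewrite /in_Minf Minf_rankE.
by rewrite (_ : (fun n => _) = (fun=> nrank a) :> (nat -> R))// lim_cst.
Qed.

Lemma rank_in_Minf_mx n (a : 'M[K]_(pow2 n)) : rk (in_Minf_mx a) = (\rank a)%:R / (2 ^ n)%:R.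
Proof. by rewrite /in_Minf_mx rank_in_Minf nrankE. Qed.

Lemma in_Minf_mxM n (a b : 'M[K]_(pow2 n)) : in_Minf_mx (a *m b) = in_Minf_mx a * in_Minf_mx b.
Proof. by rewrite /in_Minf_mx in_limM in_MinfM. Qed.

Lemma in_Minf_mxB n (a b : 'M[K]_(pow2 n)) : in_Minf_mx (a - b) = in_Minf_mx a - in_Minf_mx b.
Proof. by rewrite /in_Minf_mx in_limD in_limN in_MinfB. Qed.

Lemma in_Minf_mx1 n : in_Minf_mx (1%:M : 'M[K]_(pow2 n)) = 1.
Proof. by rewrite /in_Minf_mx in_lim1 in_Minf1. Qed.

Lemma in_Minf_mx_ext n N (a : 'M[K]_(pow2 n)) : (n <= N)%N -> in_Minf_mx (ext N a) = in_Minf_mx a.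
Proof.
move=> nN; rewrite /in_Minf_mx; congr in_Minf; apply: (@matlim_eqP _ _ N) => L NL _ _.
by rewrite /at_level /= ext_trans.
Qed.

Lemma in_Minf_mx_dense (x : M) (e : R) : 0 < e ->
  exists n (a : 'M[K]_(pow2 n)), rk (x - in_Minf_mx a) < e.
Proof.
move=> /(in_Minf_dense x)[a]; have [n [b ->]] := in_lim_surj a.
by rewrite mdist_MinfE; exists n, b.
Qed.

Lemma rk_distM (x y x' y' : M) : rk (x * y - x' * y') <= rk (x - x') + rk (y - y').
Proof. exact: mdist_MinfM. Qed.

Lemma rk_lipschitz (x y : M) : rk x <= rk y + rk (x - y).
Proof. by rewrite addrC -{1}(subrK y x); exact: Minf_rankD. Qed.

Lemma rk_sym (x y : M) : rk (x - y) = rk (y - x).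
Proof. by rewrite -Minf_rankN opprB. Qed.

Lemma Minf_Frobenius (x y z : M) : rk (x * y) + rk (y * z) <= rk y + rk (x * y * z).
Proof.
rewrite leNgt; apply/negP => h.
(* Approximating the three factors within e costs 2e for each double product, e for y and 3e for the
   triple product, 8e in all. *)
pose e := (rk (x * y) + rk (y * z) - rk y - rk (x * y * z)) / 8.
have e0 : 0 < e by rewrite /e; lra.
have [n1 [a1 h1]] := in_Minf_mx_dense x e0; have [n2 [a2 h2]] := in_Minf_mx_dense y e0.
have [n3 [a3 h3]] := in_Minf_mx_dense z e0.
pose N := maxn n1 (maxn n2 n3).
have l1 : (n1 <= N)%N by rewrite leq_maxl.
have l2 : (n2 <= N)%N by rewrite !leq_max leqnn orbT.
have l3 : (n3 <= N)%N by rewrite !leq_max leqnn !orbT.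
rewrite -(in_Minf_mx_ext a1 l1) in h1; rewrite -(in_Minf_mx_ext a2 l2) in h2.
rewrite -(in_Minf_mx_ext a3 l3) in h3.
move: (ext N a1) (ext N a2) (ext N a3) h1 h2 h3 => a b c h1 h2 h3.
have F : rk (in_Minf_mx a * in_Minf_mx b) + rk (in_Minf_mx b * in_Minf_mx c) <=
    rk (in_Minf_mx b) + rk (in_Minf_mx a * in_Minf_mx b * in_Minf_mx c).
  rewrite -!in_Minf_mxM !rank_in_Minf_mx -!mulrDl ler_wpM2r ?invr_ge0//.
  by rewrite -!natrD ler_nat mxrank_Frobenius.
have := rk_lipschitz (x * y) (in_Minf_mx a * in_Minf_mx b).
have := rk_lipschitz (y * z) (in_Minf_mx b * in_Minf_mx c).
have := rk_lipschitz (in_Minf_mx b) y; have := rk_lipschitz (in_Minf_mx a * in_Minf_mx b * in_Minf_mx c) (x * y * z).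
have := rk_distM x y (in_Minf_mx a) (in_Minf_mx b); have := rk_distM y z (in_Minf_mx b) (in_Minf_mx c).
have := rk_distM (in_Minf_mx a * in_Minf_mx b) (in_Minf_mx c) (x * y) z.
have := rk_distM (in_Minf_mx a) (in_Minf_mx b) x y.
rewrite (rk_sym _ x) (rk_sym _ y) (rk_sym _ z).
have : e * 8 = rk (x * y) + rk (y * z) - rk y - rk (x * y * z) by rewrite /e; lra.
by lra.
Qed.

Lemma Minf_rank_complete (u : nat -> M) (c : R) :
  (forall n, rk (u n.+1 - u n) <= c * 2^-1 ^+ n) ->
  exists l, forall e : R, 0 < e -> exists N, forall n, (N <= n)%N -> rk (u n - l) < e.
Proof.
move=> uc.
have c0 : 0 <= c.
  have := uc 0%N; rewrite expr0 mulr1; apply: le_trans.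
  by have := Minf_rankD (u 1%N - u 0%N) (- (u 1%N - u 0%N));
    rewrite subrr Minf_rank0 Minf_rankN; lra.
have tail N k : rk (u (N + k)%N - u N) <= 2 * (c * 2^-1 ^+ N) - 2 * (c * 2^-1 ^+ (N + k)).
  elim: k => [|k IH]; first by rewrite addn0 !subrr Minf_rank0.
  have := Minf_rankD (u (N + k).+1 - u (N + k)%N) (u (N + k)%N - u N).
  rewrite addnS addrA subrK; have := uc (N + k)%N; rewrite exprS; lra.
have tail' N n : (N <= n)%N -> rk (u n - u N) <= 2 * (c * 2^-1 ^+ N).
  move=> /subnKC <-; have := tail N (n - N)%N.
  have : 0 <= c * 2^-1 ^+ (N + (n - N)) by rewrite mulr_ge0// exprn_ge0//; lra.
  by lra.
have cauchy_u : cauchy (u @ \oo).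
  apply/cauchy_seqP => e e0.
  have [N HN] : exists N, 2^-1 ^+ N < e / (4 * (c + 1)).
    have h : 0 < e / (4 * (c + 1)) by rewrite divr_gt0//; lra.
    exact: half_expn_small.
  exists N => m n Nm Nn; rewrite mdist_MinfE.
  have := Minf_rankD (u m - u N) (u N - u n); rewrite addrA subrK.
  have := tail' _ _ Nm; have := tail' _ _ Nn; rewrite (rk_sym (u n)).
  suff : 4 * (c * 2^-1 ^+ N) < e by lra.
  move: HN; rewrite ltr_pdivlMr; last by lra.
  have : 0 <= 2^-1 ^+ N :> R by rewrite exprn_ge0//; lra.
  by nra.
have [y /cvg_seqP Hy] := Minf_complete cauchy_u.
exists y => e /Hy[N HN]; exists N => n /HN.
by rewrite mdist_MinfE rk_sym.
Qed.

(** In the rank factorizations of [a] and [b] the outer factors next to [x] are cancelled, so that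
    the two truncated identities meet. *)
Lemma mx_prime n (a b : 'M[K]_n) : exists x : 'M[K]_n,
  (minn (\rank a) (\rank b) <= \rank (a *m x *m b))%N.
Proof.
exists (invmx (row_ebase a) *m invmx (col_ebase b)).
set x := _ *m _ *m b.
have xE : invmx (col_ebase a) *m x *m invmx (row_ebase b) =
    pid_mx (minn (\rank a) (\rank b)).
  have ha : invmx (col_ebase a) *m a = pid_mx (\rank a) *m row_ebase a.
    by rewrite -{2}(mulmx_ebase a) -mulmxA mulKmx ?col_ebase_unit.
  have hb : b *m invmx (row_ebase b) = col_ebase b *m pid_mx (\rank b).
    by rewrite -{1}(mulmx_ebase b) mulmxK ?row_ebase_unit.
  rewrite /x !mulmxA ha -mulmxA hb !mulmxA mulmxK ?row_ebase_unit//.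
  rewrite -(mulmxA (pid_mx _)) mulVmx ?col_ebase_unit// mulmx1.
  rewrite mul_pid_mx; congr pid_mx; apply/minn_idPr.
  by rewrite geq_min rank_leq_row.
have rn : (minn (\rank a) (\rank b) <= n)%N by rewrite geq_min rank_leq_row.
rewrite -(rank_pid_mx K rn rn) -xE.
by rewrite (leq_trans (mxrankM_maxl _ _))// mxrankM_maxr.
Qed.

(** Replace the truncated identity in the rank factorization of [a] by the full one. *)
Lemma mx_unit_near n (a : 'M[K]_n) : exists2 b : 'M[K]_n, b \in unitmx &
  (\rank (a - b)%R + \rank a <= n)%N.
Proof.
exists (col_ebase a *m row_ebase a).
  by rewrite unitmx_mul col_ebase_unit row_ebase_unit.
rewrite -{1}(mulmx_ebase a) -{2}[col_ebase a]mulmx1 -mulmxBl -mulmxBr.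
rewrite -mxrank_opp -mulNmx -mulmxN opprB -/(copid_mx _).
have rn : (\rank a <= n)%N by exact: rank_leq_row.
have : (\rank (col_ebase a *m copid_mx (\rank a) *m row_ebase a) <= n - \rank a)%N.
  by rewrite -(rank_copid_mx K rn) (leq_trans (mxrankM_maxl _ _))// mxrankM_maxr.
by move=> h; rewrite (leq_trans (leq_add h (leqnn _)))// subnK.
Qed.

Definition finite_level (x : M) := exists n (a : 'M[K]_(pow2 n)), x = in_Minf_mx a.

Lemma finite_level2 x y : finite_level x -> finite_level y ->
  exists n (a b : 'M[K]_(pow2 n)), x = in_Minf_mx a /\ y = in_Minf_mx b.
Proof.
move=> [n [a ->]] [m [b ->]]; exists (maxn n m), (ext _ a), (ext _ b).
by rewrite !in_Minf_mx_ext// ?leq_maxl ?leq_maxr.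
Qed.

Lemma finite_levelB x y : finite_level x -> finite_level y -> finite_level (x - y).
Proof.
by move=> fx fy; have [n [a [b [-> ->]]]] := finite_level2 fx fy;
  exists n, (a - b); rewrite in_Minf_mxB.
Qed.

Lemma finite_levelM x y : finite_level x -> finite_level y -> finite_level (x * y).
Proof.
by move=> fx fy; have [n [a [b [-> ->]]]] := finite_level2 fx fy;
  exists n, (a *m b); rewrite in_Minf_mxM.
Qed.

Lemma finite_level1 : finite_level 1.
Proof. by exists 0%N, 1%:M; rewrite in_Minf_mx1. Qed.

Lemma finite_level_regular x : finite_level x -> exists y,
  [/\ finite_level y, x * y * x = x & y * x * y = y].
Proof.
move=> [n [a ->]]; have [p [g [fp pa ag]]] : exists p g : M,
    [/\ finite_level p, p * in_Minf_mx a = g & in_Minf_mx a * g = in_Minf_mx a].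
  exists (in_Minf_mx (pinvmx a)), (in_Minf_mx (pinvmx a) * in_Minf_mx a); split=> //.
    by exists n, (pinvmx a).
  by rewrite -!in_Minf_mxM mulmxA mulmxKpV.
have gg : g * g = g by rewrite -{1}pa -mulrA ag.
exists (g * p); split; try by peirce.
by rewrite -pa; do !apply: finite_levelM => //; exists n, a.
Qed.

Lemma Minf_rankB (x y : M) : rk (x - y) <= rk x + rk y.
Proof. by rewrite -(Minf_rankN y); exact: Minf_rankD. Qed.

(* McCoy's lemma, with an estimate. *)
Lemma regular_step b w b' : b * w * b = b -> finite_level w -> finite_level b' ->
  exists w', [/\ finite_level w', b' * w' * b' = b' &
    rk (w' - w) <= 2 * rk (b' - b)].
Proof.
move=> bwb fw fb'; pose c := b' - b' * w * b'.
have fc : finite_level c by do !apply: finite_levelB => //; do !apply: finite_levelM.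
(* A reflexive inverse [y] has rank at most that of the defect [c], and [c] is small since it
   vanishes when b' = b. *)
have [y [fy cyc ycy]] := finite_level_regular fc.
pose z := (1 - w * b') * y * (1 - b' * w).
have f1 := finite_level1.
have fz : finite_level z.
  by do !apply: finite_levelM => //; apply: finite_levelB => //; apply: finite_levelM.
exists (w - (0 - z)); split.
- do 2!apply: finite_levelB => //.
  by rewrite -(subrr 1); exact: finite_levelB.
- rewrite sub0r opprK mulrDr mulrDl.
  have -> : b' * z * b' = c * y * c.
    by rewrite /z /c; peirce.
  by rewrite cyc /c; peirce.
have cE : c = (b' - b) * (1 - w * b') - b * w * (b' - b).
  have -> : (b' - b) * (1 - w * b') - b * w * (b' - b) =
    b' - b - b' * w * b' + b * w * b by peirce.
  by rewrite bwb /c; peirce.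
have -> : w - (0 - z) - w = z by peirce.
have := Minf_rankB ((b' - b) * (1 - w * b')) (b * w * (b' - b)); rewrite -cE.
have := Minf_rankMl (b' - b) (1 - w * b'); have := Minf_rankMr (b * w) (b' - b).
have := Minf_rankMl ((1 - w * b') * y) (1 - b' * w).
have := Minf_rankMr (1 - w * b') y; have := Minf_rankMl (y * c) y.
by rewrite -/z ycy; have := Minf_rankMr y c; lra.
Qed.

(** Unrelated inner inverses of matrices approximating [x] need not converge. [regular_step]
    corrects the previous one instead, which makes the sequence Cauchy. *)
Lemma Minf_regular (x : M) : exists y, x * y * x = x.
Proof.
have h0 n : 0 < 2^-1 ^+ n :> R by apply: exprn_gt0; lra.
have bP n : exists b : M, finite_level b /\ rk (x - b) < 2^-1 ^+ n.
  by have [k [a ha]] := in_Minf_mx_dense x (h0 n); exists (in_Minf_mx a); split=> //; exists k, a.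
have [b {}bP] := choice bP.
have stepP (s : nat * M) : exists w', b s.1 * s.2 * b s.1 = b s.1 -> finite_level s.2 ->
    [/\ finite_level w', b s.1.+1 * w' * b s.1.+1 = b s.1.+1 &
    rk (w' - s.2) <= 2 * rk (b s.1.+1 - b s.1)].
  have [[h1 h2]|h] := pselect (b s.1 * s.2 * b s.1 = b s.1 /\ finite_level s.2).
    by have [w'] := regular_step h1 h2 (bP s.1.+1).1; exists w'.
  by exists 0 => h1 h2; case: h.
have [F FP] := choice stepP.
have [w0 [fw0 bw0 _]] := finite_level_regular (bP 0%N).1.
pose w := fix w n := if n is n'.+1 then F (n', w n') else w0.
have wS n : w n.+1 = F (n, w n) by [].
have w0E : w 0%N = w0 by []; clearbody w.
have wP n : finite_level (w n) /\ b n * w n * b n = b n.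
  elim: n => [|n [IH1 IH2]]; first by rewrite w0E.
  by rewrite wS; have /= [] := FP (n, w n) IH2 IH1.
have wd n : rk (w n.+1 - w n) <= 4 * 2^-1 ^+ n.
  have [h1 h2] := wP n; have /= [_ _] := FP (n, w n) h2 h1; rewrite -wS.
  have := Minf_rankB (x - b n) (x - b n.+1).
  have -> : x - b n - (x - b n.+1) = b n.+1 - b n by peirce.
  have [_] := bP n; have [_] := bP n.+1; rewrite exprS; have := h0 n; lra.
have [y yP] := Minf_rank_complete wd.
exists y; apply/eqP; rewrite -subr_eq0; apply/eqP/Minf_rank_eq0.
apply/eqP; rewrite eq_le; apply/andP; split; last first.
  by have := Minf_rankB (x * y * x - x) (x * y * x - x); rewrite subrr Minf_rank0; lra.
rewrite leNgt; apply/negP => e0.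
set e := rk _ in e0.
have [|N HN] := yP (e / 8); first by lra.
have [|N' HN'] := @half_expn_small R (e / 8); first by lra.
pose n := maxn N N'.
have hb : rk (x - b n) < e / 8.
  have [_ h] := bP n; apply: lt_trans h _; apply: le_lt_trans HN'.
  by apply: half_expn_le; exact: leq_maxr.
have hw : rk (w n - y) < e / 8 by apply: HN; exact: leq_maxl.
have [_ bwb] := wP n.
have := Minf_rankB (x * y * x - b n * w n * b n) (x - b n).
rewrite bwb; have -> : x * y * x - b n - (x - b n) = x * y * x - x by peirce.
have := rk_distM (x * y) x (b n * w n) (b n); have := rk_distM x y (b n) (w n).
by rewrite bwb (rk_sym y) -/e; lra.
Qed.

Lemma Minf_prime (x y : M) (e : R) : 0 < e ->
  exists z, Num.min (rk x) (rk y) - e <= rk (x * z * y).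
Proof.
move=> e0; have e1 : 0 < e / 4 by lra.
have [n1 [a1 h1]] := in_Minf_mx_dense x e1; have [n2 [a2 h2]] := in_Minf_mx_dense y e1.
rewrite -(in_Minf_mx_ext a1 (leq_maxl n1 n2)) in h1.
rewrite -(in_Minf_mx_ext a2 (leq_maxr n1 n2)) in h2.
move: (ext _ a1) (ext _ a2) h1 h2 => a b h1 h2.
have [z hz] := mx_prime a b; exists (in_Minf_mx z).
have : Num.min (rk (in_Minf_mx a)) (rk (in_Minf_mx b)) <= rk (in_Minf_mx a * in_Minf_mx z * in_Minf_mx b).
  rewrite -!in_Minf_mxM !rank_in_Minf_mx ge_min !ler_pM2r ?invr_gt0 ?ltr0n ?expn_gt0// !ler_nat.
  by rewrite -geq_min.
have := rk_lipschitz (in_Minf_mx a * in_Minf_mx z * in_Minf_mx b) (x * in_Minf_mx z * y).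
have := rk_distM (in_Minf_mx a * in_Minf_mx z) (in_Minf_mx b) (x * in_Minf_mx z) y.
have := rk_distM (in_Minf_mx a) (in_Minf_mx z) x (in_Minf_mx z).
have := rk_lipschitz x (in_Minf_mx a); have := rk_lipschitz y (in_Minf_mx b).
rewrite subrr Minf_rank0 (rk_sym _ x) (rk_sym _ y) => l1 l2 l3 l4 l5.
have : Num.min (rk x) (rk y) <= Num.min (rk (in_Minf_mx a)) (rk (in_Minf_mx b)) + e / 4.
  by rewrite addr_minl le_min !ge_min; apply/andP; split; apply/orP; [left|right]; lra.
by lra.
Qed.

Lemma Minf_dyadic n : exists2 e : M, e * e = e & rk e = 2^-1 ^+ n.
Proof.
have h : (0 < pow2 n)%N by rewrite pow2E expn_gt0.
pose i := Ordinal h; exists (in_Minf_mx (delta_mx i i)).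
  by rewrite -in_Minf_mxM mul_delta_mx.
by rewrite rank_in_Minf_mx mxrank_delta exprVn -natrX div1r.
Qed.

Lemma Minf_rank_one : rk 1 = 1.
Proof. by rewrite -(in_Minf_mx1 0) rank_in_Minf_mx mxrank1 divr1. Qed.

Lemma Minf_rank_ring : rank_ring rk.
Proof.
split.
- exact: Minf_rank_eq0.
- exact: Minf_rank0.
- exact: Minf_rank_one.
- exact: Minf_rankN.
- exact: Minf_rankD.
- exact: Minf_rankMl.
- exact: Minf_rankMr.
- exact: Minf_Frobenius.
- exact: Minf_rank_complete.
- exact: Minf_regular.
- exact: Minf_prime.
- exact: Minf_dyadic.
Qed.

Lemma in_Minf_mx_unit n (a : 'M[K]_(pow2 n)) : a \in unitmx -> in_Minf_mx a \is a GRing.unit.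
Proof.
move=> au; apply/unitrP; exists (in_Minf_mx (invmx a)).
by rewrite -!in_Minf_mxM mulVmx// mulmxV// in_Minf_mx1.
Qed.

(** A unit has rank 1, so a matrix close to it has nearly full rank and hence an invertible matrix
    nearby. *)
Lemma in_Minf_mx_unit_dense (g : M) (e : R) : g \is a GRing.unit -> 0 < e ->
  exists n, exists2 a : 'M[K]_(pow2 n), a \in unitmx & rk (g - in_Minf_mx a) < e.
Proof.
move=> gu e0; have e1 : 0 < e / 2 by lra.
have [n [a ha]] := in_Minf_mx_dense g e1; have [b bu hb] := mx_unit_near a.
exists n, b => //.
have r1 : rk g = 1.
  have := Minf_rankMr g 1; have := Minf_rankMl g g^-1.
  by rewrite mulr1 mulrV// Minf_rank_one; lra.
have hb' : rk (in_Minf_mx a - in_Minf_mx b) + rk (in_Minf_mx a) <= 1.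
  rewrite -in_Minf_mxB !rank_in_Minf_mx -mulrDl ler_pdivrMr ?ltr0n ?expn_gt0//.
  by rewrite mul1r -natrD ler_nat -pow2E.
have := rk_lipschitz g (in_Minf_mx a).
have := Minf_rankD (g - in_Minf_mx a) (in_Minf_mx a - in_Minf_mx b); rewrite addrA subrK; lra.
Qed.

End MinfRank.

(** * Fixed points on compact metric spaces *)

Section CompactMetric.
Variables (R : realType) (X : topologicalType) (d : X -> X -> R).
Hypothesis dP : is_metric d.
Hypothesis nbhsP : forall (x : X) (A : set X),
  nbhs x A <-> exists2 e : R, 0 < e & [set y | d x y < e] `<=` A.
Hypothesis Xc : compact [set: X].

Lemma metric_ge0 x y : 0 <= d x y.
Proof.
by case: dP => d0 _ ds dt; have := dt x y x; rewrite d0 (ds y x); lra.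
Qed.

Lemma metric_ball_nbhs x (e : R) : 0 < e -> nbhs x [set y | d x y < e].
Proof. by move=> e0; apply/nbhsP; exists e. Qed.

(** Without a finite subcover, the complements of finite unions of balls generate a proper filter; a
    cluster point would be adherent to the complement of its own ball. *)
Lemma finite_ball_cover (r : X -> R) : (forall x, 0 < r x) ->
  exists s : seq X, forall y, exists2 x, x \in s & d x y < r x.
Proof.
move=> r0; apply: contrapT => ns.
pose F := [set B : set X | exists s : seq X,
  forall y, (forall x, x \in s -> ~ d x y < r x) -> B y].
have FF : ProperFilter F.
  split; last split.
  - move=> [s sP]; apply: ns; exists s => y; apply: contrapT => H.
    by apply: (sP y) => x xs xy; apply: H; exists x.
  - by exists [::].
  - move=> B C [s sP] [t tP]; exists (s ++ t) => y H; split.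
      by apply: sP => x xs; apply: H; rewrite mem_cat xs.
    by apply: tP => x xs; apply: H; rewrite mem_cat xs orbT.
  - by move=> B C BC [s sP]; exists s => y /sP; exact: BC.
have [p [_ Fp]] := Xc FF filterT.
have Fb : F [set y | ~ d p y < r p].
  by exists [:: p] => y H; apply: H; rewrite mem_head.
by have [y [/= h1 h2]] := Fp _ _ Fb (metric_ball_nbhs p (r0 p)).
Qed.

Lemma finite_net (e : R) : 0 < e ->
  exists s : seq X, forall y, exists2 x, x \in s & d x y < e.
Proof. by move=> e0; exact: finite_ball_cover. Qed.

Lemma metric_bounded : exists B : R, forall x y, d x y <= B.
Proof.
have [d0 _ ds dt] := dP.
have [s sP] := finite_net ltr01.
pose m := \sum_(x <- s) \sum_(y <- s) d x y.
exists (m + 2) => x y; have [a aS ax] := sP x; have [b bS by_] := sP y.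
have : d a b <= m.
  rewrite /m (big_rem a)//= (big_rem b)//= -addrA lerDl addr_ge0//.
    by apply: sumr_ge0 => i _; exact: metric_ge0.
  by do 2!apply: sumr_ge0 => ? _; exact: metric_ge0.
have := dt x a y; have := dt a b y; rewrite (ds x a); lra.
Qed.

Lemma uniformly_continuous (h : X -> X) (e : R) : continuous h -> 0 < e ->
  exists2 r : R, 0 < r & forall x y, d x y < r -> d (h x) (h y) < e.
Proof.
have [d0 _ ds dt] := dP.
move=> hc e0; have rP x : exists r : R, 0 < r /\
    forall y, d x y < 2 * r -> d (h x) (h y) < e / 2.
  have : nbhs (h x) [set z | d (h x) z < e / 2] by apply: metric_ball_nbhs; lra.
  move=> /(hc x)/nbhsP[r r0 H]; exists (r / 2); split; first by lra.
  by move=> y xy; apply: H => /=; lra.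
have [r {}rP] := choice rP.
have [s sP] := @finite_ball_cover r (fun x => (rP x).1).
have [m m0 mr] : exists2 m : R, 0 < m & forall x, x \in s -> m <= r x.
  elim: s {sP} => [|a s [m m0 IH]]; first by exists 1.
  exists (Num.min m (r a)); first by rewrite lt_min m0 (rP a).1.
  by move=> x; rewrite inE ge_min => /predU1P[->|/IH ->//]; rewrite lexx orbT.
exists m => // x y xy; have [z zs zx] := sP x; have rz := mr z zs.
have := (rP z).2 x; have := (rP z).2 y; have := dt z x y; have := dt (h x) (h z) (h y).
have rz0 := (rP z).1.
rewrite (ds (h x) (h z)) => t1 t2 /(_ _)/wrap[]; first by lra.
move=> h1 /(_ _)/wrap[]; first by lra.
by move=> h2; lra.
Qed.

Lemma sequence_cluster (x : nat -> X) : exists p, forall (e : R) N, 0 < e ->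
  exists2 n, (N <= n)%N & d p (x n) < e.
Proof.
have [p [_ px]] := Xc (fmap_proper_filter x _) (filterT : (x @ \oo) setT).
exists p => e N e0.
have FN : (x @ \oo) [set y | exists2 n, (N <= n)%N & y = x n].
  by exists N => // n /= Nn; exists n.
by have [y [/= [n Nn ->] h]] := px _ _ FN (metric_ball_nbhs p e0); exists n.
Qed.

End CompactMetric.

(** * The displacement as a length function *)

Section DisplacementLength.
Variables (R : realType) (X : topologicalType) (d : X -> X -> R).
Hypothesis dP : is_metric d.
Hypothesis nbhsP : forall (x : X) (A : set X),
  nbhs x A <-> exists2 e : R, 0 < e & [set y | d x y < e] `<=` A.
Hypothesis Xc : compact [set: X].
Hypothesis X0 : [set: X] !=set0.
Variables (A : unitRingType) (act : GL A -> X -> X).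
Hypothesis actP : is_action act.
Hypothesis act_continuous : forall g, continuous (act g).

(* Non-units have length 0, the supremum of the empty set. *)
Definition displacement (a : A) : R :=
  sup [set r | exists g y, val g = a /\ r = d (act g y) y].

Lemma displacement_ub g y : d (act g y) y <= displacement (val g).
Proof.
apply: ub_le_sup; last by exists g, y.
have [B HB] := metric_bounded dP nbhsP Xc.
by exists B => r [h [z [_ ->]]]; exact: HB.
Qed.

Lemma displacement_le g (c : R) : (forall y, d (act g y) y <= c) ->
  displacement (val g) <= c.
Proof.
move=> gc; apply: ge_sup.
  by have [y _] := X0; exists (d (act g y) y), g, y.
by move=> r [h [y [/val_inj -> ->]]].
Qed.

Definition toGL (a : A) (au : a \is a GRing.unit) : GL A :=
  exist (fun x => x \is a GRing.unit) a au.

Lemma valM (g h : GL A) : val (g * h)%g = val g * val h. Proof. by []. Qed.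
Lemma valV (g : GL A) : val (g^-1)%g = (val g)^-1. Proof. by []. Qed.

Lemma actV g y : act g^-1%g (act g y) = y /\ act g (act g^-1%g y) = y.
Proof.
by case: actP => a1 aM; rewrite -!aM mulVg mulgV a1.
Qed.

(** For the cover, a map is coded by a modulus of uniform continuity and, for each point of a finite
    net fitting that modulus, a nearby point of a fixed finite net. [pickle] makes the codes natural
    numbers, and maps with equal codes differ by at most four steps of e / 4. *)
Lemma displacement_length : length_function displacement.
Proof.
have [d0 _ ds dt] := dP; have [a1 aM] := actP.
have V x : x \is a GRing.unit -> displacement x^-1 <= displacement x.
  move=> xu; rewrite -[x^-1]/(val (toGL xu)^-1%g); apply: displacement_le => y.
  have := displacement_ub (toGL xu) (act (toGL xu)^-1%g y).
  by rewrite (actV _ _).2 ds.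
split.
- move=> x y xu yu; rewrite -[x]/(val (toGL xu)) -[y]/(val (toGL yu)) -valM.
  apply: displacement_le => z; rewrite aM.
  have := displacement_ub (toGL xu) (act (toGL yu) z).
  have := displacement_ub (toGL yu) z.
  by have := dt (act (toGL xu) (act (toGL yu) z)) (act (toGL yu) z) z; lra.
- move=> x xu; apply/eqP; rewrite eq_le V//=.
  by rewrite -{1}[x]invrK V// unitrV.
move=> e e0; have e4 : 0 < e / 4 by lra.
have [t tP] := finite_net nbhsP Xc e4.
have [x0 _] := X0.
have indP y : exists k, d (nth x0 t k) y < e / 4.
  by have [x xt xy] := tP y; exists (index x t); rewrite nth_index.
have [ind {}indP] := choice indP.
have modP (g : GL A) : exists n : nat, forall x y, d x y < n.+1%:R^-1 ->
    d (act g x) (act g y) < e / 4.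
  have [r r0 rP] := uniformly_continuous dP nbhsP Xc (act_continuous (g := g)) e4.
  exists (Num.bound r^-1) => x y xy; apply: rP; apply: lt_trans xy _.
  rewrite invf_plt ?posrE//; apply: lt_trans (archi_boundP _) _.
    by rewrite invr_ge0 ltW.
  by rewrite ltr_nat.
have [modulus {}modP] := choice modP.
have netP n : exists s : seq X, forall y, exists2 x, x \in s & d x y < n.+1%:R^-1.
  by apply: (finite_net nbhsP Xc); rewrite invr_gt0.
have [net {}netP] := choice netP.
pose code g := pickle (modulus g, [seq ind (act g x) | x <- net (modulus g)]).
have codeP g h : code g = code h -> forall y, d (act g y) (act h y) <= e.
  move=> /(pcan_inj (@pickleK _))[mgh igh] y.
  have [x xn xy] := netP (modulus g) y.
  have hx : ind (act g x) = ind (act h x).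
    by move: igh; rewrite -mgh => /eq_in_map; exact.
  have := indP (act g x); have := indP (act h x); rewrite -hx.
  move: (nth _ _ _) => z h1 h2.
  have := modP g _ _ xy; rewrite mgh in xy; have := modP h _ _ xy.
  have := dt (act g y) (act g x) (act h y); have := dt (act g x) z (act h y).
  have := dt z (act h x) (act h y); by rewrite (ds (act g y) (act g x)) (ds (act g x) z); lra.
have decP k : exists g, forall h, code h = k -> code g = k.
  have [[g gk]|ng] := pselect (exists g, code g = k); first by exists g.
  by exists 1%g => h hk; case: ng; exists h.
have [dec {}decP] := choice decP.
exists (fun k => val (dec k)); split=> [k|x xu]; first exact: valP.
pose g := toGL xu; exists (code g).
rewrite -valV -[x]/(val g) -valM; apply: displacement_le => y.
rewrite aM; have := codeP _ _ (esym (decP _ g erefl)) (act (dec (code g))^-1%g y).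
by rewrite (actV _ _).2.
Qed.

End DisplacementLength.

(** * Almost fixed points and their cluster point *)

Section FixedPoint.
Variables (R : realType) (K : finFieldType).
Local Notation A := (Minf R K).
Local Notation rk := (@Minf_rank R K).

(** Singular matrices are sent to the default value 1, which makes the map total. *)
Definition GL_mx n (a : 'M[K]_(pow2 n)) : GL A := insubd (1%g : GL A) (in_Minf_mx R a).

Lemma val_GL_mx n (a : 'M[K]_(pow2 n)) : a \in unitmx -> val (GL_mx a) = in_Minf_mx R a.
Proof. by move=> au; rewrite val_insubd in_Minf_mx_unit. Qed.

Lemma GL_mxM n (a b : 'M[K]_(pow2 n)) : a \in unitmx -> b \in unitmx ->
  GL_mx (a *m b) = (GL_mx a * GL_mx b)%g.
Proof.
move=> au bu; apply: val_inj; rewrite valM !val_GL_mx ?in_Minf_mxM//.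
by rewrite unitmx_mul au.
Qed.

Lemma ext_unit n N (a : 'M[K]_(pow2 n)) : (n <= N)%N -> a \in unitmx ->
  ext N a \in unitmx.
Proof.
move=> nN au; have := mulmxV au => /(congr1 (ext N)); rewrite extM// ext1//.
by move=> /mulmx1_unit[].
Qed.

Lemma GL_mx_ext n N (a : 'M[K]_(pow2 n)) : (n <= N)%N -> GL_mx (ext N a) = GL_mx a.
Proof. by move=> nN; rewrite /GL_mx in_Minf_mx_ext. Qed.

Variables (X : topologicalType) (d : X -> X -> R).
Hypothesis dP : is_metric d.
Hypothesis nbhsP : forall (x : X) (B : set X),
  nbhs x B <-> exists2 e : R, 0 < e & [set y | d x y < e] `<=` B.
Hypothesis Xc : compact [set: X].
Hypothesis X0 : [set: X] !=set0.
Variable act : GL A -> X -> X.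
Hypothesis actP : is_action act.
Hypothesis act_continuous : forall g, continuous (act g).

Let l := displacement d act.

(** Continuity at 1 becomes uniform: g and h differ by the displacement of gh^-1, and gh^-1 - 1 = (g
    - h)h^-1 has rank at most that of g - h. *)
Lemma displacement_small (c : R) : 0 < c -> exists j, forall g h : GL A,
  rk (val g - val h) < 2^-1 ^+ j -> forall y, d (act g y) (act h y) <= c.
Proof.
move=> c0; have lP := displacement_length dP nbhsP Xc X0 actP act_continuous.
have [r r0 rP] := length_continuous (Minf_rank_ring R K) lP c0.
have [j jr] := half_expn_small r0; exists j => g h gh y.
have e : act g y = act (g * h^-1)%g (act h y).
  by rewrite -(actP.2) -mulgA mulVg mulg1.
rewrite e; apply: le_trans (displacement_ub dP nbhsP Xc act _ _) _.
apply: rP; first exact: valP.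
rewrite valM valV; have hu := valP h.
rewrite -(mulrV hu) -mulrBl; apply: le_lt_trans (Minf_rankMl _ _) _.
exact: lt_trans gh jr.
Qed.

Lemma almost_fixed n (e : R) : 0 < e -> exists x, forall a : 'M[K]_(pow2 n),
  a \in unitmx -> d (act (GL_mx a) x) x <= e.
Proof.
have [d0 _ ds dt] := dP.
move=> e0; have e3 : 0 < e / 3 by lra.
have e6 : 0 < e / 6 by lra.
have [j jP] := displacement_small e3.
have [s sP] := finite_net nbhsP Xc e6.
have [x0 _] := X0.
pose k := size s; pose q := #|units K (pow2 n)|.
(* With r = 2^(N - j), concentration bounds the exceptional proportion by M / (q 2^N), and M < 2^N
   makes this less than 1/q. The k + 2 comes from the k + 1 classes below. *)
pose M := (17 * q * k.+2 * 2 ^ (2 * j))%N.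
pose N := (n + j + M)%N.
have nN : (n <= N)%N by rewrite /N -addnA leq_addr.
have jN : (j <= N)%N by rewrite /N addnAC leq_addl.
pose U := units K (pow2 N).
pose p (h : 'M[K]_(pow2 N)) := act (GL_mx h) x0.
(* Net indices are below k; one extra class keeps the index type inhabited. *)
have ip h : exists i : 'I_k.+1, d (nth x0 s i) (p h) < e / 6.
  have [x xs xy] := sP (p h); have := xs; rewrite -index_mem => h1.
  by exists (inord (index x s)); rewrite inordK ?nth_index// ltnS ltnW.
have [f fP] := choice ip.
pose C (i : 'I_k.+1) := [set h in U | f h == i]%SET.
have inC i h : (h \in C i) = (h \in U) && (f h == i) by rewrite /C !inE.
have [i Ci] : exists i, (#|U| <= k.+1 * #|C i|)%N.
  apply/existsP; apply: contraT => /existsPn H.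
  have cU : #|U| = (\sum_(i < k.+1) #|C i|)%N.
    rewrite -sum1_card (partition_big f predT)//=; apply: eq_bigr => i _.
    by rewrite -sum1_card; apply: eq_bigl => h; rewrite inC.
  have : (\sum_(i < k.+1) (k.+1 * #|C i|).+1 <= \sum_(i < k.+1) #|U|)%N.
    by apply: leq_sum => i _; have := H i; rewrite -ltnNge.
  under eq_bigr do rewrite -addn1.
  by rewrite big_split /= -big_distrr /= -cU !sum_nat_const card_ord muln1
    -[leqRHS]addn0 leq_add2l.
have Cp h h' : h \in C i -> h' \in C i -> d (p h) (p h') <= e / 3.
  rewrite !inC => /andP[_ /eqP hi] /andP[_ /eqP hi'].
  have := fP h; have := fP h'; rewrite hi hi'; move: (nth _ _ _) => z.
  by have := dt (p h) z (p h'); rewrite (ds (p h) z); lra.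
have CU : C i \subset U by apply/fintype.subsetP => h; rewrite inC => /andP[].
pose r := (2 ^ (N - j))%N.
have := units_concentration r CU Ci.
set B := [set h in _ | _]%SET => cB.
have U0 : (0 < #|U|)%N by apply/card_gt0P; exists 1%:M; rewrite inE unitmx1.
have rr : (r ^ 2 * 2 ^ (2 * j) = 2 ^ N * 2 ^ N)%N.
  by rewrite /r -expnM -!expnD; congr (2 ^ _)%N; rewrite mulnC -mulnDr subnK// mul2n addnn.
have MN : (M < 2 ^ N)%N.
  apply: leq_trans (ltn_expl M (leqnn 2)) _.
  by rewrite leq_exp2l// /N leq_addl.
have Bsmall : (q * #|B| < #|U|)%N.
  have pN : (0 < 2 ^ N * 2 ^ N)%N by rewrite muln_gt0 expn_gt0.
  rewrite -(ltn_pmul2r pN) -{1}rr.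
  have -> : (q * #|B| * (r ^ 2 * 2 ^ (2 * j)) =
      #|B| * r ^ 2 * (q * 2 ^ (2 * j)))%N by lia.
  have -> : (#|U| * (2 ^ N * 2 ^ N) = 2 ^ N * (2 ^ N * #|U|))%N by lia.
  have h1 : (#|B| * r ^ 2 * (q * 2 ^ (2 * j)) <= M * (2 ^ N * #|U|))%N.
    apply: leq_trans (leq_mul cB (leqnn _)) _.
    by rewrite -/U /M -(pow2E N); lia.
  by apply: leq_ltn_trans h1 _; rewrite ltn_pmul2r// muln_gt0 expn_gt0 U0.
(* Union bound: the preimages of [B] under the q left translations cannot cover the group. *)
have [h hU hB] : exists2 h, h \in U & forall a : 'M[K]_(pow2 n), a \in unitmx ->
    ext N a *m h \notin B.
  pose Bad := (\bigcup_(a in units K (pow2 n)) [set h | (ext N a *m h)%R \in B])%SET.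
  have cBad : (#|Bad| <= q * #|B|)%N.
    rewrite /q -sum_nat_const /Bad.
    elim/big_rec2: _ => [|a S m aU Sm]; first by rewrite cards0.
    rewrite (leq_trans (leq_card_setU _ _))// leq_add// -(card_imset _ (f := mulmx (ext N a))).
      by apply/subset_leq_card/fintype.subsetP => y /imsetP[h]; rewrite inE => hB ->.
    have aN : ext N a \in unitmx by apply: ext_unit => //; move: aU; rewrite inE.
    exact: can_inj (mulKmx aN).
  have : ~~ (U \subset Bad).
    apply/negP => /subset_leq_card UB.
    by have := leq_ltn_trans (leq_trans UB cBad) Bsmall; rewrite ltnn.
  move=> /subsetPn[h hU hB]; exists h => // a au; apply: contra hB => ahB.
  by apply/finset.bigcupP; exists a; rewrite finset.in_set.
have near (a : 'M[K]_(pow2 n)) : a \in unitmx -> exists2 b, b \in C i &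
    d (act (GL_mx a) (p h)) (p b) <= e / 3.
  move=> au; have := hB a au; have hu : h \in unitmx by move: hU; rewrite inE.
  have ahu : ext N a *m h \in unitmx by rewrite unitmx_mul hu ext_unit.
  rewrite !finset.in_set ahu /= => /forall_inPn[b bC]; rewrite -ltnNge => br.
  exists b => //; have bu : b \in unitmx by move: bC; rewrite inC finset.in_set => /andP[].
  rewrite /p -(actP.2) -(GL_mx_ext _ nN) -GL_mxM ?ext_unit//; apply: jP.
  rewrite !val_GL_mx// -in_Minf_mxB rank_in_Minf_mx ltr_pdivrMr ?ltr0n ?expn_gt0//.
  rewrite (@lt_le_trans _ _ r%:R) ?ltr_nat// /r natrX exprVn.
  by rewrite [leRHS]mulrC ler_pdivlMr ?exprn_gt0// -exprD subnK// -natrX.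
exists (p h) => a au.
(* [p h] itself need not lie in the chosen piece, so a = 1 is used as well: a p(h) is close to p(b),
   which is close to p(b'), which is close to p(h). *)
have [b bC hb] := near _ au; have [b' b'C hb'] := near _ (unitmx1 _ _).
have := Cp _ _ bC b'C; have := dt (act (GL_mx a) (p h)) (p b) (p h).
have := dt (p b) (p b') (p h); rewrite (ds (p b') (p h)).
have g1 : GL_mx (1%:M : 'M[K]_(pow2 n)) = 1%g.
  by apply: val_inj; rewrite val_GL_mx ?unitmx1// in_Minf_mx1.
by move: hb'; rewrite g1 (actP.1); lra.
Qed.

Lemma fixed_point : exists x, forall g, act g x = x.
Proof.
have [d0 d1 ds dt] := dP.
have xP n : exists x, forall a : 'M[K]_(pow2 n), a \in unitmx ->
    d (act (GL_mx a) x) x <= 2^-1 ^+ n.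
  by apply: almost_fixed; apply: exprn_gt0; lra.
have [x {}xP] := choice xP.
have [p pP] := sequence_cluster nbhsP Xc x.
have eq_small y z : (forall e : R, 0 < e -> d y z <= 3 * e) -> y = z.
  move=> h; apply: d1; apply/eqP; rewrite eq_le (metric_ge0 dP) andbT leNgt.
  by apply/negP => yz; have := h (d y z / 4); lra.
have fin n (a : 'M[K]_(pow2 n)) : a \in unitmx -> act (GL_mx a) p = p.
  move=> au; apply: eq_small => e e0; have [N HN] := half_expn_small e0.
  have [r r0 rP] := uniformly_continuous dP nbhsP Xc (act_continuous (g := GL_mx a)) e0.
  (* Taking k >= n lets [x k] be almost fixed by the matrix [a], read at level k. *)
  have [|k kN pk] := pP (Num.min e r) (maxn n N); first by rewrite lt_min e0.
  move: kN; rewrite geq_max => /andP[nk Nk]; move: pk; rewrite lt_min => /andP[pe pr].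
  have := xP k _ (ext_unit nk au); rewrite GL_mx_ext// => h.
  have := half_expn_le R Nk; have := rP _ _ pr.
  have := dt (act (GL_mx a) p) (act (GL_mx a) (x k)) p; have := dt (act (GL_mx a) (x k)) (x k) p.
  by rewrite (ds (x k)); lra.
exists p => g; apply: eq_small => e e0.
have [j jP] := displacement_small e0.
have j0 : 0 < 2^-1 ^+ j :> R by apply: exprn_gt0; lra.
have [n [a au ha]] := in_Minf_mx_unit_dense (valP g) j0.
have := jP g (GL_mx a); rewrite val_GL_mx// => /(_ ha p); rewrite fin//; lra.
Qed.

End FixedPoint.

Theorem corollary1p6 (R : realType) (K : finFieldType) (X : topologicalType)
    (act : GL (Minf R K) -> X -> X) :
  [set: X] !=set0 -> compact [set: X] -> metrizable R X ->
  is_action act -> (forall g, is_homeomorphism (act g)) ->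
  exists x : X, forall g, act g x = x.
Proof.
move=> X0 Xc [d [dP nbhsP]] actP homeo.
by apply: (fixed_point dP nbhsP Xc X0 actP) => g; case: (homeo g).
Qed.
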